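(* Let $\boldsymbol\beta_3=(\beta_0,\dots,\beta_3)$ with $\beta_k\ge0$, $E=\mathcal{C}^{\boldsymbol\beta_3}(V;V)$, and let $\mathbf{W}=(W,\mathcal{W})\in\mathbf{C}^\alpha([0,T];E)$ be an $E$-valued (linear) rough path. Let $(Y,Y')\in\mathcal{D}_W^{2\alpha}(V)$ and $(Z,Z')\in\mathcal{D}_W^{2\alpha}(\mathcal{L}(V;K))$. Then for all $0\le s\le t\le T$ the following Itô type formula holds: $$\int_s^tZ_r\,dW(r,Y_r)=\int_s^tZ_rW(dr,Y_r)+\int_s^tZ_rDW(r,Y_r)\,dY_r+\frac12\Big[\int_s^tZ_rD^2W(r,Y_r)\,d\langle Y\rangle_r+\int_s^tZ_r\,d\langle\langle X,Y\rangle\rangle_r+\int_s^tZ_r\,d\langle\langle Y,X\rangle\rangle_r\Big],$$ where $$X_t=\int_0^tDW(dr,Y_r)=\lim_{|\pi|\to0}\sum_{k}\big[DW_{t_{k-1},t_k}(Y_{t_{k-1}})+(\mathcal{D}^{(2)})^2Y'_{t_{k-1}}\mathcal{W}_{t_{k-1},t_k}\big]\in\mathcal{L}(V;V),$$ $\langle Y\rangle$, $\langle\langle X,Y\rangle\rangle$ and $\langle\langle Y,X\rangle\rangle$ are the $2\alpha$-Hölder continuous quadratic compensators defined in the context, the integrals outside the bracket are rough integrals between controlled rough paths, and the three integrals inside the bracket are Young integrals.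
   Context: Fix $T>0$, $\alpha\in(\frac13,\frac12]$, separable Banach spaces $V,K$; $\Phi_{s,t}:=\Phi_t-\Phi_s$ for functions of time; tensor products carry the projective norm; all limits are over partitions $\pi$ (points $t_k$) of the relevant interval with mesh tending to $0$. $\mathcal{C}^{\boldsymbol\beta_n}(V;V)$ is the Banach space of $n$ times continuously Fréchet differentiable $\phi:V\to V$ with $\sum_{k=0}^n\sup_x\|D^k\phi(x)\|(1+\|x\|_V)^{-\beta_k}<\infty$. $\mathbf{C}^\alpha([0,T];E)$ is the set of pairs $(W,\mathcal{W})$ with $W:[0,T]\to E$ $\alpha$-Hölder, $\mathcal{W}:[0,T]^2\to E\otimes E$ with $\sup_{s\ne t}\|\mathcal{W}_{s,t}\|/|t-s|^{2\alpha}<\infty$ and $\mathcal{W}_{s,t}-\mathcal{W}_{s,u}-\mathcal{W}_{u,t}=W_{s,u}\otimes W_{u,t}$. Write $W(t,x)=W_t(x)$. For a Banach space $L$, $\mathcal{D}_W^{2\alpha}(L)$ is the set of pairs $(H,H')$ of $\alpha$-Hölder paths $H:[0,T]\to L$, $H':[0,T]\to\mathcal{L}(E;L)$ with $\sup_{s\ne t}\|H_{s,t}-H'_sW_{s,t}\|_L/|t-s|^{2\alpha}<\infty$; here $\mathcal{L}(A;B)$ denotes the bounded linear operators from $A$ to $B$. Integrals of controlled paths: for $(A,A')\in\mathcal{D}_W^{2\alpha}(\mathcal{L}(K_1;K_2))$, $(B,B')\in\mathcal{D}_W^{2\alpha}(K_1)$, $$\int_s^tA_rdB_r=\lim\sum_k\big[A_{t_{k-1}}B_{t_{k-1},t_k}+(A'_{t_{k-1}}B'_{t_{k-1}})\mathcal{W}_{t_{k-1},t_k}\big],\quad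 \int_s^tdA_r(B_r)=\lim\sum_k\big[A_{t_{k-1},t_k}B_{t_{k-1}}+(A'_{t_{k-1}}B'_{t_{k-1}})\mathcal{W}^*_{t_{k-1},t_k}\big],$$ where $(A'B')(\phi_1\otimes\phi_2)=A'(\phi_1)[B'(\phi_2)]$ and $(\phi_1\otimes\phi_2)^*=\phi_2\otimes\phi_1$. Similarly $\int_s^tB_r\otimes dB_r=\lim\sum_k[B_{t_{k-1}}\otimes B_{t_{k-1},t_k}+(B'_{t_{k-1}}\otimes B'_{t_{k-1}})\mathcal{W}_{t_{k-1},t_k}]$. Objects in the formula: - $F_t=W(t,Y_t)$ is controlled by $W$ with $F'_t\phi=\phi(Y_t)+DW_t(Y_t)(Y'_t\phi)$, and $\int Z_rdW(r,Y_r):=\int Z_rdF_r$. - $G_t=\int_0^tW(dr,Y_r):=\lim\sum_k[W_{t_{k-1},t_k}(Y_{t_{k-1}})+\Theta_{t_{k-1}}\mathcal{W}_{t_{k-1},t_k}]$ with $\Theta_t(\phi_1\otimes\phi_2)=D\phi_2(Y_t)(Y'_t\phi_1)$; it is controlled by $W$ with $G'_t\phi=\phi(Y_t)$, and $\int Z_rW(dr,Y_r):=\int Z_rdG_r$. - $H_t=Z_tDW(t,Y_t)\in\mathcal{L}(V;K)$ is controlled by $W$ with $H'_t\phi=(Z'_t\phi)DW_t(Y_t)+Z_tD\phi(Y_t)+Z_tD^2W_t(Y_t)(Y'_t\phi,\cdot)$, and $\int Z_rDW(r,Y_r)dY_r:=\int H_rdY_r$. - $(\mathcal{D}^{(2)})^2Y'_t(\phi_1\otimes\phi_2)=D^2\phi_2(Y_t)(Y'_t\phi_1,\cdot)\in\mathcal{L}(V;V)$;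 $X$ is controlled by $W$ with $X'_t\phi=D\phi(Y_t)$. - $\langle Y\rangle_{s,t}=Y_{s,t}\otimes Y_{s,t}-2\int_s^tY_{s,r}\otimes dY_r$; $\langle\langle X,Y\rangle\rangle_{s,t}=X_{s,t}Y_{s,t}-2\int_s^tX_{s,r}dY_r$; $\langle\langle Y,X\rangle\rangle_{s,t}=X_{s,t}Y_{s,t}-2\int_s^tdX_r(Y_{s,r})$. These are functions on $[0,T]^2$ bounded by a constant times $|t-s|^{2\alpha}$. - Young integrals against such a two-parameter function $Q$: $\int_s^tA_rdQ_r=\lim\sum_kA_{t_{k-1}}Q_{t_{k-1},t_k}$.
   Formalization: The Young integrals of Z against ⟨⟨X,Y⟩⟩ and ⟨⟨Y,X⟩⟩ need not exist separately; the formula is proved with their sum as one integral against ⟨⟨X,Y⟩⟩+⟨⟨Y,X⟩⟩, and as printed whenever one of the two exists. Compensators are bounded for s ≤ t. *)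

(* Defs.v *)
From HB Require Import structures.
From mathcomp Require Import all_boot all_order all_algebra.
From mathcomp Require Import all_classical all_reals all_analysis.
From mathcomp Require Import lra.
Set Implicit Arguments.
Unset Strict Implicit.
Unset Printing Implicit Defensive.
Import Order.TTheory GRing.Theory Num.Theory.
Import numFieldNormedType.Exports.
Local Open Scope classical_set_scope.
Local Open Scope ring_scope.

Section BoundedLinear.
Context {R : realType}.
Implicit Types A B : normedModType R.

Definition bounded_linear A B (f : A -> B) : Prop :=
  linear f /\ exists M : R, forall x, `|f x| <= M * `|x|.

Definition blin_pred A B : {pred A -> B} := [pred f | `[< bounded_linear f >]].

(* The space L(A; B), with the operator norm (see [blin_normE]). *)
Record blin A B := Blin {
  blin_fun :> A -> B;
  _ : blin_fun \in @blin_pred A B }.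

HB.instance Definition _ A B := [isSub for @blin_fun A B].
HB.instance Definition _ A B := [Choice of blin A B by <:].

Lemma blin_submod_closed A B : submod_closed (@blin_pred A B).
Proof.
split.
  apply/asboolP; split=> [a x y|]; first by rewrite /= addr0 scaler0.
  by exists 0 => x; rewrite normr0 mul0r.
move=> a f g /asboolP[lf [Mf hf]] /asboolP[lg [Mg hg]]; apply/asboolP; split.
  move=> b x y /=; rewrite !fctE lf lg.
  by rewrite !scalerDr !scalerA mulrC -!addrA; congr (_ + _); rewrite addrCA.
exists (`|a| * Mf + Mg) => x; rewrite !fctE mulrDl.
by rewrite (le_trans (ler_normD _ _))// lerD// normrZ -mulrA ler_wpM2l.
Qed.

HB.instance Definition _ A B :=
  GRing.isSubmodClosed.Build R (A -> B) (@blin_pred A B) (blin_submod_closed A B).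
HB.instance Definition _ A B := [SubChoice_isSubLmodule of blin A B by <:].

Lemma blin_bl A B (f : blin A B) : bounded_linear f.
Proof. by case: f => f /= /asboolP. Qed.

Lemma blin_is_linear A B (f : blin A B) : linear f.
Proof. by case: (blin_bl f). Qed.

HB.instance Definition _ A B (f : blin A B) :=
  GRing.isLinear.Build R A B _ f (blin_is_linear f).


Lemma blin_lipex A B (f : blin A B) : exists2 M : R, 0 <= M & forall x, `|f x| <= M * `|x|.
Proof.
have [_ [M hM]] := blin_bl f; exists (Num.max M 0); first by rewrite le_max lexx orbT.
by move=> x; rewrite (le_trans (hM x))// ler_wpM2r// le_max lexx.
Qed.

Definition opnorm A B (f : blin A B) : R :=
  sup [set `|f x| | x in [set x | `|x| <= 1]].


Definition opset A B (f : blin A B) : set R := [set `|f x| | x in [set x | `|x| <= 1]].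

Lemma opset_sup A B (f : blin A B) : has_sup (opset f).
Proof.
split; first by exists `|f 0|; exists 0 => //=; rewrite normr0.
have [M M0 hM] := blin_lipex f; exists M => _ [x /= x1 <-].
by rewrite (le_trans (hM x))// ler_piMr.
Qed.

Lemma opnorm_le A B (f : blin A B) (M : R) : 0 <= M ->
  (forall x, `|f x| <= M * `|x|) -> opnorm f <= M.
Proof.
move=> M0 hM; apply: ge_sup => [|_ [x /= x1 <-]]; first by case: (opset_sup f).
by rewrite (le_trans (hM x))// ler_piMr.
Qed.

Lemma opnorm_ge0 A B (f : blin A B) : 0 <= opnorm f.
Proof.
apply: (@le_trans _ _ `|f 0|) => //; apply: ub_le_sup; first by case: (opset_sup f).
by exists 0 => //=; rewrite normr0.
Qed.

Lemma opnormP A B (f : blin A B) x : `|f x| <= opnorm f * `|x|.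
Proof.
have [->|x0] := eqVneq x 0; first by rewrite linear0 !normr0 mulr0.
have nx : 0 < `|x| by rewrite normr_gt0.
rewrite -ler_pdivrMr// mulrC -{1}(gtr0_norm nx) -normfV -normrZ -linearZ /=.
apply: ub_le_sup; first by case: (opset_sup f).
by exists (`|x|^-1 *: x) => //=; rewrite normrZ normfV normr_id mulVf// gt_eqF.
Qed.

Lemma opnormD A B (f g : blin A B) : opnorm (f + g) <= opnorm f + opnorm g.
Proof.
apply: opnorm_le => [|x]; first by rewrite addr_ge0// opnorm_ge0.
by rewrite (le_trans (ler_normD _ _))// mulrDl lerD// opnormP.
Qed.

Lemma opnormZ A B (a : R) (f : blin A B) : opnorm (a *: f) = `|a| * opnorm f.
Proof.
have le (b : R) (g : blin A B) : opnorm (b *: g) <= `|b| * opnorm g.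
  apply: opnorm_le => [|x]; first by rewrite mulr_ge0// opnorm_ge0.
  by rewrite /= fctE normrZ -mulrA ler_wpM2l// opnormP.
apply/eqP; rewrite eq_le le /=.
have [->|a0] := eqVneq a 0; first by rewrite normr0 mul0r opnorm_ge0.
rewrite -ler_pdivlMl ?normr_gt0// -normfV.
by rewrite -{1}[f](@scalerK _ _ a) ?unitfE.
Qed.

Lemma opnorm_eq0 A B (f : blin A B) : opnorm f = 0 -> f = 0.
Proof.
move=> f0; apply/val_inj/funext => x /=; apply/normr0_eq0/eqP.
by rewrite eq_le normr_ge0 andbT (le_trans (opnormP f x))// f0 mul0r.
Qed.

HB.instance Definition _ A B := @Lmodule_isNormed.Build R (blin A B)
  (fun f => opnorm f) (@opnormD A B) (@opnormZ A B) (@opnorm_eq0 A B).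

Lemma blin_normE A B (f : blin A B) : `|f| = sup [set `|f x| | x in [set x | `|x| <= 1]].
Proof. by []. Qed.

Lemma ler_blin A B (f : blin A B) x : `|f x| <= `|f| * `|x|.
Proof. exact: opnormP. Qed.

Lemma blin_norm_le A B (f : blin A B) (M : R) : 0 <= M ->
  (forall x, `|f x| <= M * `|x|) -> `|f| <= M.
Proof. exact: opnorm_le. Qed.

End BoundedLinear.

Section BlinComplete.
Context {R : realType} (A : normedModType R) (B : completeNormedModType R).

Lemma blin_complete (F : set_system (blin A B)) : ProperFilter F -> cauchy F -> cvg F.
Proof.
move=> FF /cauchy_ballP Fc.
pose l x : B := lim ((f : blin A B) x @[f --> F]).
have cl x : (f : blin A B) x @[f --> F] --> l x.
  apply/cauchy_cvgP/cauchy_ballP => e e0.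
  have e1 : 0 < e / (`|x| + 1) by rewrite divr_gt0// ltr_wpDl.
  have [[P Q] /= [FP FQ] PQ] := Fc _ e1.
  exists ([set (f : blin A B) x | f in P], [set (f : blin A B) x | f in Q]) => /=.
    by split; [apply: (filterS _ FP)|apply: (filterS _ FQ)] => f ? /=; exists f.
  move=> [_ _] /= [[f Pf <-] [g Qg <-]].
  have := PQ (f, g) (conj Pf Qg); rewrite -!ball_normE /= => fg.
  apply: (le_lt_trans (ler_blin (f - g) x)).
  apply: (@le_lt_trans _ _ (e / (`|x| + 1) * `|x|)).
    by rewrite ler_wpM2r// ltW.
  by rewrite -mulrA gtr_pMr// mulrC ltr_pdivrMr ?ltr_wpDl// mul1r ltrDl.
have ll : linear l.
  move=> a x y; apply: (@cvg_lim _ _ _ F) => //.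
  rewrite (_ : (fun f : blin A B => f (a *: x + y)) =
      (fun f : blin A B => a *: f x + f y)); last first.
    by apply/funext => f; rewrite linearP.
  by apply: cvgD; [exact: (@cvgZl_tmp _ _ _ F _ a (fun f : blin A B => f x))|].
have ub e : 0 < e -> \forall f \near F, forall x, `|l x - (f : blin A B) x| <= e * `|x|.
  move=> e0; have := Fc _ e0.
  case=> -[P Q] /= [FP FQ] PQ; apply: (@filterS _ F _ P) => // f Pf x.
  have cn : `|(g : blin A B) x - f x| @[g --> F] --> `|l x - f x|.
    by apply: cvg_norm; apply: cvgB => //; exact: cvg_cst.
  apply: (cvgr_to_le cn).
  apply: (@filterS _ F _ Q) => // g Qg.
  have := PQ (f, g) (conj Pf Qg); rewrite -ball_normE /= => fg.
  rewrite distrC (le_trans (ler_blin (f - g) x))// ler_wpM2r// ltW//.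
have lb : l \in @blin_pred R A B.
  apply/asboolP; split => //.
  have [f hf] := filter_ex (ub 1 ltr01).
  exists (1 + `|f|) => x; rewrite -[l x](subrK (f x)) mulrDl.
  by rewrite (le_trans (ler_normD _ _))// lerD// ler_blin.
apply/cvg_ex; exists (Blin lb); apply/cvgrPdist_le => e e0.
by apply: filterS (ub e e0) => f hf; apply: blin_norm_le => //; exact: ltW.
Qed.

HB.instance Definition _ := Uniform_isComplete.Build (blin A B) blin_complete.

End BlinComplete.


Section Frechet.
Context {R : realType}.
Implicit Types A B : normedModType R.

(* [f] as an element of L(A; B); the default 0 is taken when [f] is not bounded
   linear. *)
Definition blin_of A B (f : A -> B) : blin A B := insubd (0 : blin A B) f.

Lemma blin_ofE A B (f : A -> B) : bounded_linear f -> blin_of f = f :> (A -> B).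
Proof. by move=> bf; rewrite /blin_of insubdK//; apply/asboolP. Qed.

(* The Frechet derivative as a map A -> L(A; B); default 0 at points where [f]
   is not differentiable. *)
Definition frechet A B (f : A -> B) (x : A) : blin A B := blin_of ('d f x).

Lemma frechetE A B (f : A -> B) x : differentiable f x ->
  frechet f x = 'd f x :> (A -> B).
Proof.
move=> df; apply: blin_ofE; split; first exact: linearP.
have /linear_bounded_continuous/linear_boundedP := diff_continuous df.
by move=> /pinfty_ex_gt0[M _ hM]; exists M.
Qed.

Lemma frechetP A B (f g : A -> B) (a : R) x :
  differentiable f x -> differentiable g x ->
  frechet (a *: f + g) x = a *: frechet f x + frechet g x.
Proof.
move=> df dg; have dZ := differentiableZ a df.
have e1 := frechetE (differentiableD dZ dg); have e2 := frechetE df.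
have e3 := frechetE dg.
by apply/val_inj; rewrite [LHS]e1 (diffD dZ dg) (diffZ a df) -e2 -e3.
Qed.

End Frechet.

Section WeightedCn.
Context {R : realType} (A B : normedModType R).

(* L(A; L(A; ... ; B)), i.e. n-linear maps with their usual norm; [Dn 2 f] is
   convertible to [frechet (frechet f)]. *)
Fixpoint mlin (n : nat) : normedModType R :=
  if n is m.+1 then blin A (mlin m) : normedModType R else B.

Fixpoint Dn (n : nat) (f : A -> B) : A -> mlin n :=
  if n is m.+1 then frechet (Dn m f) else f.

Definition Cn (n : nat) (f : A -> B) : Prop :=
  (forall k, (k < n)%N -> forall x, differentiable (Dn k f) x) /\
  continuous (Dn n f).

Lemma Dn_linear n k (a : R) (f g : A -> B) : (k <= n)%N -> Cn n f -> Cn n g ->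
  Dn k (a *: f + g) = a *: Dn k f + Dn k g.
Proof.
move=> kn [df _] [dg _]; elim: k kn => [//|k ih] kn /=.
apply/funext => x; rewrite ih ?(ltnW kn)//.
by apply: frechetP; [apply: df|apply: dg].
Qed.

Lemma Cn_linear n (a : R) (f g : A -> B) : Cn n f -> Cn n g -> Cn n (a *: f + g).
Proof.
move=> Cf Cg; split.
  move=> k kn x; rewrite (Dn_linear a (ltnW kn) Cf Cg).
  by apply: differentiableD; [apply: differentiableZ; apply: Cf.1|apply: Cg.1].
move=> x; rewrite (Dn_linear a (leqnn n) Cf Cg).
by apply: cvgD; [apply: cvgZl_tmp; apply: Cf.2|apply: Cg.2].
Qed.

Lemma Dn0 k : Dn k (0 : A -> B) = 0.
Proof.
elim: k => [//|k ih] /=; rewrite ih; apply/funext => x; apply/val_inj => /=.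
by rewrite frechetE ?diff_cst.
Qed.

Context (n : nat) (beta : 'I_n.+1 -> R).

Definition wrange (k : 'I_n.+1) (f : A -> B) : set R :=
  range (fun x => `|Dn k f x| * (1 + `|x|) `^ (- beta k)).

Definition wCn_pred : {pred A -> B} :=
  [pred f | `[< Cn n f /\ forall k, has_ubound (wrange k f) >]].

Lemma wCn_submod_closed : submod_closed wCn_pred.
Proof.
split.
  apply/asboolP; split=> [|k].
    split=> [k _ x|]; rewrite Dn0; first exact: differentiable_cst.
    exact: cst_continuous.
  by exists 0 => _ [x _ <-]; rewrite Dn0 normr0 mul0r.
move=> a f g /asboolP[Cf bf] /asboolP[Cg bg]; apply/asboolP; split.
  exact: Cn_linear.
move=> k; have [Mf hf] := bf k; have [Mg hg] := bg k.
exists (`|a| * Mf + Mg) => _ [x _ <-].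
rewrite (Dn_linear a (leq_ord k) Cf Cg) !fctE.
rewrite (le_trans (ler_wpM2r (powR_ge0 _ _) (ler_normD _ _)))// mulrDl lerD//.
  by rewrite normrZ -mulrA ler_wpM2l// hf//; exists x.
by rewrite hg//; exists x.
Qed.

(* C^{beta_n}(A; B); weights are written (1 + |x|) `^ (- beta k). Completeness is
   a property of this normed space that no definition below uses. *)
Record wCn := WCn { wCn_fun :> A -> B ; _ : wCn_fun \in wCn_pred }.

HB.instance Definition _ := [isSub for wCn_fun].
HB.instance Definition _ := [Choice of wCn by <:].
HB.instance Definition _ :=
  GRing.isSubmodClosed.Build R (A -> B) wCn_pred wCn_submod_closed.
HB.instance Definition _ := [SubChoice_isSubLmodule of wCn by <:].

Definition wnorm (f : wCn) : R := \sum_(k < n.+1) sup (wrange k f).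

Lemma wCn_Cn (f : wCn) : Cn n f.
Proof. by case: f => f /= /asboolP[]. Qed.

Lemma wrange_sup (f : wCn) k : has_sup (wrange k f).
Proof.
split; last by case: f => f /= /asboolP[_].
by exists (`|Dn k f 0| * (1 + `|0 : A|) `^ (- beta k)); exists 0.
Qed.

Lemma le_wrange (f : wCn) (k : 'I_n.+1) x :
  `|Dn k f x| * (1 + `|x|) `^ (- beta k) <= sup (wrange k f).
Proof. by apply: ub_le_sup; [case: (wrange_sup f k)|exists x]. Qed.

Lemma wnormD (f g : wCn) : wnorm (f + g) <= wnorm f + wnorm g.
Proof.
rewrite /wnorm -big_split /=; apply: ler_sum => k _.
apply: ge_sup; first by case: (wrange_sup (f + g) k).
move=> _ [x _ <-].
have := Dn_linear 1 (leq_ord k) (wCn_Cn f) (wCn_Cn g); rewrite !scale1r => ->.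
rewrite fctE.
rewrite (le_trans (ler_wpM2r (powR_ge0 _ _) (ler_normD _ _)))// mulrDl.
by rewrite lerD// le_wrange.
Qed.

Lemma wnormZ (a : R) (f : wCn) : wnorm (a *: f) = `|a| * wnorm f.
Proof.
have le (b : R) (g : wCn) : wnorm (b *: g) <= `|b| * wnorm g.
  rewrite /wnorm mulr_sumr; apply: ler_sum => k _.
  apply: ge_sup; first by case: (wrange_sup (b *: g) k).
  move=> _ [x _ <-].
  have := Dn_linear b (leq_ord k) (wCn_Cn g) (wCn_Cn 0).
  rewrite Dn0 !addr0 => ->; rewrite fctE.
  by rewrite normrZ -mulrA ler_wpM2l// le_wrange.
apply/eqP; rewrite eq_le le /=.
have [->|a0] := eqVneq a 0.
  rewrite normr0 mul0r; apply: sumr_ge0 => k _.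
  by apply: le_trans (le_wrange _ k 0); rewrite mulr_ge0// powR_ge0.
rewrite -ler_pdivlMl ?normr_gt0// -normfV.
by rewrite -{1}[f](@scalerK _ _ a) ?unitfE.
Qed.

Lemma wnorm_eq0 (f : wCn) : wnorm f = 0 -> f = 0.
Proof.
move=> f0; apply/val_inj/funext => x /=; apply/normr0_eq0/eqP.
have s0 k : 0 <= sup (wrange k f).
  by apply: le_trans (le_wrange _ k 0); rewrite mulr_ge0// powR_ge0.
have : sup (wrange ord0 f) = 0.
  apply/eqP; rewrite eq_le s0 andbT -f0 /wnorm big_ord_recl lerDl.
  by rewrite sumr_ge0.
have := le_wrange f ord0 x; rewrite /= => h e; move: h; rewrite e.
have w0 : 0 < (1 + `|x|) `^ (- beta ord0) by rewrite powR_gt0// ltr_wpDr.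
by rewrite pmulr_lle0// => h; rewrite eq_le h normr_ge0.
Qed.

HB.instance Definition _ :=
  @Lmodule_isNormed.Build R wCn wnorm wnormD wnormZ wnorm_eq0.

End WeightedCn.

(* The projective tensor product, i.e. the completion of the algebraic tensor
   product for the norm
     pi(z) = inf { sum |a_i| |b_i| : z = sum a_i (x) b_i }.
   A finite sum of elementary tensors is represented by the list of its terms;
   [fteq] is equality in the algebraic tensor product, [pnorm] is pi. The
   completion consists of the pi-Cauchy sequences of such finite sums, modulo
   sequences tending to 0 for pi. The main facts are [tens_bilin],
   [fttens_norm], [fttens_dense], [ptensor_complete] and, below, [liftE],
   [lift_norm] and [lift_unique]. *)
Section ProjectiveTensor.
Local Open Scope quotient_scope.
Context {R : realType} (A B : normedModType R).
Implicit Types x y z : seq (A * B).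

Definition bilin (G : lmodType R) (f : A -> B -> G) : Prop :=
  (forall b, linear (f^~ b)) /\ (forall a, linear (f a)).

Definition fteval (G : lmodType R) (f : A -> B -> G) x : G :=
  \sum_(p <- x) f p.1 p.2.

Definition fteq x y : Prop := forall (G : lmodType R) (f : A -> B -> G),
  bilin f -> fteval f x = fteval f y.

Definition ftweight x : R := \sum_(p <- x) `|p.1| * `|p.2|.

Definition pnorm x : R := inf [set ftweight y | y in fteq x].

Definition ftscale (a : R) x := [seq (a *: p.1, p.2) | p <- x].

Definition ftsub x y := x ++ ftscale (-1) y.

Lemma fteval_cat (G : lmodType R) (f : A -> B -> G) x y :
  fteval f (x ++ y) = fteval f x + fteval f y.
Proof. exact: big_cat. Qed.

Lemma fteval_scale (G : lmodType R) (f : A -> B -> G) a x : bilin f ->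
  fteval f (ftscale a x) = a *: fteval f x.
Proof.
move=> [lf _]; rewrite /fteval big_map scaler_sumr; apply: eq_bigr => p _ /=.
have := lf p.2 a p.1 0; rewrite addr0 => ->.
have := lf p.2 (-1) 0 0; rewrite scaler0 addr0 scaleN1r addNr => ->.
by rewrite addr0.
Qed.

Lemma ftweight_ge0 x : 0 <= ftweight x.
Proof. by apply: sumr_ge0 => p _; rewrite mulr_ge0. Qed.

Lemma ftweight_cat x y : ftweight (x ++ y) = ftweight x + ftweight y.
Proof. exact: big_cat. Qed.

Lemma ftweight_scale a x : ftweight (ftscale a x) = `|a| * ftweight x.
Proof.
rewrite /ftweight big_map mulr_sumr; apply: eq_bigr => p _ /=.
by rewrite normrZ mulrA.
Qed.

Lemma fteq_refl x : fteq x x. Proof. by []. Qed.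

Lemma pnorm_inf x : has_inf [set ftweight y | y in fteq x].
Proof.
split; first by exists (ftweight x); exists x.
by exists 0 => _ [y _ <-]; exact: ftweight_ge0.
Qed.

Lemma pnorm_ge0 x : 0 <= pnorm x.
Proof.
by apply: lb_le_inf => [|_ [y _ <-]]; [case: (pnorm_inf x)|exact: ftweight_ge0].
Qed.

Lemma pnorm_le x y : fteq x y -> pnorm x <= ftweight y.
Proof. by move=> xy; apply: ge_inf; [case: (pnorm_inf x)|exists y]. Qed.

Lemma pnorm_adh x (e : R) : 0 < e -> exists2 y, fteq x y & ftweight y < pnorm x + e.
Proof. by move=> e0; have [_ [y xy <-] h] := inf_adherent e0 (pnorm_inf x); exists y. Qed.

Lemma pnorm_fteq x y : fteq x y -> pnorm x = pnorm y.
Proof.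
move=> xy; congr (inf (ftweight @` _)); apply/seteqP; split => z h G f bf.
  by rewrite -(xy G f bf) h.
by rewrite (xy G f bf) h.
Qed.

Lemma pnorm_cat x y : pnorm (x ++ y) <= pnorm x + pnorm y.
Proof.
apply/ler_addgt0Pr => e e0; have e2 : 0 < e / 2 by rewrite divr_gt0.
have [x' xx' hx] := pnorm_adh x e2; have [y' yy' hy] := pnorm_adh y e2.
apply: (@le_trans _ _ (ftweight (x' ++ y'))).
  by apply: pnorm_le => G f bf; rewrite !fteval_cat xx'// yy'.
rewrite ftweight_cat [e]splitr addrACA; apply: ltW; exact: ltrD.
Qed.

Lemma pnorm_scale a x : pnorm (ftscale a x) = `|a| * pnorm x.
Proof.
have le b y : pnorm (ftscale b y) <= `|b| * pnorm y.
  apply/ler_addgt0Pr => e e0; have b1 : 0 < `|b| + 1 by rewrite ltr_wpDl.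
  have [y' yy' hy] := pnorm_adh y (divr_gt0 e0 b1).
  apply: (@le_trans _ _ (ftweight (ftscale b y'))).
    by apply: pnorm_le => G f bf; rewrite !fteval_scale// yy'.
  rewrite ftweight_scale (le_trans (ler_wpM2l _ (ltW hy)))// mulrDr lerD2l.
  by rewrite mulrCA ger_pMr// ler_pdivrMr// mul1r lerDl.
apply/eqP; rewrite eq_le le /=.
have [->|a0] := eqVneq a 0; first by rewrite normr0 mul0r pnorm_ge0.
rewrite -ler_pdivlMl ?normr_gt0// -normfV; apply: le_trans (le _ _).
rewrite (@pnorm_fteq x (ftscale a^-1 (ftscale a x)))// => G f bf.
by rewrite !fteval_scale// scalerA mulVf// scale1r.
Qed.

Lemma pnorm_nil : pnorm [::] = 0.
Proof.
apply/eqP; rewrite eq_le pnorm_ge0 andbT (le_trans (pnorm_le (fteq_refl _)))//.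
by rewrite /ftweight big_nil.
Qed.

Lemma fteval_sub (G : lmodType R) (f : A -> B -> G) x y : bilin f ->
  fteval f (ftsub x y) = fteval f x - fteval f y.
Proof. by move=> bf; rewrite fteval_cat fteval_scale// scaleN1r. Qed.

Lemma pdist_fteq x y : fteq x y -> pnorm (ftsub x y) = 0.
Proof.
move=> xy; rewrite -pnorm_nil; apply: pnorm_fteq => G f bf.
by rewrite fteval_sub// xy// subrr /fteval big_nil.
Qed.

Lemma pdist_tri y x z : pnorm (ftsub x z) <= pnorm (ftsub x y) + pnorm (ftsub y z).
Proof.
apply: le_trans (pnorm_cat _ _); rewrite (@pnorm_fteq _ (ftsub x y ++ ftsub y z))//.
by move=> G f bf; rewrite fteval_cat !fteval_sub// addrA subrK.
Qed.

Lemma pdistC x y : pnorm (ftsub x y) = pnorm (ftsub y x).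
Proof.
rewrite -[RHS]mul1r -(@normrN1 R) -pnorm_scale; apply: pnorm_fteq => G f bf.
by rewrite fteval_scale// !fteval_sub// scaleN1r opprB.
Qed.

Lemma pdist_cat x x' y y' :
  pnorm (ftsub (x ++ x') (y ++ y')) <= pnorm (ftsub x y) + pnorm (ftsub x' y').
Proof.
apply: le_trans (pnorm_cat _ _); rewrite (@pnorm_fteq _ (ftsub x y ++ ftsub x' y'))//.
by move=> G f bf; rewrite fteval_cat !fteval_sub// !fteval_cat opprD addrACA.
Qed.

Lemma pdist_scale a x y :
  pnorm (ftsub (ftscale a x) (ftscale a y)) = `|a| * pnorm (ftsub x y).
Proof.
rewrite -pnorm_scale; apply: pnorm_fteq => G f bf.
by rewrite fteval_scale// !fteval_sub// !fteval_scale// scalerBr.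
Qed.

Lemma pdist_norm x y : `|pnorm x - pnorm y| <= pnorm (ftsub x y).
Proof.
have h u v : pnorm u - pnorm v <= pnorm (ftsub u v).
  rewrite lerBlDr; apply: le_trans (pnorm_cat _ _).
  rewrite (@pnorm_fteq u (ftsub u v ++ v))// => G f bf.
  by rewrite fteval_cat fteval_sub// subrK.
by rewrite ler_norml h andbT lerNl opprB pdistC h.
Qed.

Definition ftcauchy (u : nat -> seq (A * B)) : Prop :=
  forall e : R, 0 < e -> exists N, forall m n, (N <= m)%N -> (N <= n)%N ->
    pnorm (ftsub (u m) (u n)) <= e.

Record ftcseq := FtCseq { ftcseq_fun :> nat -> seq (A * B) ;
  _ : `[< ftcauchy ftcseq_fun >] }.
HB.instance Definition _ := [isSub for ftcseq_fun].
HB.instance Definition _ := [Choice of ftcseq by <:].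

Lemma ftcseqP (u : ftcseq) : ftcauchy u.
Proof. by case: u => u /= /asboolP. Qed.

Definition ftceq (u v : ftcseq) : bool :=
  `[< forall e : R, 0 < e -> exists N, forall n, (N <= n)%N ->
        pnorm (ftsub (u n) (v n)) <= e >].

Lemma ftceq0 (u v : ftcseq) :
  (forall n, pnorm (ftsub (u n) (v n)) = 0) -> ftceq u v.
Proof. by move=> h; apply/asboolP => e e0; exists 0%N => n _; rewrite h ltW. Qed.

Lemma ftceq_refl : reflexive ftceq.
Proof. by move=> u; apply: ftceq0 => n; apply: pdist_fteq. Qed.

Lemma ftceq_sym : symmetric ftceq.
Proof.
by move=> u v; apply/asboolP/asboolP => h e /h[N hN]; exists N => n /hN;
  rewrite pdistC.
Qed.

Lemma ftceq_trans : transitive ftceq.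
Proof.
move=> v u w /asboolP h /asboolP k; apply/asboolP => e e0.
have e2 : 0 < e / 2 by rewrite divr_gt0.
have [N hN] := h _ e2; have [M hM] := k _ e2; exists (maxn N M) => n.
rewrite geq_max => /andP[Nn Mn]; apply: le_trans (pdist_tri (v n) _ _) _.
by rewrite [e]splitr lerD ?hN ?hM.
Qed.

Canonical ftceq_equiv := EquivRel ftceq ftceq_refl ftceq_sym ftceq_trans.

Definition ptensor : Type := {eq_quot ftceq}.
HB.instance Definition _ := Choice.on ptensor.
HB.instance Definition _ := EqQuotient.on ptensor.

Definition ptof (u : ftcseq) : ptensor := \pi_ptensor u.

Lemma ptofP u v : ftceq u v <-> ptof u = ptof v.
Proof. by split=> [uv|/eqP]; [apply/eqP; rewrite eqmodE|rewrite eqmodE]. Qed.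

Lemma ptofK (x : ptensor) : ptof (repr x) = x.
Proof. exact: reprK. Qed.

Lemma ftcst_subproof x : `[< ftcauchy (fun=> x) >].
Proof.
by apply/asboolP => e e0; exists 0%N => m n _ _; rewrite pdist_fteq// ltW.
Qed.
Definition ftcst x : ftcseq := FtCseq (ftcst_subproof x).

Lemma ftcat_subproof (u v : ftcseq) : `[< ftcauchy (fun n => u n ++ v n) >].
Proof.
apply/asboolP => e e0; have e2 : 0 < e / 2 by rewrite divr_gt0.
have [N hN] := ftcseqP u e2; have [M hM] := ftcseqP v e2.
exists (maxn N M) => m n; rewrite !geq_max => /andP[Nm Mm] /andP[Nn Mn].
by rewrite (le_trans (pdist_cat _ _ _ _))// [e]splitr lerD ?hN ?hM.
Qed.
Definition ftcat (u v : ftcseq) : ftcseq := FtCseq (ftcat_subproof u v).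

Lemma ftcscale_subproof a (u : ftcseq) :
  `[< ftcauchy (fun n => ftscale a (u n)) >].
Proof.
apply/asboolP => e e0; have a1 : 0 < `|a| + 1 by rewrite ltr_wpDl.
have [N hN] := ftcseqP u (divr_gt0 e0 a1).
exists N => m n Nm Nn; rewrite pdist_scale.
rewrite (le_trans (ler_wpM2l _ (hN _ _ Nm Nn)))//.
by rewrite mulrCA ger_pMr// ler_pdivrMr// mul1r lerDl.
Qed.
Definition ftcscale a (u : ftcseq) : ftcseq := FtCseq (ftcscale_subproof a u).

Lemma ftcat_eq u u' v v' :
  ftceq u u' -> ftceq v v' -> ftceq (ftcat u v) (ftcat u' v').
Proof.
move=> /asboolP h /asboolP k; apply/asboolP => e e0.
have e2 : 0 < e / 2 by rewrite divr_gt0.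
have [N hN] := h _ e2; have [M hM] := k _ e2; exists (maxn N M) => n.
rewrite geq_max => /andP[Nn Mn]; apply: le_trans (pdist_cat _ _ _ _) _.
by rewrite [e]splitr lerD ?hN ?hM.
Qed.

Lemma ftcscale_eq a u u' : ftceq u u' -> ftceq (ftcscale a u) (ftcscale a u').
Proof.
move=> /asboolP h; apply/asboolP => e e0; have a1 : 0 < `|a| + 1 by rewrite ltr_wpDl.
have [N hN] := h _ (divr_gt0 e0 a1); exists N => n Nn; rewrite pdist_scale.
rewrite (le_trans (ler_wpM2l _ (hN _ Nn)))//.
by rewrite mulrCA ger_pMr// ler_pdivrMr// mul1r lerDl.
Qed.

Definition pt0 : ptensor := ptof (ftcst [::]).
Definition ptadd (x y : ptensor) : ptensor := ptof (ftcat (repr x) (repr y)).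
Definition ptscale a (x : ptensor) : ptensor := ptof (ftcscale a (repr x)).
Definition ptopp (x : ptensor) : ptensor := ptscale (-1) x.

Lemma ptaddE u v : ptadd (ptof u) (ptof v) = ptof (ftcat u v).
Proof. by apply/ptofP/ftcat_eq; apply/ptofP; rewrite ptofK. Qed.

Lemma ptscaleE a u : ptscale a (ptof u) = ptof (ftcscale a u).
Proof. by apply/ptofP/ftcscale_eq; apply/ptofP; rewrite ptofK. Qed.

Lemma ptof_fteq (u v : ftcseq) : (forall n, fteq (u n) (v n)) -> ptof u = ptof v.
Proof. by move=> h; apply/ptofP/ftceq0 => n; exact: pdist_fteq. Qed.

Lemma ptaddA : associative ptadd.
Proof.
move=> x y z; rewrite -[x]ptofK -[y]ptofK -[z]ptofK !ptaddE.
by apply: ptof_fteq => n G f bf; rewrite /= !fteval_cat addrA.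
Qed.

Lemma ptaddC : commutative ptadd.
Proof.
move=> x y; rewrite -[x]ptofK -[y]ptofK !ptaddE.
by apply: ptof_fteq => n G f bf; rewrite /= !fteval_cat addrC.
Qed.

Lemma ptadd0 : left_id pt0 ptadd.
Proof. by move=> x; rewrite -[x]ptofK !ptaddE; apply: ptof_fteq. Qed.

Lemma ptaddN : left_inverse pt0 ptopp ptadd.
Proof.
move=> x; rewrite -[x]ptofK /ptopp ptscaleE ptaddE; apply: ptof_fteq => n G f bf.
by rewrite /= fteval_cat fteval_scale// scaleN1r addNr /fteval big_nil.
Qed.

HB.instance Definition _ :=
  GRing.isZmodule.Build ptensor ptaddA ptaddC ptadd0 ptaddN.

Lemma ptscaleA a b (x : ptensor) : ptscale a (ptscale b x) = ptscale (a * b) x.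
Proof.
rewrite -[x]ptofK !ptscaleE; apply: ptof_fteq => n G f bf.
by rewrite /= !fteval_scale// scalerA.
Qed.

Lemma ptscale1 : left_id 1 ptscale.
Proof.
move=> x; rewrite -[x]ptofK !ptscaleE; apply: ptof_fteq => n G f bf.
by rewrite /= !fteval_scale// scale1r.
Qed.

Lemma ptscaleDr : right_distributive ptscale +%R.
Proof.
move=> a x y; rewrite -[x]ptofK -[y]ptofK [_ + _]ptaddE !ptscaleE [RHS]ptaddE.
apply: ptof_fteq => n G f bf.
by rewrite /= !(fteval_scale, fteval_cat)// scalerDr.
Qed.

Lemma ptscaleDl (x : ptensor) : {morph ptscale^~ x : a b / a + b}.
Proof.
move=> a b; rewrite -[x]ptofK !ptscaleE [RHS]ptaddE; apply: ptof_fteq => n G f bf.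
by rewrite /= !(fteval_scale, fteval_cat)// scalerDl.
Qed.

HB.instance Definition _ := GRing.Zmodule_isLmodule.Build R ptensor
  ptscaleA ptscale1 ptscaleDr ptscaleDl.

Definition ftcnorm (u : ftcseq) : R := lim (pnorm (u n) @[n --> \oo]).

Lemma ftcnorm_cvg (u : ftcseq) : pnorm (u n) @[n --> \oo] --> ftcnorm u.
Proof.
apply/cauchy_cvgP/cauchy_exP => e e0; have e2 : 0 < e / 2 by rewrite divr_gt0.
have [N hN] := ftcseqP u e2; exists (pnorm (u N)).
exists N => //= n Nn; rewrite -ball_normE /=.
rewrite (le_lt_trans (pdist_norm _ _))// (le_lt_trans (hN _ _ _ _))//.
by rewrite ltr_pdivrMr// ltr_pMr// ltr1n.
Qed.

Arguments ftcnorm_cvg u : clear implicits.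

Lemma ftceq_norm u v : ftceq u v -> ftcnorm u = ftcnorm v.
Proof.
move=> /asboolP h; have hv := ftcnorm_cvg v.
apply: (cvg_unique _ (ftcnorm_cvg u)) => //.
apply/cvgrPdist_le => e e0; have e2 : 0 < e / 2 by rewrite divr_gt0.
have [N hN] := h _ e2; near=> n.
rewrite -(subrK (pnorm (v n)) (ftcnorm v)) -addrA.
rewrite (le_trans (ler_normD _ _))// [e]splitr lerD//.
  by near: n; move/cvgrPdist_le : hv; apply.
rewrite distrC (le_trans (pdist_norm _ _))// hN//.
by near: n; exists N.
Unshelve. all: by end_near. Qed.

Definition ptnorm (x : ptensor) : R := ftcnorm (repr x).

Lemma ptnormE u : ptnorm (ptof u) = ftcnorm u.
Proof. by apply/ftceq_norm/ptofP; rewrite ptofK. Qed.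

Lemma ptnorm_le (x y : ptensor) : ptnorm (x + y) <= ptnorm x + ptnorm y.
Proof.
rewrite -[x]ptofK -[y]ptofK [_ + _]ptaddE !ptnormE.
set u := repr x; set v := repr y.
have c : pnorm (u n) + pnorm (v n) @[n --> \oo] --> ftcnorm u + ftcnorm v.
  by apply: cvgD; exact: ftcnorm_cvg.
apply: (ler_cvg_to (ftcnorm_cvg (ftcat u v)) c).
by apply: nearW => n; exact: pnorm_cat.
Qed.

Lemma ptnormZ a (x : ptensor) : ptnorm (a *: x) = `|a| * ptnorm x.
Proof.
rewrite -[x]ptofK [_ *: _]ptscaleE !ptnormE.
apply: (cvg_unique _ (ftcnorm_cvg _)) => //=.
under eq_fun do rewrite pnorm_scale.
by apply: cvgM; [exact: cvg_cst|exact: ftcnorm_cvg].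
Qed.

Lemma ptnorm_eq0 (x : ptensor) : ptnorm x = 0 -> x = 0.
Proof.
rewrite -[x]ptofK ptnormE => h; apply/ptofP/asboolP => e e0.
have := ftcnorm_cvg (repr x); rewrite h => /cvgrPdist_le/(_ _ e0)[N _ hN].
exists N => n Nn; rewrite /ftsub /= cats0.
by have := hN n Nn; rewrite sub0r normrN ger0_norm// pnorm_ge0.
Qed.

HB.instance Definition _ :=
  @Lmodule_isNormed.Build R ptensor ptnorm ptnorm_le ptnormZ ptnorm_eq0.

Definition fttens x : ptensor := ptof (ftcst x).
Definition tens (a : A) (b : B) : ptensor := fttens [:: (a, b)].

Lemma fttens_norm x : `|fttens x| = pnorm x.
Proof.
rewrite [LHS]ptnormE; apply: (cvg_unique _ (ftcnorm_cvg _)) => //=.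
exact: cvg_cst.
Qed.

Lemma fttens_cat x y : fttens (x ++ y) = fttens x + fttens y.
Proof. by rewrite [RHS]ptaddE; apply: ptof_fteq. Qed.

Lemma fttens_scale a x : fttens (ftscale a x) = a *: fttens x.
Proof. by rewrite [RHS]ptscaleE; apply: ptof_fteq. Qed.

Lemma fttens_sub x y : fttens x - fttens y = fttens (ftsub x y).
Proof. by rewrite fttens_cat fttens_scale scaleN1r. Qed.

Lemma fttens_fteq x y : fteq x y -> fttens x = fttens y.
Proof. by move=> h; apply: ptof_fteq. Qed.

Lemma fttensE x : fttens x = \sum_(p <- x) tens p.1 p.2.
Proof.
elim: x => [|[a b] x ih]; first by rewrite big_nil.
by rewrite big_cons -ih -fttens_cat.
Qed.

Lemma tens_bilin : bilin tens.
Proof.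
split=> [b a u v|u a v w]; rewrite -fttens_scale -fttens_cat.
  apply: fttens_fteq => G f bf; rewrite fteval_cat fteval_scale//.
  by rewrite /fteval !(big_cons, big_nil) !addr0; case: bf => lf _; exact: lf.
apply: fttens_fteq => G f bf; rewrite fteval_cat fteval_scale//.
by rewrite /fteval !(big_cons, big_nil) !addr0; case: bf => _ lf; exact: lf.
Qed.

Lemma tens_le a b : `|tens a b| <= `|a| * `|b|.
Proof.
rewrite fttens_norm (le_trans (pnorm_le (fteq_refl _)))//.
by rewrite /ftweight big_cons big_nil addr0.
Qed.

Lemma fttens_dense (z : ptensor) (e : R) : 0 < e -> exists x, `|z - fttens x| <= e.
Proof.
move=> e0; have e2 : 0 < e / 2 by rewrite divr_gt0.
rewrite -[z]ptofK; set u := repr z; have [N hN] := ftcseqP u e0.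
exists (u N); rewrite /fttens -[- _]scaleN1r [_ *: _]ptscaleE [_ + _]ptaddE.
rewrite [leLHS]ptnormE; apply: (cvgr_to_le (ftcnorm_cvg _)).
by exists N => // n /= Nn; exact: hN.
Qed.

Lemma ptensor_complete (F : set_system ptensor) : ProperFilter F -> cauchy F -> cvg F.
Proof.
move=> FF /cauchyP Fc.
have /choice[x hx] (k : nat) : exists x, F (ball (fttens x) (2 * k.+1%:R^-1)).
  have k0 : 0 < k.+1%:R^-1 :> R by rewrite invr_gt0.
  have [z Fz] := Fc _ k0; have [x hx] := fttens_dense z k0; exists x.
  apply: filterS Fz => y; rewrite -!ball_normE /= => zy.
  rewrite -(subrK z (fttens x)) -addrA (le_lt_trans (ler_normD _ _))//.
  by rewrite mulrDl mul1r ler_ltD// distrC.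
have dx k l : pnorm (ftsub (x k) (x l)) <= 2 * k.+1%:R^-1 + 2 * l.+1%:R^-1.
  have [y []] := filter_ex (filterI (hx k) (hx l)); rewrite -!ball_normE /= => yk yl.
  rewrite -fttens_norm -fttens_sub -(subrK y (fttens (x k))) -addrA.
  by rewrite (le_trans (ler_normD _ _))// lerD// ltW// distrC.
have small (e : R) : 0 < e -> exists N, forall k, (N <= k)%N -> 2 * k.+1%:R^-1 <= e :> R.
  move=> e0; have e2 : 0 < e / 2 by rewrite divr_gt0.
  have /cvgrPdist_le/(_ _ e2)[N _ hN] := @cvg_harmonic R.
  exists N => k Nk; have := hN k Nk; rewrite sub0r normrN ger0_norm ?invr_ge0//.
  by rewrite ler_pdivlMr// mulrC.
have cx : `[< ftcauchy x >].
  apply/asboolP => e e0; have [N hN] := small (e / 2) (divr_gt0 e0 (ltr0Sn _ 1)).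
  exists N => m n Nm Nn; rewrite (le_trans (dx _ _))// [e]splitr.
  by rewrite lerD// hN.
apply/cvg_ex; exists (ptof (FtCseq cx)); apply/cvgrPdist_le => e e0.
have e4 : 0 < e / 4 by rewrite divr_gt0.
have [N hN] := small _ e4.
apply: filterS (hx N) => y; rewrite -ball_normE /= => yN.
set u := ptof _.
have uN : `|u - fttens (x N)| <= e / 4 + e / 4.
  rewrite /u /fttens -[- _]scaleN1r [_ *: _]ptscaleE [_ + _]ptaddE.
  rewrite [leLHS]ptnormE; apply: (cvgr_to_le (ftcnorm_cvg _)).
  exists N => // n /= Nn; rewrite (le_trans (dx _ _))// lerD ?hN//.
rewrite -(subrK (fttens (x N)) u) -addrA (le_trans (ler_normD _ _))//.
have -> : e = e / 4 + e / 4 + (e / 2) by lra.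
by rewrite lerD// ltW// (lt_le_trans yN)// (le_trans (hN _ (leqnn _)))//; lra.
Qed.

HB.instance Definition _ := Uniform_isComplete.Build ptensor ptensor_complete.

End ProjectiveTensor.

Section Lift.
Context {R : realType} {A B : normedModType R}.
Local Notation T := (ptensor A B).

(* The bounded linear map induced by a bounded bilinear [f]; the default 0 is
   taken when there is none. *)
Definition lift (G : normedModType R) (f : A -> B -> G) : blin T G :=
  xget 0 [set L : blin T G | forall a b, L (tens a b) = f a b].

Lemma fteval_le (G : normedModType R) (f : A -> B -> G) (C : R) x :
  0 <= C -> bilin f -> (forall a b, `|f a b| <= C * (`|a| * `|b|)) ->
  `|fteval f x| <= C * pnorm x.
Proof.
move=> C0 bf fC; apply/ler_addgt0Pr => e e0; have C1 : 0 < C + 1 by rewrite ltr_wpDl.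
have [y xy hy] := pnorm_adh x (divr_gt0 e0 C1); rewrite (xy G f bf).
apply: (@le_trans _ _ (C * ftweight y)).
  rewrite /fteval (le_trans (ler_norm_sum _ _ _))// mulr_sumr.
  by apply: ler_sum => p _; exact: fC.
rewrite (le_trans (ler_wpM2l C0 (ltW hy)))// mulrDr lerD2l.
by rewrite mulrCA ger_pMr// ler_pdivrMr// mul1r lerDl.
Qed.

Lemma lift_unique (G : normedModType R) (L M : blin T G) :
  (forall a b, L (tens a b) = M (tens a b)) -> L = M.
Proof.
move=> h; apply/subr0_eq; set D := L - M.
have D0 x : D (fttens x) = 0.
  by rewrite fttensE linear_sum big1// => p _; rewrite /= fctE h subrr.
suff Dz z : `|D z| <= 0.
  apply/val_inj/funext => z; apply/normr0_eq0/eqP.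
  by rewrite eq_le normr_ge0 andbT; exact: Dz.
apply/ler_addgt0Pl => e e0; rewrite addr0.
have n1 : 0 < `|D| + 1 by rewrite ltr_wpDl.
have [x hx] := fttens_dense z (divr_gt0 e0 n1).
have -> : D z = D (z - fttens x) by rewrite -[in LHS](subrK (fttens x) z) linearD [X in _ + X]D0 addr0.
rewrite (le_trans (ler_blin D _))//.
rewrite (le_trans (ler_wpM2l _ hx))// mulrCA ger_pMr// ler_pdivrMr// mul1r.
by rewrite lerDl.
Qed.

Lemma lift_ex (G : completeNormedModType R) (f : A -> B -> G) (C : R) :
  0 <= C -> bilin f -> (forall a b, `|f a b| <= C * (`|a| * `|b|)) ->
  exists L : blin T G, (forall a b, L (tens a b) = f a b) /\ `|L| <= C.
Proof.
move=> C0 bf fC.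
pose l (z : T) : G := lim (fteval f (repr z n) @[n --> \oo]).
have C1 : 0 < C + 1 by rewrite ltr_wpDl.
have cv (u : ftcseq A B) : cvg (fteval f (u n) @[n --> \oo]).
  apply/cauchy_cvgP/cauchy_exP => e e0.
  have e2 : 0 < e / 2 / (C + 1) by rewrite !divr_gt0.
  have [N hN] := ftcseqP u e2; exists (fteval f (u N)); exists N => //= n Nn.
  rewrite -ball_normE /= -fteval_sub// (le_lt_trans (fteval_le _ C0 bf fC))//.
  rewrite (le_lt_trans (ler_wpM2l C0 (hN _ _ _ _)))// mulrCA.
  rewrite (@le_lt_trans _ _ (e / 2))//.
    by rewrite ger_pMr ?divr_gt0// ler_pdivrMr// mul1r lerDl.
  by rewrite ltr_pdivrMr// ltr_pMr// ltr1n.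
have lE (u : ftcseq A B) : fteval f (u n) @[n --> \oo] --> l (ptof u).
  have /ptofP/asboolP h : ptof u = ptof (repr (ptof u)) by rewrite ptofK.
  have hv := cv (repr (ptof u)); apply/cvgrPdist_le => e e0.
  have e2 : 0 < e / 2 by rewrite divr_gt0.
  have [N hN] := h _ (divr_gt0 e2 C1); near=> n.
  rewrite -(subrK (fteval f (repr (ptof u) n)) (l _)) -addrA.
  rewrite (le_trans (ler_normD _ _))// [e]splitr lerD//.
    by near: n; move/cvgrPdist_le : hv; apply.
  rewrite distrC -fteval_sub// (le_trans (fteval_le _ C0 bf fC))//.
  rewrite (@le_trans _ _ (C * (e / 2 / (C + 1))))//.
    by rewrite ler_wpM2l// hN//; near: n; exists N.
  by rewrite mulrCA ger_pMr// ler_pdivrMr// mul1r lerDl.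
have ll : linear l.
  move=> a x y; rewrite -[x]ptofK -[y]ptofK.
  have -> : a *: ptof (repr x) + ptof (repr y) =
      ptof (ftcat (ftcscale a (repr x)) (repr y)) :> T.
    by rewrite [_ *: _]ptscaleE [LHS]ptaddE.
  apply: (cvg_unique _ (lE _)) => //=.
  rewrite (_ : (fun n => _) = (fun n => a *: fteval f (repr x n) + fteval f (repr y n))).
    by apply: cvgD; [apply: cvgZl_tmp|]; exact: lE.
  by apply/funext => n; rewrite fteval_cat fteval_scale.
have lC z : `|l z| <= C * `|z|.
  rewrite -[z]ptofK.
  have c : `|fteval f (repr z n)| @[n --> \oo] --> `|l (ptof (repr z))|.
    by apply: cvg_norm; exact: lE.
  have d : C * pnorm (repr z n) @[n --> \oo] --> C * `|ptof (repr z)|.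
    rewrite [in X in _ --> X]/Num.norm /= ptnormE.
    by apply: cvgM; [exact: cvg_cst|exact: ftcnorm_cvg].
  by apply: (ler_cvg_to c d); apply: nearW => n; exact: fteval_le.
have lb : l \in @blin_pred R T G by apply/asboolP; split => //; exists C.
exists (Blin lb); split; last exact: blin_norm_le.
move=> a b; apply: (cvg_unique _ (lE (ftcst [:: (a, b)]))) => //=.
rewrite (_ : (fun n => _) = fun=> f a b); first exact: cvg_cst.
by apply/funext => n; rewrite /fteval big_cons big_nil addr0.
Unshelve. all: by end_near. Qed.

Lemma liftE (G : completeNormedModType R) (f : A -> B -> G) (C : R) :
  bilin f -> (forall a b, `|f a b| <= C * (`|a| * `|b|)) ->
  forall a b, lift f (tens a b) = f a b.
Proof.
move=> bf fC.
have C0 : 0 <= Num.max C 0 by rewrite le_max lexx orbT.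
have fC' a b : `|f a b| <= Num.max C 0 * (`|a| * `|b|).
  by rewrite (le_trans (fC a b))// ler_wpM2r ?mulr_ge0// le_max lexx.
have [L [LE _]] := lift_ex C0 bf fC'.
by rewrite /lift; case: xgetP => [M -> //|/(_ L)]; case.
Qed.

Lemma lift_norm (G : completeNormedModType R) (f : A -> B -> G) (C : R) :
  0 <= C -> bilin f -> (forall a b, `|f a b| <= C * (`|a| * `|b|)) ->
  `|lift f| <= C.
Proof.
move=> C0 bf fC; have [L [LE LC]] := lift_ex C0 bf fC.
rewrite (_ : lift f = L)//; apply: lift_unique => a b.
by rewrite LE (liftE bf fC).
Qed.

End Lift.

Section BoundedBilinear.
Context {R : realType}.
Implicit Types A B G : normedModType R.

Definition bounded_bilinear A B G (f : A -> B -> G) : Prop :=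
  bilin f /\ exists C : R, forall a b, `|f a b| <= C * (`|a| * `|b|).

Lemma bounded_linear_comp A B G (g : B -> G) (f : A -> B) :
  bounded_linear g -> bounded_linear f -> bounded_linear (fun x => g (f x)).
Proof.
move=> [lg [N hN]] [lf [M hM]]; split=> [a x y|]; first by rewrite lf lg.
exists (Num.max N 0 * M) => x; rewrite (le_trans (hN _))// -mulrA.
rewrite (@le_trans _ _ (Num.max N 0 * `|f x|))//.
  by rewrite ler_wpM2r// le_max lexx.
by rewrite ler_wpM2l// le_max lexx orbT.
Qed.

Lemma bounded_linear_add A B (f g : A -> B) :
  bounded_linear f -> bounded_linear g -> bounded_linear (fun x => f x + g x).
Proof.
move=> [lf [N hN]] [lg [M hM]]; split=> [a x y|].
  by rewrite lf lg scalerDr addrACA.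
by exists (N + M) => x; rewrite (le_trans (ler_normD _ _))// mulrDl lerD.
Qed.

Lemma bounded_bilinear_blin A B G (L : blin A (blin B G)) :
  bounded_bilinear (fun a b => L a b).
Proof.
split; first split=> [b a x y|a]; first by rewrite linearP.
  exact: blin_is_linear.
exists `|L| => a b; rewrite mulrA (le_trans (ler_blin _ _))// ler_wpM2r//.
exact: ler_blin.
Qed.

Lemma bounded_bilinear_comp A B G A' B' (g : A -> B -> G)
    (f1 : A' -> A) (f2 : B' -> B) :
  bounded_bilinear g -> bounded_linear f1 -> bounded_linear f2 ->
  bounded_bilinear (fun a b => g (f1 a) (f2 b)).
Proof.
move=> [[gl gr] [C hC]] bf1 bf2; split.
  split=> [b a x y|a b x y]; first by rewrite (proj1 bf1); exact: gl.
  by rewrite (proj1 bf2); exact: gr.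
have e1 : blin_of f1 = f1 :> (A' -> A) := blin_ofE bf1.
have e2 : blin_of f2 = f2 :> (B' -> B) := blin_ofE bf2.
have M0 : 0 <= Num.max C 0 by rewrite le_max lexx orbT.
exists (Num.max C 0 * (`|blin_of f1| * `|blin_of f2|)) => a b.
rewrite (le_trans (hC _ _))// (@le_trans _ _ (Num.max C 0 * (`|f1 a| * `|f2 b|)))//.
  by rewrite ler_wpM2r ?mulr_ge0// le_max lexx.
rewrite -mulrA ler_wpM2l// mulrACA ler_pM//.
  by rewrite -[in leLHS]e1 ler_blin.
by rewrite -[in leLHS]e2 ler_blin.
Qed.

Lemma bounded_bilinear_post A B G G' (h : G -> G') (g : A -> B -> G) :
  bounded_linear h -> bounded_bilinear g -> bounded_bilinear (fun a b => h (g a b)).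
Proof.
move=> [lh [N hN]] [[gl gr] [C hC]]; split.
  split=> [b a x y|a b x y].
    have -> : g (a *: x + y) b = a *: g x b + g y b by exact: gl.
    exact: lh.
  have -> : g a (b *: x + y) = b *: g a x + g a y by exact: gr.
  exact: lh.
exists (Num.max N 0 * C) => a b; rewrite (le_trans (hN _))// -mulrA.
rewrite (@le_trans _ _ (Num.max N 0 * `|g a b|))//.
  by rewrite ler_wpM2r// le_max lexx.
by rewrite ler_wpM2l// le_max lexx orbT.
Qed.

Lemma bounded_bilinear_add A B G (f g : A -> B -> G) :
  bounded_bilinear f -> bounded_bilinear g ->
  bounded_bilinear (fun a b => f a b + g a b).
Proof.
move=> [[fl fr] [M hM]] [[gl gr] [N hN]]; split.
  split=> [b a x y|a b x y].
    have -> : f (a *: x + y) b = a *: f x b + f y b by exact: fl.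
    have -> : g (a *: x + y) b = a *: g x b + g y b by exact: gl.
    by rewrite scalerDr addrACA.
  have -> : f a (b *: x + y) = b *: f a x + f a y by exact: fr.
  have -> : g a (b *: x + y) = b *: g a x + g a y by exact: gr.
  by rewrite scalerDr addrACA.
by exists (M + N) => a b; rewrite (le_trans (ler_normD _ _))// mulrDl lerD.
Qed.

Lemma bounded_bilinear_flip A B G (f : A -> B -> G) :
  bounded_bilinear f -> bounded_bilinear (fun b a => f a b).
Proof.
by move=> [[fl fr] [M hM]]; split=> //; exists M => b a; rewrite [`|b| * _]mulrC.
Qed.

Lemma bounded_bilinear_tens A B : bounded_bilinear (@tens R A B).
Proof.
by split; [exact: tens_bilin|exists 1 => a b; rewrite mul1r; exact: tens_le].
Qed.

Lemma blin_of2E A B G (f : A -> B -> G) : bounded_bilinear f ->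
  forall a b, blin_of (fun a => blin_of (f a)) a b = f a b.
Proof.
move=> [[fl fr] [C hC]].
have C0 : 0 <= Num.max C 0 by rewrite le_max lexx orbT.
have fb a b : `|f a b| <= Num.max C 0 * `|a| * `|b|.
  by rewrite (le_trans (hC _ _))// -mulrA ler_wpM2r ?mulr_ge0// le_max lexx.
have inner a : blin_of (f a) = f a :> (B -> G).
  by apply: blin_ofE; split; [exact: fr|exists (Num.max C 0 * `|a|)].
move=> a b; rewrite blin_ofE ?inner//; split=> [c x y|].
  apply/val_inj/funext => v /=; rewrite !fctE !inner; exact: fl.
exists (Num.max C 0) => x; apply: blin_norm_le => [|v]; first exact: mulr_ge0.
by rewrite inner.
Qed.

Lemma lift_tens A B (G : completeNormedModType R) (f : A -> B -> G) :
  bounded_bilinear f -> forall a b, lift f (tens a b) = f a b.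
Proof. by move=> [bf [C hC]]; exact: (liftE bf hC). Qed.

Section Evaluation.
Context {A B : normedModType R} {n : nat} {beta : 'I_n.+1 -> R}.

Lemma wCn_Dn_le (f : wCn A B beta) (k : 'I_n.+1) x :
  `|Dn k f x| <= `|f| * (1 + `|x|) `^ beta k.
Proof.
have w0 : 0 < (1 + `|x|) `^ beta k by rewrite powR_gt0// ltr_wpDr.
rewrite -ler_pdivrMr// -powRN (le_trans (le_wrange f k x))//.
rewrite [leRHS]/Num.norm /= /wnorm (bigD1 k)//= lerDl; apply: sumr_ge0 => j _.
by apply: le_trans (le_wrange f j 0); rewrite mulr_ge0// powR_ge0.
Qed.

Lemma bounded_linear_Dn k (x : A) : (k <= n)%N ->
  bounded_linear (fun f : wCn A B beta => Dn k f x).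
Proof.
move=> kn; split=> [a f g|].
  have := Dn_linear a kn (wCn_Cn f) (wCn_Cn g).
  by move=> /(congr1 (fun h : A -> mlin A B k => h x)).
exists ((1 + `|x|) `^ beta (Ordinal (kn : (k < n.+1)%N))) => f.
by rewrite mulrC; exact: (wCn_Dn_le f (Ordinal (kn : (k < n.+1)%N)) x).
Qed.

End Evaluation.

End BoundedBilinear.

Section PartitionLimits.
Context {R : realType}.

(* As in [itv_partition s t pi], the partition of [s, t] consists of the points
   [s :: pi]; [zip (s :: pi) pi] lists its consecutive pairs. *)
Definition mesh (s : R) (pi : seq R) : R :=
  \big[Num.max/0]_(p <- zip (s :: pi) pi) (p.2 - p.1).

Definition partitions (s t : R) : set_system (seq R) :=
  [set P | exists2 d : R, 0 < d &
    forall pi, itv_partition s t pi -> mesh s pi < d -> P pi].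

Lemma fine_partition (s t d : R) : s <= t -> 0 < d ->
  exists2 pi, itv_partition s t pi & mesh s pi < d.
Proof.
move=> st d0; have h0 : 0 < d / 2 by rewrite divr_gt0.
have [n] : exists n : nat, t - s <= n%:R * (d / 2).
  exists (Num.truncn ((t - s) / (d / 2))).+1; rewrite -ler_pdivrMr// ltW//.
  exact: truncnS_gt.
elim: n s st => [|n ih] s st hn.
  have ts : s = t by move: hn st; rewrite mul0r subr_le0 => ? ?; apply/eqP; rewrite eq_le; apply/andP.
  by exists [::]; rewrite ?ts /itv_partition /mesh ?big_nil//= eqxx.
have [tsd|tsd] := leP t (s + d / 2).
  move: st; rewrite le_eqVlt => /predU1P[<-|s_t].
    by exists [::]; rewrite /itv_partition /mesh ?big_nil//= eqxx.
  exists [:: t]; first exact: itv_partition1.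
  rewrite /mesh /= big_cons big_nil gt_max d0 andbT /=.
  by rewrite ltrBlDl (le_lt_trans tsd)// ltrD2l ltr_pdivrMr// ltr_pMr// ltr1n.
have [|pi [p1 p2] mpi] := ih (s + d / 2) (ltW tsd).
  by move: hn; rewrite -natr1 mulrDl mul1r; lra.
exists (s + d / 2 :: pi); first by split => //=; rewrite ltrDl h0.
rewrite /mesh /= big_cons /= gt_max mpi andbT addrAC subrr add0r.
by rewrite ltr_pdivrMr// ltr_pMr// ltr1n.
Qed.

Lemma partitions_filter (s t : R) : s <= t -> ProperFilter (partitions s t).
Proof.
move=> st; split.
  by move=> [d d0 h]; have [pi] := fine_partition st d0; exact: h.
split; first by exists 1.
  move=> P Q [d d0 hP] [e e0 hQ]; exists (Num.min d e); first by rewrite lt_min d0.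
  by move=> pi ppi; rewrite lt_min => /andP[? ?]; split; [exact: hP|exact: hQ].
by move=> P Q PQ [d d0 hP]; exists d => // pi ppi mpi; exact/PQ/hP.
Qed.

Context {L : normedModType R}.

Definition psum (J : R -> R -> L) (s : R) (pi : seq R) : L :=
  \sum_(p <- zip (s :: pi) pi) J p.1 p.2.

Definition intcvg (J : R -> R -> L) (s t : R) : Prop :=
  cvg (psum J s pi @[pi --> partitions s t]).

Definition intlim (J : R -> R -> L) (s t : R) : L :=
  lim (psum J s pi @[pi --> partitions s t]).

End PartitionLimits.

Definition separable {T : topologicalType} : Prop :=
  exists2 D : set T, countable D & dense D.
Arguments separable T : clear implicits.

Section RoughPaths.
Context {R : realType} (T alpha : R).

Definition holder {L : normedModType R} (X : R -> L) : Prop :=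
  exists C : R, forall s t, 0 <= s <= T -> 0 <= t <= T ->
    `|X t - X s| <= C * `|t - s| `^ alpha.

Definition holder2 {L : normedModType R} (Q : R -> R -> L) : Prop :=
  exists C : R, forall s t, 0 <= s <= T -> 0 <= t <= T -> s != t ->
    `|Q s t| <= C * `|t - s| `^ (2 * alpha).

(* The compensators below are limits over partitions of [s, t], hence only
   defined for s <= t. *)
Definition holder2_le {L : normedModType R} (Q : R -> R -> L) : Prop :=
  exists C : R, forall s t, 0 <= s -> s <= t -> t <= T ->
    `|Q s t| <= C * `|t - s| `^ (2 * alpha).

Context {E : normedModType R}.

Definition rough_path (W : R -> E) (WW : R -> R -> ptensor E E) : Prop :=
  [/\ holder W, holder2 WW &
    forall s u t, 0 <= s <= T -> 0 <= u <= T -> 0 <= t <= T ->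
      WW s t - WW s u - WW u t = tens (W u - W s) (W t - W u)].

Definition controlled {L : normedModType R} (W : R -> E)
    (H : R -> L) (H' : R -> blin E L) : Prop :=
  [/\ holder H, holder H' &
    holder2 (fun s t => H t - H s - H' s (W t - W s))].

End RoughPaths.

Section Germs.
Context {R : realType} {E : normedModType R} (WW : R -> R -> ptensor E E).

Definition pswap (A B : normedModType R) : blin (ptensor A B) (ptensor B A) :=
  lift (fun a b => tens b a).

(* The limits over partitions of the following sums are respectively
   int A dB, int dA (B), int B (x) dB and the Young integral int A dQ. *)
Definition rint_germ (K1 K2 : normedModType R)
    (A : R -> blin K1 K2) (A' : R -> blin E (blin K1 K2))
    (B : R -> K1) (B' : R -> blin E K1) (s t : R) : K2 :=
  A s (B t - B s) + lift (fun p q => A' s p (B' s q)) (WW s t).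

Definition rintd_germ (K1 K2 : normedModType R)
    (A : R -> blin K1 K2) (A' : R -> blin E (blin K1 K2))
    (B : R -> K1) (B' : R -> blin E K1) (s t : R) : K2 :=
  (A t - A s) (B s) +
  lift (fun p q => A' s p (B' s q)) (pswap E E (WW s t)).

Definition rtens_germ (K1 : normedModType R)
    (B : R -> K1) (B' : R -> blin E K1) (s t : R) : ptensor K1 K1 :=
  tens (B s) (B t - B s) + lift (fun p q => tens (B' s p) (B' s q)) (WW s t).

Definition young_germ (K1 K2 : normedModType R)
    (A : R -> blin K1 K2) (Q : R -> R -> K1) (s t : R) : K2 :=
  A s (Q s t).

Section Compensators.
Context {V : normedModType R} (X : R -> blin V V) (X' : R -> blin E (blin V V))
  (Y : R -> V) (Y' : R -> blin E V).

Definition bracket (s t : R) : ptensor V V :=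
  tens (Y t - Y s) (Y t - Y s) -
  2 *: intlim (rtens_germ (fun r => Y r - Y s) Y') s t.

Definition bracketXY (s t : R) : V :=
  (X t - X s) (Y t - Y s) -
  2 *: intlim (rint_germ (fun r => X r - X s) X' Y Y') s t.

Definition bracketYX (s t : R) : V :=
  (X t - X s) (Y t - Y s) -
  2 *: intlim (rintd_germ X X' (fun r => Y r - Y s) Y') s t.

End Compensators.

End Germs.

(* F_t = W(t, Y_t), G_t = int_0^t W(dr, Y_r), H_t = Z_t DW(t, Y_t),
   X_t = int_0^t DW(dr, Y_r), and D2_t = Z_t D^2 W(t, Y_t). *)
Section ItoObjects.
Context {R : realType} {V K : normedModType R} {beta : 'I_4 -> R}.
Local Notation E := (wCn V V beta).
Context (W : R -> E) (WW : R -> R -> ptensor E E).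
Context (Y : R -> V) (Y' : R -> blin E V).
Context (Z : R -> blin V K) (Z' : R -> blin E (blin V K)).

Definition ItoF (t : R) : V := W t (Y t).

Definition ItoF' (t : R) : blin E V :=
  blin_of (fun p : E => p (Y t) + frechet (W t) (Y t) (Y' t p)).

Definition ItoG_germ (s t : R) : V :=
  (W t - W s : E) (Y s) +
  lift (fun p q : E => frechet q (Y s) (Y' s p)) (WW s t).

Definition ItoG (t : R) : V := intlim ItoG_germ 0 t.

Definition ItoG' (t : R) : blin E V := blin_of (fun p : E => p (Y t)).

Definition ItoH (t : R) : blin V K :=
  blin_of (fun v => Z t (frechet (W t) (Y t) v)).

Definition ItoH' (t : R) : blin E (blin V K) :=
  blin_of (fun p : E => blin_of (fun v =>
    Z' t p (frechet (W t) (Y t) v) +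
    Z t (frechet p (Y t) v) +
    Z t (frechet (frechet (W t)) (Y t) (Y' t p) v))).

Definition ItoX_germ (s t : R) : blin V V :=
  frechet (W t - W s : E) (Y s) +
  lift (fun p q : E => frechet (frechet q) (Y s) (Y' s p)) (WW s t).

Definition ItoX (t : R) : blin V V := intlim ItoX_germ 0 t.

Definition ItoX' (t : R) : blin E (blin V V) :=
  blin_of (fun p : E => frechet p (Y t)).

Definition ItoD2 (t : R) : blin (ptensor V V) K :=
  lift (fun u v => Z t (frechet (frechet (W t)) (Y t) u v)).

End ItoObjects.
Arguments ItoG' {R V} beta Y t.
Arguments ItoX' {R V} beta Y t.

(* The maps packed by [blin_of] and [lift] in the definitions above are bounded
   (bi)linear, so that their default values are never used. *)
Section ItoObjectsEval.
Context {R : realType} {V K : completeNormedModType R} {beta : 'I_4 -> R}.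
Local Notation E := (wCn V V beta).
Context (W : R -> E) (Y : R -> V) (Y' : R -> blin E V).
Context (Z : R -> blin V K) (Z' : R -> blin E (blin V K)).

Lemma ItoF'E t p :
  ItoF' W Y Y' t p = p (Y t) + frechet (W t) (Y t) (Y' t p).
Proof.
rewrite /ItoF' blin_ofE//; apply: bounded_linear_add.
  exact: (bounded_linear_Dn (Y t) (leq0n 3)).
by apply: bounded_linear_comp; exact: blin_bl.
Qed.

Lemma ItoG'E t p : ItoG' beta Y t p = p (Y t).
Proof.
by rewrite /ItoG' blin_ofE//; exact: (bounded_linear_Dn (Y t) (leq0n 3)).
Qed.

Lemma ItoHE t v : ItoH W Y Z t v = Z t (frechet (W t) (Y t) v).
Proof.
by rewrite /ItoH blin_ofE//; apply: bounded_linear_comp; exact: blin_bl.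
Qed.

Lemma bounded_linear_frechet y :
  bounded_linear (fun p : E => frechet p y : blin V V).
Proof. exact: (bounded_linear_Dn y (isT : (1 <= 3)%N)). Qed.

Lemma bounded_linear_frechet2 y :
  bounded_linear (fun p : E => frechet (frechet p) y : blin V (blin V V)).
Proof. exact: (bounded_linear_Dn y (isT : (2 <= 3)%N)). Qed.

Lemma ItoX'E t p : ItoX' beta Y t p = frechet p (Y t).
Proof. by rewrite /ItoX' blin_ofE//; exact: bounded_linear_frechet. Qed.

Lemma bounded_linear_id (A : normedModType R) : bounded_linear (@id A).
Proof. by split=> //; exists 1 => x; rewrite mul1r. Qed.

Lemma ItoH'E t p v : ItoH' W Y Y' Z Z' t p v =
  Z' t p (frechet (W t) (Y t) v) + Z t (frechet p (Y t) v) +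
  Z t (frechet (frechet (W t)) (Y t) (Y' t p) v).
Proof.
apply: blin_of2E; apply: bounded_bilinear_add.
  apply: bounded_bilinear_add.
    have b := bounded_bilinear_blin (Z' t).
    exact: (bounded_bilinear_comp b (bounded_linear_id E) (blin_bl _)).
  apply: bounded_bilinear_post; first exact: blin_bl.
  have b := bounded_bilinear_blin (blin_of (fun p : E => frechet p (Y t) : blin V V)).
  by rewrite (blin_ofE (bounded_linear_frechet (Y t))) in b.
apply: bounded_bilinear_post; first exact: blin_bl.
have b := bounded_bilinear_blin (frechet (frechet (W t)) (Y t)).
exact: (bounded_bilinear_comp b (blin_bl (Y' t)) (bounded_linear_id V)).
Qed.

Lemma ItoG_lift s (p q : E) :
  lift (fun p q : E => frechet q (Y s) (Y' s p)) (tens p q) =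
  frechet q (Y s) (Y' s p).
Proof.
apply: lift_tens; apply: bounded_bilinear_flip.
have b := bounded_bilinear_blin (blin_of (fun p : E => frechet p (Y s) : blin V V)).
rewrite (blin_ofE (bounded_linear_frechet (Y s))) in b.
exact: (bounded_bilinear_comp b (bounded_linear_id E) (blin_bl (Y' s))).
Qed.

Lemma ItoX_lift s (p q : E) :
  lift (fun p q : E => frechet (frechet q) (Y s) (Y' s p)) (tens p q) =
  frechet (frechet q) (Y s) (Y' s p).
Proof.
apply: lift_tens; apply: bounded_bilinear_flip.
have b := bounded_bilinear_blin
  (blin_of (fun p : E => frechet (frechet p) (Y s) : blin V (blin V V))).
rewrite (blin_ofE (bounded_linear_frechet2 (Y s))) in b.
exact: (bounded_bilinear_comp b (bounded_linear_id E) (blin_bl (Y' s))).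
Qed.

Lemma ItoD2E t u v :
  ItoD2 W Y Z t (tens u v) = Z t (frechet (frechet (W t)) (Y t) u v).
Proof.
apply: lift_tens; apply: bounded_bilinear_post; first exact: blin_bl.
exact: bounded_bilinear_blin.
Qed.

End ItoObjectsEval.

(* Main.v *)
Require Import Defs.
From HB Require Import structures.
From mathcomp Require Import all_boot all_order all_algebra.
From mathcomp Require Import all_classical all_reals all_analysis.
From mathcomp Require Import ring lra.
Set Implicit Arguments.
Unset Strict Implicit.
Unset Printing Implicit Defensive.
Import Order.TTheory GRing.Theory Num.Theory.
Import numFieldNormedType.Exports.
Local Open Scope classical_set_scope.
Local Open Scope ring_scope.

(** Call an expression J(s, t) negligible if it is at most a constant times
|t - s|^(3 alpha). As 3 alpha > 1, the sums of a negligible J over partitions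
tend to 0 with the mesh, so an identity between integrals follows from the same
identity, up to negligible terms, between their germs.

Convergence rests on the sewing lemma: the sums of a germ J converge as soon as
J(s, t) - J(s, u) - J(u, t) is negligible, and the limit is additive and differs
from J by a negligible term ([germ_sewing]).

Everything in the formula is a product or a rough integral of controlled paths.
By Taylor's formula the evaluation A_t : p |-> p(Y_t), a path of bounded operators
on E, is controlled by W, with A'_t(phi) : p |-> Dp(Y_t)(Y'_t phi)
([controlled_jet]), and so is A1_t : p |-> Dp(Y_t). With these, F = A W is a
product, G = int A dW and X = int A1 dW are rough integrals, and
H = Z o (A1 W) is again a product. So [controlled_product],
[rough_integral_controlled] and [rough_integral_cvg] give all the controlled
paths and all the rough integrals.

The formula itself is an expansion at the left endpoint s. By Taylor's formula of
order two, up to negligible terms,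
  F_st = W_st(Y_s) + DW_s(Y_s) Y_st + D^2 W_s(Y_s)(Y_st, Y_st) / 2
         + DW_st(Y_s) Y_st,
while <Y>_st is Y_st (x) Y_st - 2 (Y'_s (x) Y'_s) WW_st, and each of <<X, Y>>_st
and <<Y, X>>_st is DW_st(Y_s) Y_st minus twice an operator applied to WW_st.
Hence the terms of the formula that do not involve WW cancel, and the operators
applied to WW cancel too, as one sees on elementary tensors
([second_level_cancel]). This gives [defect_isO].

Of the two Young integrals, the one against <<X, Y>> + <<Y, X>> converges because
this sum is exactly additive, by integration by parts ([XYX_add]); the failure of
additivity of <<X, Y>> is X_ut Y_su - X_su Y_ut, which the other summand
compensates. The integral against <Y> then converges because all the other sums
in the expansion do. *)


(** * Equalities of linear combinations by reflection *)

Inductive lexpr (R : Type) :=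
  | LVar of nat | LZero | LAdd of lexpr R & lexpr R | LOpp of lexpr R
  | LScale of R & lexpr R.
Arguments LVar {R}.
Arguments LZero {R}.

(** Two formal linear combinations of the same vectors have equal values if they
have equal coefficients; this reduces an identity in a module to identities
between scalars. *)
Section LinearCombinations.
Context {R : realType} {V : lmodType R}.
Implicit Types (e : lexpr R) (env : seq V).

Fixpoint leval env e : V :=
  match e with
  | LVar n => nth 0 env n
  | LZero => 0
  | LAdd a b => leval env a + leval env b
  | LOpp a => - leval env a
  | LScale c a => c *: leval env a
  end.

Fixpoint lcoef e (i : nat) : R :=
  match e with
  | LVar n => if eqn n i then 1 else 0
  | LZero => 0
  | LAdd a b => lcoef a i + lcoef b i
  | LOpp a => - lcoef a i
  | LScale c a => c * lcoef a i
  end.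

Lemma leval_coef env e :
  leval env e = \sum_(i < size env) lcoef e i *: env`_i.
Proof.
elim: e => [n||a iha b ihb|a iha|c a iha] /=.
- have [ns|ns] := ltnP n (size env).
    rewrite (bigD1 (Ordinal ns))//= big1 ?addr0 ?(introT eqnP erefl) ?scale1r//.
    move=> i ni; case: ifPn; last by rewrite scale0r.
    by move=> /eqnP ei; case/eqP: ni; apply/val_inj.
  rewrite nth_default// big1// => i _; case: ifPn; last by rewrite scale0r.
  by move=> /eqnP ei; move: (ltn_ord i); rewrite -ei ltnNge ns.
- by rewrite big1// => i _; rewrite scale0r.
- by rewrite iha ihb -big_split; apply: eq_bigr => i _; rewrite scalerDl.
- by rewrite iha -sumrN; apply: eq_bigr => i _; rewrite scaleNr.
- by rewrite iha scaler_sumr; apply: eq_bigr => i _; rewrite scalerA.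
Qed.

Fixpoint same_coefs n e1 e2 : Prop :=
  if n is m.+1 then lcoef e1 m = lcoef e2 m /\ same_coefs m e1 e2 else True.

Lemma leval_eq env e1 e2 :
  same_coefs (size env) e1 e2 -> leval env e1 = leval env e2.
Proof.
rewrite !leval_coef; elim: (size env) => [|n ih] /=; first by rewrite !big_ord0.
by move=> [e12 /ih h]; rewrite !big_ord_recr /= e12 h.
Qed.

End LinearCombinations.

Ltac lmod_index x env :=
  match env with
  | x :: _ => constr:(0%N)
  | _ :: ?env' => let n := lmod_index x env' in constr:(S n)
  end.

(** The same vector may occur with distinct but convertible algebraic structures,
so atoms that are not found syntactically are looked up by unification. *)
Ltac lmod_index_conv x env :=
  match env with
  | ?y :: _ => let _ := match goal with _ => unify x y end in constr:(0%N)
  | _ :: ?env' => let n := lmod_index_conv x env' in constr:(S n)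
  end.

Ltac lmod_find x env :=
  match env with
  | _ => lmod_index x env
  | _ => lmod_index_conv x env
  end.

Ltac lmod_add x env :=
  match env with
  | _ => let n := lmod_find x env in env
  | _ => constr:(x :: env)
  end.

Ltac lmod_atoms e env :=
  lazymatch e with
  | GRing.add ?a ?b => let env1 := lmod_atoms b env in lmod_atoms a env1
  | GRing.opp ?a => lmod_atoms a env
  | GRing.zero => env
  | GRing.scale ?c ?a => lmod_atoms a env
  | _ => lmod_add e env
  end.

Ltac lmod_reify R e env :=
  lazymatch e with
  | GRing.add ?a ?b =>
      let a' := lmod_reify R a env in let b' := lmod_reify R b env in
      constr:(LAdd a' b')
  | GRing.opp ?a => let a' := lmod_reify R a env in constr:(LOpp a')
  | GRing.zero => constr:(@LZero R)
  | GRing.scale ?c ?a => let a' := lmod_reify R a env in constr:(@LScale R c a')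
  | _ => let n := lmod_find e env in constr:(@LVar R n)
  end.

(** Proves an equality between linear combinations over the real type [R]. *)
Ltac lmod R :=
  lazymatch goal with
  | |- @eq ?V ?x ?y =>
    let env0 := lmod_atoms x (@nil V) in
    let env := lmod_atoms y env0 in
    let ex := lmod_reify (Real.sort R) x env in
    let ey := lmod_reify (Real.sort R) y env in
    refine (@leval_eq R _ env ex ey _);
    cbn [size same_coefs lcoef eqn];
    repeat split; first [lra | ring | field]
  end.

(** * Bounded operators, products and tensors *)

Section BlinAlgebra.
Context {R : realType}.
Implicit Types A B C G : normedModType R.

Lemma blin_ext A B (f g : blin A B) : (forall x, f x = g x) -> f = g.
Proof. by move=> h; apply/val_inj/funext. Qed.

Lemma blinDE A B (f g : blin A B) x : (f + g) x = f x + g x.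
Proof. by []. Qed.

Lemma blinNE A B (f : blin A B) x : (- f) x = - f x.
Proof. by []. Qed.

Lemma blinZE A B a (f : blin A B) x : (a *: f) x = a *: f x.
Proof. by []. Qed.

Lemma blin0E A B x : (0 : blin A B) x = 0.
Proof. by []. Qed.

Definition blinE := (blinDE, blinNE, blinZE, blin0E).

Definition idL A : blin A A := blin_of id.

Lemma idLE A x : @idL A x = x.
Proof.
by rewrite /idL blin_ofE//; split=> //; exists 1 => y; rewrite mul1r.
Qed.

Definition bcomp A B C (g : blin B C) (f : blin A B) : blin A C :=
  blin_of (fun x => g (f x)).

Lemma bcompE A B C (g : blin B C) (f : blin A B) x : bcomp g f x = g (f x).
Proof. by rewrite /bcomp blin_ofE//; apply: bounded_linear_comp; exact: blin_bl. Qed.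

Definition blin2_of A B G (f : A -> B -> G) : blin A (blin B G) :=
  blin_of (fun a => blin_of (f a)).

(** With [bflip], a germ in which the operator is integrated, int dA (B), has the
shape of int A dB. *)
Definition bflip A B G (m : blin A (blin B G)) : blin B (blin A G) :=
  blin2_of (fun b a => m a b).

Lemma bflipE A B G (m : blin A (blin B G)) b a : bflip m b a = m a b.
Proof.
by rewrite /bflip /blin2_of blin_of2E//; exact/bounded_bilinear_flip/bounded_bilinear_blin.
Qed.

Lemma bounded_bilinear_bcomp A B C : bounded_bilinear (@bcomp A B C).
Proof.
split; first split=> [f a g h|g a f h]; try apply: blin_ext => x.
- by rewrite !(blinE, bcompE).
- by rewrite !(blinE, bcompE) linearP.
exists 1 => g f; rewrite mul1r; apply: blin_norm_le => [|x]; first exact: mulr_ge0.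
rewrite bcompE (le_trans (ler_blin _ _))// -mulrA ler_wpM2l//; exact: ler_blin.
Qed.

Definition bcompm A B C : blin (blin B C) (blin (blin A B) (blin A C)) :=
  blin2_of (@bcomp A B C).

Lemma bcompmE A B C (g : blin B C) (f : blin A B) : bcompm _ _ _ g f = bcomp g f.
Proof. by rewrite /bcompm /blin2_of blin_of2E//; exact: bounded_bilinear_bcomp. Qed.

Definition tensm A B : blin A (blin B (ptensor A B)) := blin2_of (@tens R A B).

Lemma tensmE A B (a : A) (b : B) : tensm A B a b = tens a b.
Proof. by rewrite /tensm /blin2_of blin_of2E//; exact: bounded_bilinear_tens. Qed.

End BlinAlgebra.

Section BlinTensor.
Context {R : realType} {E1 E2 A B : normedModType R} {G : completeNormedModType R}.

(** An operator on the projective tensor product is the lift of its values on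
elementary tensors, so its norm is controlled by these values. *)
Lemma blin_tens_norm_le (L : blin (ptensor E1 E2) G) (C : R) : 0 <= C ->
  (forall a b, `|L (tens a b)| <= C * (`|a| * `|b|)) -> `|L| <= C.
Proof.
move=> C0 LC; have [tl tr] := @tens_bilin R E1 E2.
have bi : bilin (fun a b => L (tens a b)).
  split=> [b a x y|a b x y].
    by have := tl b a x y; rewrite /= => ->; rewrite linearP.
  by have := tr a b x y; rewrite /= => ->; rewrite linearP.
rewrite (_ : L = Defs.lift (fun a b => L (tens a b))); first exact: lift_norm.
by apply: lift_unique => a b; rewrite (liftE bi LC).
Qed.

Variable m : blin A (blin B G).

(** This is the operator written A'B' in the rough integral of A against B, for a
product [m] of the values of A and B. *)
Definition bten (f : blin E1 A) (g : blin E2 B) : blin (ptensor E1 E2) G :=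
  Defs.lift (fun p q => m (f p) (g q)).

Lemma btenE f g p q : bten f g (tens p q) = m (f p) (g q).
Proof.
apply: lift_tens.
exact: (bounded_bilinear_comp (bounded_bilinear_blin m) (blin_bl f) (blin_bl g)).
Qed.

Lemma bounded_bilinear_bten : bounded_bilinear bten.
Proof.
split; first split=> [g a f h|f a g h]; try apply: lift_unique => p q.
- by rewrite !(blinE, btenE) linearP !blinE.
- by rewrite !(blinE, btenE) linearP.
exists `|m| => f g; apply: blin_tens_norm_le => [|p q]; first by rewrite !mulr_ge0.
rewrite btenE (le_trans (ler_blin _ _))// (le_trans (ler_wpM2r _ (ler_blin _ _)))//.
rewrite -!mulrA ler_wpM2l// [leRHS](_ : _ = (`|f| * `|p|) * (`|g| * `|q|)); last by ring.
by rewrite ler_pM// ler_blin.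
Qed.

Definition btenm : blin (blin E1 A) (blin (blin E2 B) (blin (ptensor E1 E2) G)) :=
  blin2_of bten.

Lemma btenmE f g : btenm f g = bten f g.
Proof. by rewrite /btenm /blin2_of blin_of2E//; exact: bounded_bilinear_bten. Qed.

End BlinTensor.

(** * Sums over partitions *)

Section PartitionSums.
Context {R : realType} {L : normedModType R}.
Implicit Types (J : R -> R -> L) (pi p q : seq R).

Lemma psum_nil J s : psum J s [::] = 0.
Proof. by rewrite /psum big_nil. Qed.

Lemma psum_cons J s u pi : psum J s (u :: pi) = J s u + psum J u pi.
Proof. by rewrite /psum big_cons. Qed.

Lemma psum_cat J s p q : psum J s (p ++ q) = psum J s p + psum J (last s p) q.
Proof.
elim: p s => [|u p ih] s /=; first by rewrite psum_nil add0r.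
by rewrite !psum_cons ih addrA.
Qed.

Lemma itv_partition_consE (s t u : R) pi :
  itv_partition s t (u :: pi) <-> s < u /\ itv_partition u t pi.
Proof.
rewrite /itv_partition/=; split=> [[/andP[su h1] h2]|[su [h1 h2]]]; first by split.
by rewrite su h1.
Qed.

End PartitionSums.

Section PartitionSumBounds.
Context {R : realType} {L : normedModType R}.
Implicit Types (J : R -> R -> L) (pi : seq R).

Lemma psum_le J (G : R -> R -> R) s t pi :
  (forall u v, s <= u -> u <= v -> v <= t -> `|J u v| <= G u v) ->
  itv_partition s t pi -> `|psum J s pi| <= psum G s pi.
Proof.
elim: pi s => [|u pi ih] s h; first by rewrite !psum_nil normr0.
move=> /itv_partition_consE[su put].
have ut := itv_partition_le put.
rewrite !psum_cons (le_trans (ler_normD _ _))//; apply: lerD.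
  by apply: h => //; exact: ltW.
by apply: ih => // x y ux; apply: h; rewrite (le_trans _ ux)// ltW.
Qed.

Lemma psum_incr (f : R -> L) s t pi :
  itv_partition s t pi -> psum (fun u v => f v - f u) s pi = f t - f s.
Proof.
elim: pi s => [|u pi ih] s; first by move=> /itv_partition_nil ->; rewrite psum_nil subrr.
by move=> /itv_partition_consE[_ /ih {}ih]; rewrite psum_cons ih; lmod R.
Qed.

End PartitionSumBounds.

Section Meshes.
Context {R : realType}.
Implicit Types (pi p q : seq R).

Lemma mesh_cons (s u : R) pi : mesh s (u :: pi) = Num.max (u - s) (mesh u pi).
Proof. by rewrite /mesh big_cons. Qed.

Lemma mesh_cat (s d : R) p q : mesh s p < d -> mesh (last s p) q < d ->
  mesh s (p ++ q) < d.
Proof.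
elim: p s => [|u p ih] s //=; rewrite !mesh_cons !gt_max => /andP[-> up] uq /=.
exact: ih.
Qed.

(** Write (v - u)^theta as (v - u)^(theta - 1) (v - u): the first factor is small
with the mesh and the second one telescopes. *)
Lemma psum_powR_mesh (theta d s t : R) pi : 1 < theta ->
  itv_partition s t pi -> mesh s pi < d ->
  psum (fun u v => (v - u) `^ theta) s pi <= d `^ (theta - 1) * (t - s).
Proof.
move=> th1; elim: pi s => [|u pi ih] s.
  by move=> /itv_partition_nil -> _; rewrite psum_nil subrr mulr0.
move=> /itv_partition_consE[su put]; rewrite mesh_cons gt_max => /andP[ud md].
rewrite psum_cons [leRHS](_ : _ = d `^ (theta - 1) * (u - s) +
  d `^ (theta - 1) * (t - u)); last by ring.
rewrite lerD ?ih// -[in leLHS](subrK 1 theta) [in leLHS]powRD; last first.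
  by apply/implyP; rewrite subrK => /eqP e; move: th1; rewrite e ltr10.
rewrite powRr1 ?subr_ge0 ?(ltW su)// ler_wpM2r ?subr_ge0 ?(ltW su)//.
have us : 0 <= u - s by rewrite subr_ge0 ltW.
by apply: ge0_ler_powR => //; rewrite ?subr_ge0 ?nnegrE ?ltW// (le_lt_trans us).
Qed.

(** The interval of the partition that contains [c], with the partitions on both
of its sides. *)
Lemma itv_partition_straddle (s t c : R) pi : itv_partition s t pi -> s <= c -> c < t ->
  exists p u q, [/\ pi = p ++ u :: q, itv_partition s (last s p) p,
    itv_partition u t q & last s p <= c < u].
Proof.
elim: pi s => [|v pi ih] s.
  by move=> /itv_partition_nil <- sc /(le_lt_trans sc); rewrite ltxx.
move=> /itv_partition_consE[sv pv] sc ct.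
have [vc|cv] := leP v c.
  have [p [u [q [-> ps uq /andP[h1 h2]]]]] := ih v pv vc ct.
  exists (v :: p), u, q; split => //; last by rewrite /= h1.
  by apply/itv_partition_consE.
by exists [::], v, pi; split=> //=; rewrite sc.
Qed.

Lemma itv_partition_ge (s t x : R) pi : itv_partition s t pi -> x \in pi -> s < x.
Proof.
by move=> [/= h _] xp; move: h => /(order_path_min lt_trans)/allP/(_ _ xp).
Qed.

Lemma common_refinement (s t : R) p q : itv_partition s t p -> itv_partition s t q ->
  exists pi, [/\ itv_partition s t pi, {subset p <= pi} & {subset q <= pi}].
Proof.
have [->|st] := eqVneq s t.
  by move=> /itv_partitionxx -> /itv_partitionxx ->; exists [::].
move=> hp hq; set r := sort <=%R (undup (p ++ q)).
have mr x : (x \in r) = (x \in p) || (x \in q).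
  by rewrite mem_sort mem_undup mem_cat.
have ge x : x \in r -> s < x.
  by rewrite mr => /orP[]; [exact: (itv_partition_ge hp)|exact: (itv_partition_ge hq)].
have le x : x \in r -> x <= t.
  have aux pi : itv_partition s t pi -> x \in pi -> x <= t.
    move=> + xp; case/splitPr: xp => p1 p2 [].
    rewrite cat_path last_cat /= => /and3P[_ _ xp2] tp2.
    exact: (@itv_partition_le _ _ x t p2 (conj xp2 tp2)).
  by rewrite mr => /orP[]; [exact: (aux p)|exact: (aux q)].
have tr : t \in r.
  rewrite mr; case: p hp {r mr ge le} => [/itv_partition_nil e|u p [_ /=]].
    by rewrite e eqxx in st.
  by move=> /eqP <-; rewrite mem_last.
have sr : sorted <%R r.
  by rewrite lt_sorted_uniq_le sort_uniq undup_uniq; exact: sort_le_sorted.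
exists r; split; [|by move=> x xp; rewrite mr xp|by move=> x xp; rewrite mr xp orbT].
split.
  rewrite path_sortedE; last exact: lt_trans.
  by rewrite sr andbT; apply/allP => x /ge.
case/lastP: r sr tr le {ge mr} => [//|r x sr tr le].
rewrite last_rcons eq_le le ?mem_rcons ?inE ?eqxx//=.
move: tr; rewrite mem_rcons inE => /predU1P[->//|tr].
move: sr; rewrite -cats1 -(rev_sorted) rev_cat /= => /(order_path_min (rev_trans lt_trans)).
by move=> /allP/(_ t); rewrite mem_rev => /(_ tr) /ltW.
Qed.

Lemma itv_partition_split (s t u : R) p q : itv_partition s t (u :: p) ->
  itv_partition s t q -> {subset u :: p <= q} ->
  exists q1 q2, [/\ q = q1 ++ q2, itv_partition s u q1, itv_partition u t q2 &
    {subset p <= q2}].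
Proof.
move=> /itv_partition_consE[su hp] + sub; have uq : u \in q by rewrite sub ?mem_head.
move=> hq; case/splitPr: uq hq sub => q1 q2 [].
rewrite cat_path last_cat /= => /and3P[sq1 q1u uq2] lq2 sub.
exists (rcons q1 u), q2; split => //.
- by rewrite cat_rcons.
- by split; rewrite ?rcons_path ?sq1 ?q1u// last_rcons.
move=> x xp; have ux := itv_partition_ge hp xp.
have := sub x; rewrite inE xp orbT mem_cat inE => /(_ isT)/or3P[|/eqP xu|//].
  move=> xq1; have : x < u.
    have : path <%R s (rcons q1 u) by rewrite rcons_path sq1.
    rewrite -cats1 => /path_sorted; rewrite -rev_sorted rev_cat /=.
    move=> /(order_path_min (rev_trans lt_trans))/allP/(_ x).
    by rewrite mem_rev => /(_ xq1).
  by move=> /(lt_trans ux); rewrite ltxx.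
by move: ux; rewrite xu ltxx.
Qed.

End Meshes.

(** * The sewing lemma *)

Section Sewing.
Context {R : realType}.

Lemma halfX_lt (theta : R) : 1 < theta -> 2 * 2^-1 `^ theta < 1.
Proof.
move=> th1; have h : (theta - 1) + 1 = theta by rewrite subrK.
rewrite -h powRD; last by apply/implyP; rewrite h => /eqP e; move: th1; rewrite e ltr10.
rewrite powRr1// mulrCA mulfV// mulr1.
have e1 : (1 : R) `^ (theta - 1) = 1 by rewrite powR1.
rewrite -[ltRHS]e1.
by apply: gt0_ltr_powR; rewrite ?nnegrE ?subr_gt0// invf_lt1// ltr1n.
Qed.

(** The solution of K = 2 K / 2^theta + 2 C: the recursion for the constant when an
interval is cut into two parts of at most half its length, at the cost of two
defects of additivity. *)
Definition sew_cst (theta C : R) : R := 2 * C / (1 - 2 * 2^-1 `^ theta).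

Lemma sew_cst_ge0 theta C : 1 < theta -> 0 <= C -> 0 <= sew_cst theta C.
Proof.
by move=> th1 C0; rewrite divr_ge0 ?mulr_ge0// subr_ge0 ltW// halfX_lt.
Qed.

Context {L : completeNormedModType R} (T theta C : R) (J : R -> R -> L).
Hypotheses (th1 : 1 < theta) (C0 : 0 <= C).
Hypothesis dJ : forall s u t : R, 0 <= s -> s <= u -> u <= t -> t <= T ->
  `|J s t - J s u - J u t| <= C * (t - s) `^ theta.
Let K := sew_cst theta C.

Let K0 : 0 <= K. Proof. exact: sew_cst_ge0. Qed.

Let le_powR (x y : R) : 0 <= x -> x <= y -> x `^ theta <= y `^ theta.
Proof.
move=> x0 xy; apply: ge0_ler_powR => //; rewrite ?nnegrE//.
  exact: ltW (lt_trans ltr01 th1).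
exact: le_trans xy.
Qed.

(** Single out the interval of the partition, from [v] to [u], that contains the
midpoint.
What remains on either side has at most half the length, so induction applies to
both sides with a gain of 2^(- theta) each, and only the two defects at [v] and
[u] are added. *)
Lemma young_bound n pi s t : (size pi <= n)%N -> 0 <= s -> t <= T ->
  itv_partition s t pi -> `|psum J s pi - J s t| <= K * (t - s) `^ theta.
Proof.
elim: n pi s t => [|n ih] pi s t sz s0 tT hpi.
  all: have st := itv_partition_le hpi.
  all: have [e|nst] := eqVneq s t.
  1,3: subst t; rewrite (itv_partitionxx hpi) psum_nil sub0r;
    have := dJ s0 (lexx s) (lexx s) tT; rewrite !subrr sub0r powR0 ?mulr0//;
    by rewrite gt_eqF// (lt_trans ltr01 th1).
- by move: hpi nst; move: sz; case: pi => // _ /itv_partition_nil ->; rewrite eqxx.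
have {nst st} st : s < t by rewrite lt_neqAle nst.
have [sc ct] : s <= (s + t) / 2 /\ (s + t) / 2 < t by split; lra.
have [p [u [q [epi hp hq /andP[vc cu]]]]] := itv_partition_straddle hpi sc ct.
set v := last s p in hp vc.
have sv := itv_partition_le hp; have ut := itv_partition_le hq.
have vu : v <= u by rewrite (le_trans vc)// ltW.
have ip : `|psum J s p - J s v| <= K * (v - s) `^ theta.
  apply: ih => //; last by rewrite (le_trans vu)// (le_trans ut).
  by move: sz; rewrite epi size_cat /= addnS ltnS; apply: leq_trans; exact: leq_addr.
have iq : `|psum J u q - J u t| <= K * (t - u) `^ theta.
  apply: ih => //; last by rewrite (le_trans s0)// (le_trans sv).
  by move: sz; rewrite epi size_cat /= addnS ltnS; apply: leq_trans; exact: leq_addl.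
have half : ((t - s) / 2) `^ theta = 2^-1 `^ theta * (t - s) `^ theta.
  by rewrite mulrC powRM// subr_ge0 ltW.
have vs2 : (v - s) `^ theta <= 2^-1 `^ theta * (t - s) `^ theta.
  by rewrite -half le_powR ?subr_ge0//; lra.
have tu2 : (t - u) `^ theta <= 2^-1 `^ theta * (t - s) `^ theta.
  by rewrite -half le_powR ?subr_ge0//; lra.
have d1 : `|J s t - J s v - J v t| <= C * (t - s) `^ theta.
  by apply: dJ => //; rewrite (le_trans vu).
have d2 : `|J v t - J v u - J u t| <= C * (t - s) `^ theta.
  apply: le_trans (dJ (le_trans s0 sv) vu ut tT) _; rewrite ler_wpM2l// le_powR//.
    by rewrite subr_ge0 (le_trans vu).
  by rewrite lerD2l lerN2.
have -> : psum J s pi - J s t = (psum J s p - J s v) + (psum J u q - J u t) -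
    (J s t - J s v - J v t) - (J v t - J v u - J u t).
  by rewrite epi psum_cat psum_cons -/v; lmod R.
rewrite (le_trans (ler_normB _ _))// (le_trans (lerD (ler_normB _ _) (lexx _)))//.
rewrite (le_trans (lerD (lerD (ler_normD _ _) (lexx _)) (lexx _)))//.
have := lerD (lerD (lerD ip iq) d1) d2 => /le_trans; apply.
have := lerD (ler_wpM2l K0 vs2) (ler_wpM2l K0 tu2).
set h := (t - s) `^ theta => hk.
have Ke : K * (1 - 2 * 2^-1 `^ theta) = 2 * C.
  by rewrite /K /sew_cst divfK// subr_eq0 gt_eqF// halfX_lt.
have : K * h = 2 * (K * (2^-1 `^ theta * h)) + 2 * C * h.
  by rewrite -Ke; ring.
lra.
Qed.

(** A refinement partitions each interval of the coarser partition, so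
[young_bound] applies on each of them. *)
Lemma refinement_bound p q s t : 0 <= s -> t <= T ->
  itv_partition s t p -> itv_partition s t q -> {subset p <= q} ->
  `|psum J s q - psum J s p| <= psum (fun u v => K * (v - u) `^ theta) s p.
Proof.
elim: p q s => [|u p ih] q s s0 tT hp hq sub.
  by move: hp hq => /itv_partition_nil -> /itv_partitionxx ->; rewrite !psum_nil subrr normr0.
have [q1 [q2 [eq hq1 hq2 sub2]]] := itv_partition_split hp hq sub.
have lq1 : last s q1 = u by case: hq1 => _ /eqP.
move: hp => /itv_partition_consE[su hp]; have ut := itv_partition_le hp.
rewrite !psum_cons eq psum_cat lq1.
have -> : psum J s q1 + psum J u q2 - (J s u + psum J u p) =
    (psum J s q1 - J s u) + (psum J u q2 - psum J u p) by lmod R.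
rewrite (le_trans (ler_normD _ _))//; apply: lerD.
  by apply: (@young_bound (size q1)) => //; exact: le_trans tT.
by apply: ih => //; rewrite (le_trans s0)// ltW.
Qed.

Lemma psumK s p : psum (fun u v => K * (v - u) `^ theta) s p =
  K * psum (fun u v => (v - u) `^ theta) s p.
Proof. by rewrite /psum mulr_sumr. Qed.

Lemma small_power e s t : s <= t -> 0 < e -> exists2 d : R, 0 < d &
  K * (d `^ (theta - 1) * (t - s)) < e.
Proof.
move=> st e0; have A0 : 0 < K * (t - s) + 1.
  by rewrite ltr_wpDl// mulr_ge0// subr_ge0.
have th10 : 0 < theta - 1 by rewrite subr_gt0.
exists ((e / (K * (t - s) + 1)) `^ (theta - 1)^-1).
  by rewrite powR_gt0// divr_gt0.
rewrite -powRrM mulVf ?gt_eqF// powRr1 ?divr_ge0// ?ltW//.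
by rewrite mulrCA mulrAC ltr_pdivrMr// ltr_pM2l// ltrDl.
Qed.

(** Two fine partitions are compared through a common refinement. *)
Lemma sewing_cvg s t : 0 <= s -> s <= t -> t <= T -> intcvg J s t.
Proof.
move=> s0 st tT; have PF := partitions_filter st.
apply/cauchy_cvgP/cauchy_exP => e e0.
have [d d0 hd] := small_power st (divr_gt0 e0 (ltr0Sn _ 1)).
have [p0 hp0 mp0] := fine_partition st d0.
exists (psum J s p0); exists d => // p hp mp; rewrite -ball_normE /=.
have [r [hr pr p0r]] := common_refinement hp hp0.
have b q : itv_partition s t q -> mesh s q < d -> {subset q <= r} ->
    `|psum J s r - psum J s q| < e / 2.
  move=> hq mq sub; apply: (le_lt_trans (refinement_bound s0 tT hq hr sub)).
  rewrite psumK (le_lt_trans _ hd)// ler_wpM2l//.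
  exact: psum_powR_mesh.
have -> : psum J s p0 - psum J s p =
    (psum J s r - psum J s p) - (psum J s r - psum J s p0) by lmod R.
by rewrite (le_lt_trans (ler_normB _ _))// [e]splitr ltrD ?b.
Qed.

Lemma sewing_lim s t : 0 <= s -> s <= t -> t <= T ->
  psum J s pi @[pi --> partitions s t] --> intlim J s t.
Proof. by move=> s0 st tT; exact: sewing_cvg. Qed.

Lemma sewing_bound s t : 0 <= s -> s <= t -> t <= T ->
  `|intlim J s t - J s t| <= K * (t - s) `^ theta.
Proof.
move=> s0 st tT; have PF := partitions_filter st.
have c : `|psum J s pi - J s t| @[pi --> partitions s t] --> `|intlim J s t - J s t|.
  by apply: cvg_norm; apply: cvgB; [exact: sewing_lim|exact: cvg_cst].
apply: (cvgr_to_le c); exists 1 => // pi hpi _.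
exact: (@young_bound (size pi)).
Qed.

(** Concatenating fine partitions of both parts gives a fine partition of the
whole. *)
Lemma sewing_add (s u t : R) : 0 <= s -> s <= u -> u <= t -> t <= T ->
  intlim J s t = intlim J s u + intlim J u t.
Proof.
move=> s0 su ut tT.
have F1 := partitions_filter su; have F2 := partitions_filter ut.
have c1 := sewing_lim s0 su (le_trans ut tT).
have c2 := sewing_lim (le_trans s0 su) ut tT.
have c := sewing_lim s0 (le_trans su ut) tT.
apply/eqP; rewrite -subr_eq0 -normr_le0; apply/ler_addgt0Pl => e e0; rewrite addr0.
have e3 : 0 < e / 3 by rewrite divr_gt0.
have /cvgrPdist_le/(_ _ e3)[d1 d10 h1] := c1.
have /cvgrPdist_le/(_ _ e3)[d2 d20 h2] := c2.
have F := partitions_filter (le_trans su ut).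
have /cvgrPdist_le/(_ _ e3)[d d0 h] := c.
have m1 : 0 < Num.min d1 d by rewrite lt_min d10.
have m2 : 0 < Num.min d2 d by rewrite lt_min d20.
have [p hp mp] := fine_partition su m1; have [q hq mq] := fine_partition ut m2.
move: mp mq; rewrite !lt_min => /andP[mp1 mp] /andP[mq2 mq].
have lp : last s p = u by case: hp => _ /eqP.
have mpq : mesh s (p ++ q) < d by rewrite mesh_cat// lp.
have := h _ (itv_partition_cat hp hq) mpq; rewrite psum_cat lp => b.
have b1 := h1 _ hp mp1; have b2 := h2 _ hq mq2.
have -> : intlim J s t - (intlim J s u + intlim J u t) =
  (intlim J s t - (psum J s p + psum J u q)) - (intlim J s u - psum J s p) -
  (intlim J u t - psum J u q) by lmod R.
rewrite (le_trans (ler_normB _ _))// (le_trans (lerD (ler_normB _ _) (lexx _)))//.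
have := lerD (lerD b b1) b2 => /le_trans; apply; lra.
Qed.

End Sewing.

Section Negligible.
Context {R : realType} {L : normedModType R} (T theta C : R) (J : R -> R -> L).

Lemma negligible_germ s t : 1 < theta -> 0 <= C -> 0 <= s -> s <= t -> t <= T ->
  (forall s t : R, 0 <= s -> s <= t -> t <= T -> `|J s t| <= C * (t - s) `^ theta) ->
  psum J s pi @[pi --> partitions s t] --> (0 : L).
Proof.
move=> th1 C0 s0 st tT hJ; have PF := partitions_filter st.
apply/cvgrPdist_lt => e e0.
have A0 : 0 < C * (t - s) + 1 by rewrite ltr_wpDl// mulr_ge0// subr_ge0.
have th10 : 0 < theta - 1 by rewrite subr_gt0.
exists ((e / (C * (t - s) + 1)) `^ (theta - 1)^-1).
  by rewrite powR_gt0// divr_gt0.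
move=> pi hpi mpi; rewrite sub0r normrN.
apply: (@le_lt_trans _ _ (psum (fun u v => C * (v - u) `^ theta) s pi)).
  apply: (psum_le _ hpi) => u v su uv vt.
  by apply: hJ => //; [exact: le_trans su|exact: le_trans tT].
rewrite {1}/psum -mulr_sumr -/(psum (fun u v => (v - u) `^ theta) s pi).
apply: (le_lt_trans (ler_wpM2l C0 (psum_powR_mesh th1 hpi mpi))).
rewrite -powRrM mulVf ?gt_eqF// powRr1 ?divr_ge0// ?ltW//.
by rewrite mulrCA mulrAC ltr_pdivrMr// ltr_pM2l// ltrDl.
Qed.

End Negligible.

(** * Mean value inequality and Taylor bounds *)

Section MeanValue.
Context {R : realType} {B : normedModType R}.

(** The supremum of the points [x] at which the bound |g x - g 0| <= C x holds
satisfies it, by the local estimate on its left, and if it were less than 1 the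
local estimate on its right would yield a larger such point. *)
Lemma mean_value_local (g : R -> B) (C : R) :
  (forall x, 0 <= x <= 1 -> exists2 d : R, 0 < d &
    forall y, 0 <= y <= 1 -> `|y - x| < d -> `|g y - g x| <= C * `|y - x|) ->
  `|g 1 - g 0| <= C.
Proof.
move=> loc; pose S : set R := [set x | 0 <= x <= 1 /\ `|g x - g 0| <= C * x].
have S0 : S 0 by split; rewrite ?subrr ?normr0 ?mulr0 ?lexx ?ler01.
have hS : has_sup S by split; [exists 0|exists 1 => x [/andP[]]].
have c0 : 0 <= sup S by apply: ub_le_sup => //; case: hS.
have c1 : sup S <= 1 by apply: ge_sup; [exists 0|move=> x [/andP[]]].
have [|d d0 hd] := loc (sup S); first by rewrite c0.
have Sc : S (sup S).
  split; first by rewrite c0.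
  have [x [/andP[x0 x1] xS] xc] := sup_adherent d0 hS.
  have xs : x <= sup S by apply: ub_le_sup; [case: hS|split=> //; rewrite x0].
  have xd : `|x - sup S| = sup S - x by rewrite distrC ger0_norm ?subr_ge0.
  have := hd x; rewrite x0 x1 xd => /(_ isT) h.
  have {}h := h ltac:(lra).
  rewrite -(subrK (g x) (g (sup S))) -addrA (le_trans (ler_normD _ _))//.
  by rewrite distrC; have := lerD h xS; lra.
have [c|c] := ltP (sup S) 1; last first.
  have e : sup S = 1 by apply/eqP; rewrite eq_le c1.
  by case: Sc => _; rewrite e mulr1.
pose y := Num.min (sup S + d / 2) 1.
have cy : sup S < y by rewrite lt_min c ltrDl divr_gt0.
have yd : y <= sup S + d / 2 by rewrite ge_min lexx.
have y1 : y <= 1 by rewrite ge_min lexx orbT.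
have y0 : 0 <= y by rewrite (le_trans c0)// ltW.
have ny : `|y - sup S| = y - sup S by rewrite gtr0_norm ?subr_gt0.
have := hd y; rewrite y0 y1 ny => /(_ isT) h.
have {}h := h ltac:(lra).
have Sy : S y.
  split; first by rewrite y0.
  rewrite -(subrK (g (sup S)) (g y)) -addrA (le_trans (ler_normD _ _))//.
  by case: Sc => _ hc; have := lerD h hc; lra.
have : y <= sup S by apply: ub_le_sup; case: hS.
by rewrite leNgt cy.
Qed.

End MeanValue.

Section TaylorSegment.
Context {R : realType} {A : normedModType R}.

Lemma frechet_local (B : normedModType R) (f : A -> B) z e :
  differentiable f z -> 0 < e -> exists2 d : R, 0 < d &
  forall k, `|k| < d -> `|f (z + k) - f z - frechet f z k| <= e * `|k|.
Proof.
move=> df e0; have := diff_locally df => /eqaddoP/(_ _ e0).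
rewrite near_simpl => /nbhs_normP[d /= d0 hd]; exists d => // k kd.
have := hd k; rewrite /ball_ /= sub0r normrN => /(_ kd).
by rewrite frechetE// -addrA -opprD [z + k]addrC.
Qed.

(** Mean value inequality for r |-> f (x + r h) - r a - r^2 b, whose derivative is
the expression that is assumed to be bounded. The Taylor bounds of orders 0, 1
and 2 are the cases a = b = 0, then a = Df(x) h and b = 0, then a = Df(x) h and
b = D^2 f(x)(h, h) / 2. *)
Lemma segment_remainder (B : normedModType R) (f : A -> B) (x h : A) (a b : B) (C : R) :
  (forall z, differentiable f z) ->
  (forall r, 0 <= r <= 1 -> `|frechet f (x + r *: h) h - a - (2 * r) *: b| <= C) ->
  `|f (x + h) - f x - a - b| <= C.
Proof.
move=> df hC; apply/ler_addgt0Pr => e e0.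
pose g r := f (x + r *: h) - r *: a - r ^+ 2 *: b.
have -> : f (x + h) - f x - a - b = g 1 - g 0.
  by rewrite /g !expr0n expr1n !scale1r !scale0r addr0; lmod R.
apply: mean_value_local => r r01; set z := x + r *: h.
have h1 : 0 < `|h| + 1 by rewrite ltr_wpDl.
have b1 : 0 < `|b| + 1 by rewrite ltr_wpDl.
have e1 : 0 < e / 2 / (`|h| + 1) by rewrite !divr_gt0.
have [d d0 hd] := frechet_local (df z) e1.
(* The first bound keeps u h where the derivative approximates f with an error of
   at most |u| e / 2; the second bounds u^2 b in the same way. *)
exists (Num.min (d / (`|h| + 1)) (e / 2 / (`|b| + 1))).
  by rewrite lt_min !divr_gt0.
move=> r' _; rewrite lt_min; set u := r' - r => /andP[u1 u2].
have hk := hd (u *: h); have := hC r r01; rewrite -/z => hr.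
have -> : g r' - g r = (f (z + u *: h) - f z - frechet f z (u *: h)) +
   (u *: (frechet f z h - a - (2 * r) *: b) - u ^+ 2 *: b).
  have -> : z + u *: h = x + r' *: h by rewrite /z /u; lmod R.
  by rewrite [frechet f z (u *: h)]linearZ /g /= -/z /u; lmod R.
have ud : `|u *: h| < d.
  rewrite normrZ (@le_lt_trans _ _ (`|u| * (`|h| + 1)))//.
    by rewrite ler_wpM2l// lerDl.
  by rewrite -ltr_pdivlMr.
rewrite (le_trans (ler_normD _ _))//.
rewrite (le_trans (lerD (hk ud) (ler_normB _ _)))// ![`|_ *: _|]normrZ.
have t1 : e / 2 / (`|h| + 1) * (`|u| * `|h|) <= e / 2 * `|u|.
  have -> : e / 2 / (`|h| + 1) * (`|u| * `|h|) =
    (e / 2 * `|u|) * (`|h| / (`|h| + 1)) by ring.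
  apply: ler_piMr; last by rewrite ler_pdivrMr// mul1r lerDl.
  by rewrite mulr_ge0// ltW// divr_gt0.
have t2 : `|u| * `|u| * `|b| <= `|u| * (e / 2).
  rewrite -mulrA ler_wpM2l// (@le_trans _ _ (`|u| * (`|b| + 1)))//.
    by rewrite ler_wpM2l// lerDl.
  by rewrite -ler_pdivlMr// ltW.
have t3 : `|u| * `|frechet f z h - a - (2 * r) *: b| <= `|u| * C by rewrite ler_wpM2l.
lra.
Qed.

Lemma segment_lipschitz (B : normedModType R) (f : A -> B) (x h : A) (C : R) :
  (forall z, differentiable f z) ->
  (forall r, 0 <= r <= 1 -> `|frechet f (x + r *: h)| <= C) ->
  `|f (x + h) - f x| <= C * `|h|.
Proof.
move=> df hC; rewrite -[f (x + h) - f x]subr0 -[f (x + h) - f x - 0]subr0.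
apply: segment_remainder => // r r01; rewrite scaler0 !subr0.
by rewrite (le_trans (ler_blin _ _))// ler_wpM2r// hC.
Qed.

Let subsegment (r s : R) : 0 <= r <= 1 -> 0 <= s <= 1 -> 0 <= s * r <= 1.
Proof.
move=> /andP[r0 r1] /andP[s0 s1]; rewrite mulr_ge0//=.
by rewrite -[leRHS]mulr1 ler_pM.
Qed.

Lemma segment_taylor1 (B : normedModType R) (f : A -> B) (x h : A) (C : R) :
  (forall z, differentiable f z) -> (forall z, differentiable (frechet f) z) ->
  (forall r, 0 <= r <= 1 -> `|frechet (frechet f) (x + r *: h)| <= C) ->
  `|f (x + h) - f x - frechet f x h| <= C * `|h| ^+ 2.
Proof.
move=> df ddf hC; rewrite -[f (x + h) - f x - _]subr0.
apply: segment_remainder => // r r01; rewrite scaler0 subr0.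
have C0 : 0 <= C by rewrite (le_trans _ (hC r r01)).
have := @segment_lipschitz _ (frechet f) x (r *: h) C ddf _ => /(_ _) b.
have {}b := b ltac:(by move=> s s01; rewrite scalerA; exact/hC/subsegment).
 rewrite -[X in `|X|]/((frechet f (x + r *: h) - frechet f x) h).
rewrite (le_trans (ler_blin _ _))// expr2 mulrA ler_wpM2r// (le_trans b)//.
case/andP: r01 => r0 r1.
by rewrite ler_wpM2l// normrZ ger0_norm// ler_piMl.
Qed.

Lemma segment_taylor2 (B : normedModType R) (f : A -> B) (x h : A) (C : R) :
  (forall z, differentiable f z) -> (forall z, differentiable (frechet f) z) ->
  (forall z, differentiable (frechet (frechet f)) z) ->
  (forall r, 0 <= r <= 1 -> `|frechet (frechet (frechet f)) (x + r *: h)| <= C) ->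
  `|f (x + h) - f x - frechet f x h - 2^-1 *: frechet (frechet f) x h h| <=
    C * `|h| ^+ 3.
Proof.
move=> df ddf dddf hC.
apply: segment_remainder => // r r01.
have C0 : 0 <= C by rewrite (le_trans _ (hC r r01)).
have := @segment_taylor1 _ (frechet f) x (r *: h) C ddf dddf _ => /(_ _) b.
have {}b := b ltac:(by move=> s s01; rewrite scalerA; exact/hC/subsegment).
have -> : frechet f (x + r *: h) h - frechet f x h -
    (2 * r) *: (2^-1 *: frechet (frechet f) x h h) =
    (frechet f (x + r *: h) - frechet f x - frechet (frechet f) x (r *: h)) h.
  by rewrite !blinE [frechet (frechet f) x (r *: h)]linearZ !blinE; lmod R.
rewrite (le_trans (ler_blin _ _))// exprSr mulrA ler_wpM2r// (le_trans b)//.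
case/andP: r01 => r0 r1.
by rewrite ler_wpM2l// ler_pXn2r// ?nnegrE// normrZ ger0_norm// ler_piMl.
Qed.

End TaylorSegment.

(** * Orders of magnitude *)

(** [f] is of order [n] in the gauge [w], uniformly on [P]. The gauge will be
|t - s|^alpha, so that orders are natural numbers that add up in products: paths
have increments of order 1, remainders of controlled paths are of order 2, and
terms of order 3 are negligible. *)
Definition isO {R : realType} {I : Type} (P : I -> Prop) (w : I -> R) (n : nat)
    {L : normedModType R} (f : I -> L) : Prop :=
  exists2 C : R, 0 <= C & forall i, P i -> `|f i| <= C * w i ^+ n.

Section IsO.
Context {R : realType} {I : Type} {P : I -> Prop} {w : I -> R}.

Section NoGauge.
Context {L : normedModType R}.
Implicit Types f g : I -> L.

Lemma isO_ext n f g : (forall i, P i -> f i = g i) -> isO P w n g -> isO P w n f.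
Proof. by move=> fg [C C0 hC]; exists C => // i Pi; rewrite fg// hC. Qed.

Lemma isO_cst (c : L) : isO P w 0 (fun=> c).
Proof. by exists `|c| => // i _; rewrite mulr1. Qed.

Lemma isOD n f g : isO P w n f -> isO P w n g -> isO P w n (fun i => f i + g i).
Proof.
move=> [C C0 hC] [D D0 hD]; exists (C + D) => [|i Pi]; first exact: addr_ge0.
by rewrite (le_trans (ler_normD _ _))// mulrDl lerD ?hC ?hD.
Qed.

Lemma isON n f : isO P w n f -> isO P w n (fun i => - f i).
Proof. by move=> [C C0 hC]; exists C => // i Pi; rewrite normrN hC. Qed.

Lemma isOB n f g : isO P w n f -> isO P w n g -> isO P w n (fun i => f i - g i).
Proof. by move=> hf /isON; exact: isOD. Qed.

Lemma isOZ n (c : R) f : isO P w n f -> isO P w n (fun i => c *: f i).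
Proof.
move=> [C C0 hC]; exists (`|c| * C) => [|i Pi]; first exact: mulr_ge0.
by rewrite normrZ -mulrA ler_wpM2l ?hC.
Qed.

End NoGauge.

Lemma isO_mul_le n k (L L1 L2 : normedModType R)
    (f : I -> L) (g : I -> L1) (h : I -> L2) :
  (forall i, P i -> `|f i| <= `|g i| * `|h i|) ->
  isO P w n g -> isO P w k h -> isO P w (n + k) f.
Proof.
move=> fgh [C C0 hC] [D D0 hD]; exists (C * D) => [|i Pi]; first exact: mulr_ge0.
by rewrite (le_trans (fgh i Pi))// exprD mulrACA ler_pM ?hC ?hD.
Qed.

Lemma isO_app n k (A B : normedModType R) (f : I -> blin A B) (g : I -> A) :
  isO P w n f -> isO P w k g -> isO P w (n + k) (fun i => f i (g i)).
Proof. by apply: isO_mul_le => i _; exact: ler_blin. Qed.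

Lemma isO_tens n k (A B : normedModType R) (f : I -> A) (g : I -> B) :
  isO P w n f -> isO P w k g -> isO P w (n + k) (fun i => tens (f i) (g i)).
Proof. by apply: isO_mul_le => i _; exact: tens_le. Qed.

Lemma isO_le n k (L : normedModType R) (f : I -> L) :
  (exists M : R, forall i, P i -> 0 <= w i <= M) -> (k <= n)%N ->
  isO P w n f -> isO P w k f.
Proof.
move=> [M hM] kn [C C0 hC].
exists (C * `|M| ^+ (n - k)) => [|i Pi]; first by rewrite mulr_ge0// exprn_ge0.
have /andP[wi0 wiM] := hM i Pi.
rewrite (le_trans (hC i Pi))// -mulrA ler_wpM2l// -[in leLHS](subnK kn) exprD.
rewrite ler_wpM2r ?exprn_ge0//; apply: lerXn2r; rewrite ?nnegrE//.
by rewrite (le_trans wiM)// ler_norm.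
Qed.

End IsO.

Section Domains.
Context {R : realType} (T alpha : R).

Definition square (i : R * R) : Prop := 0 <= i.1 <= T /\ 0 <= i.2 <= T.
Definition ordered2 (i : R * R) : Prop := [/\ 0 <= i.1, i.1 <= i.2 & i.2 <= T].
Definition ordered3 (i : R * R * R) : Prop :=
  [/\ 0 <= i.1.1, i.1.1 <= i.1.2, i.1.2 <= i.2 & i.2 <= T].

Definition gauge2 (i : R * R) : R := `|i.2 - i.1| `^ alpha.
Definition gauge3 (i : R * R * R) : R := `|i.2 - i.1.1| `^ alpha.

(** Estimates are proved once for two abstract instants [a] and [b]: they serve for
pairs (s, t) as well as for the three pairs in a triple s <= u <= t. *)
Definition times {I} (P : I -> Prop) (a : I -> R) : Prop :=
  forall i, P i -> 0 <= a i <= T.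
Definition steps {I} (P : I -> Prop) (w : I -> R) (a b : I -> R) : Prop :=
  forall i, P i -> `|b i - a i| `^ alpha <= w i.

Hypothesis alpha0 : 0 < alpha.

Lemma powR_gauge (x : R) n : 0 <= x -> (0 < n)%N -> (x `^ alpha) ^+ n = x `^ (n%:R * alpha).
Proof. by move=> x0 n0; rewrite mulrC powRrM powR_mulrn// powR_ge0. Qed.

Lemma powR_le (x y : R) : 0 <= x -> x <= y -> x `^ alpha <= y `^ alpha.
Proof.
move=> x0 xy; apply: ge0_ler_powR; rewrite ?nnegrE//; first exact: ltW.
exact: le_trans xy.
Qed.

Lemma gauge2_bounded (P : R * R -> Prop) : (forall i, P i -> square i) ->
  exists M : R, forall i, P i -> 0 <= gauge2 i <= M.
Proof.
move=> sP; exists (T `^ alpha) => i /sP[/andP[a b] /andP[c d]].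
rewrite powR_ge0/= powR_le// ler_norml; apply/andP; split; lra.
Qed.

Lemma ordered2_square i : ordered2 i -> square i.
Proof.
by move=> [a b c]; split; rewrite ?a ?c ?andbT//= ?(le_trans a)// ?(le_trans b).
Qed.

Section Frame.
Context {I : Type} (P : I -> Prop) (w : I -> R).
Context {L : normedModType R}.

Lemma isO_holder (X : R -> L) a b : holder T alpha X ->
  times P a -> times P b -> steps P w a b -> isO P w 1 (fun i => X (b i) - X (a i)).
Proof.
move=> [C hC] ta tb sab; exists `|C| => // i Pi.
apply: le_trans (hC _ _ (ta i Pi) (tb i Pi)) _.
apply: (@le_trans _ _ (`|C| * `|b i - a i| `^ alpha)).
  by rewrite ler_wpM2r ?powR_ge0// ler_norm.
by rewrite ler_wpM2l// sab.
Qed.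

Lemma isO_bounded (X : R -> L) a : holder T alpha X -> times P a ->
  isO P w 0 (fun i => X (a i)).
Proof.
move=> [C hC] ta; exists (`|X 0| + `|C| * T `^ alpha) => [|i Pi].
  by rewrite addr_ge0// mulr_ge0// powR_ge0.
have /andP[a0 aT] := ta i Pi; have T0 := le_trans a0 aT.
rewrite mulr1 -[X (a i)](subrK (X 0)) addrC (le_trans (ler_normD _ _))// lerD2l.
rewrite (le_trans (hC _ _ _ (ta i Pi)))// ?lexx// subr0 ger0_norm//.
apply: (@le_trans _ _ (`|C| * a i `^ alpha)).
  by rewrite ler_wpM2r ?powR_ge0// ler_norm.
by rewrite ler_wpM2l// powR_le.
Qed.

(** [holder2] says nothing on the diagonal, where the gauge vanishes; hence the
assumption on [Q t t]. *)
Lemma isO_holder2 (Q : R -> R -> L) a b : holder2 T alpha Q -> (forall t : R, 0 <= t <= T -> Q t t = 0) ->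
  times P a -> times P b -> steps P w a b -> isO P w 2 (fun i => Q (a i) (b i)).
Proof.
move=> [C hC] Q0 ta tb sab; exists `|C| => // i Pi.
have wi0 : 0 <= w i by rewrite (le_trans _ (sab i Pi))// powR_ge0.
have [e|ab] := eqVneq (a i) (b i).
  by rewrite e Q0 ?normr0 ?mulr_ge0 ?exprn_ge0//; exact: tb.
apply: le_trans (hC _ _ (ta i Pi) (tb i Pi) ab) _.
rewrite -powR_gauge//.
apply: (@le_trans _ _ (`|C| * (`|b i - a i| `^ alpha) ^+ 2)).
  by rewrite ler_wpM2r ?exprn_ge0 ?powR_ge0// ler_norm.
by rewrite ler_wpM2l// lerXn2r ?nnegrE ?powR_ge0// sab.
Qed.

End Frame.

Lemma holderP (L : normedModType R) (X : R -> L) :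
  isO square gauge2 1 (fun i => X i.2 - X i.1) -> holder T alpha X.
Proof. by move=> [C C0 hC]; exists C => s t hs ht; exact: (hC (s, t)). Qed.

Lemma holder2P (L : normedModType R) (Q : R -> R -> L) :
  isO square gauge2 2 (fun i => Q i.1 i.2) -> holder2 T alpha Q.
Proof.
move=> [C C0 hC]; exists C => s t hs ht _.
by have := hC (s, t) (conj hs ht); rewrite /gauge2 powR_gauge.
Qed.

Lemma holder2_leP (L : normedModType R) (Q : R -> R -> L) :
  isO ordered2 gauge2 2 (fun i => Q i.1 i.2) -> holder2_le T alpha Q.
Proof.
move=> [C C0 hC]; exists C => s t s0 st tT.
by have := hC (s, t) (And3 s0 st tT); rewrite /gauge2 powR_gauge.
Qed.

Lemma isO_ordered2 n (L : normedModType R) (f : R * R -> L) :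
  isO square gauge2 n f -> isO ordered2 gauge2 n f.
Proof. by move=> [C C0 hC]; exists C => // i /ordered2_square; exact: hC. Qed.

Section GermSewing.
Context {L : completeNormedModType R} (J : R -> R -> L).
Hypothesis alpha3 : 3^-1 < alpha.
Let th1 : 1 < 3 * alpha. Proof. by have := alpha3; lra. Qed.

Lemma germ_sewing :
  isO ordered3 gauge3 3 (fun i => J i.1.1 i.2 - J i.1.1 i.1.2 - J i.1.2 i.2) ->
  [/\ (forall s t : R, 0 <= s -> s <= t -> t <= T -> intcvg J s t),
      (forall s u t : R, 0 <= s -> s <= u -> u <= t -> t <= T ->
        intlim J s t = intlim J s u + intlim J u t) &
      isO ordered2 gauge2 3 (fun i => intlim J i.1 i.2 - J i.1 i.2)].
Proof.
move=> [C C0 hC].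
have dJ s u t : 0 <= s -> s <= u -> u <= t -> t <= T ->
    `|J s t - J s u - J u t| <= C * (t - s) `^ (3 * alpha).
  move=> s0 su ut tT; have := hC (s, u, t) (And4 s0 su ut tT).
  by rewrite /gauge3 /= ger0_norm ?subr_ge0 ?(le_trans su)// powR_gauge// subr_ge0 (le_trans su).
split.
- exact: (sewing_cvg th1 C0 dJ).
- exact: (sewing_add th1 C0 dJ).
exists (sew_cst (3 * alpha) C) => [|i [s0 st tT]]; first exact: sew_cst_ge0.
have ts : 0 <= i.2 - i.1 by rewrite subr_ge0.
have := sewing_bound th1 C0 dJ s0 st tT.
by rewrite /gauge2 ger0_norm// powR_gauge.
Qed.

End GermSewing.

Lemma isO_negligible (L : normedModType R) (J : R -> R -> L) (s t : R) : 3^-1 < alpha ->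
  isO ordered2 gauge2 3 (fun i => J i.1 i.2) -> 0 <= s -> s <= t -> t <= T ->
  psum J s pi @[pi --> partitions s t] --> (0 : L).
Proof.
move=> a3 [C C0 hC] s0 st tT; apply: (@negligible_germ _ _ T (3 * alpha) C) => //.
  by lra.
move=> u v u0 uv vT; have := hC (u, v) (And3 u0 uv vT).
by rewrite /gauge2 /= ger0_norm ?subr_ge0// powR_gauge// subr_ge0.
Qed.

End Domains.

(** * Rough integrals of controlled paths *)

Section BlinLinear.
Context {R : realType} {A B : normedModType R}.
Implicit Types f : blin A B.
Lemma blinrD f x y : f (x + y) = f x + f y. Proof. exact: linearD. Qed.
Lemma blinrN f x : f (- x) = - f x. Proof. exact: linearN. Qed.
Lemma blinrZ f a x : f (a *: x) = a *: f x.
Proof. by have := blin_is_linear f a x 0; rewrite !addr0 (linear0 f) addr0. Qed.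
Lemma blinr0 f : f 0 = 0. Proof. exact: linear0. Qed.
End BlinLinear.
Definition blin_lin := (@blinrD, @blinrN, @blinrZ, @blinr0, @blinDE, @blinNE, @blinZE, @blin0E).

Section PsumLinear.
Context {R : realType} {L : normedModType R}.
Implicit Types f g : R -> R -> L.

Lemma psumD f g s pi :
  psum (fun s t => f s t + g s t) s pi = psum f s pi + psum g s pi.
Proof. by rewrite /psum big_split. Qed.

Lemma psumZ c f s pi : psum (fun s t => c *: f s t) s pi = c *: psum f s pi.
Proof. by rewrite /psum scaler_sumr. Qed.

Lemma psumB f g s pi :
  psum (fun s t => f s t - g s t) s pi = psum f s pi - psum g s pi.
Proof. by rewrite /psum big_split sumrN. Qed.

Lemma eq_psum f g s pi : (forall s t, f s t = g s t) -> psum f s pi = psum g s pi.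
Proof. by move=> fg; apply: eq_bigr. Qed.

End PsumLinear.

Section RoughGerm.
Context {R : realType} {E : normedModType R} {L1 L2 : normedModType R}
  {L : completeNormedModType R}.
Variables (WW : R -> R -> ptensor E E) (m : blin L1 (blin L2 L)).

(** One germ for the integrals int A dB, int B (x) dB and int dA (B), and for
int A dW: the product [m] is respectively the application of operators, the
tensor product and the flipped application. *)
Definition rough_germ (A : R -> L1) (A' : R -> blin E L1) (B : R -> L2)
    (B' : R -> blin E L2) (s t : R) : L :=
  m (A s) (B t - B s) + bten m (A' s) (B' s) (WW s t).

Lemma psum_rough_germ_shift A A' B B' c s t pi : itv_partition s t pi ->
  psum (rough_germ (fun r => A r - c) A' B B') s pi =
  psum (rough_germ A A' B B') s pi - m c (B t - B s).
Proof.
move=> hpi; have -> : m c (B t - B s) = m c (B t) - m c (B s) by rewrite !blin_lin.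
rewrite -(psum_incr (fun r => m c (B r)) hpi) -psumB; apply: eq_psum => u v.
by rewrite /rough_germ !blin_lin; lmod R.
Qed.

End RoughGerm.

Section RoughIntegration.
Context {R : realType} {T alpha : R} {E : normedModType R}.
Context {W : R -> E} {WW : R -> R -> ptensor E E}.
Hypotheses (alpha3 : 3^-1 < alpha) (hW : rough_path T alpha W WW).

Lemma alpha_gt0 : 0 < alpha. Proof. by have := alpha3; lra. Qed.
Let alpha0 := alpha_gt0.

(** Chen's relation at s = u = t. *)
Lemma rough_diag t : 0 <= t <= T -> WW t t = 0.
Proof.
case: hW => _ _ chen ht; have := chen t t t ht ht ht.
rewrite subrr sub0r subrr => e.
have t0 : tens (0 : E) (0 : E) = 0.
  by have := tens_le (0 : E) (0 : E); rewrite normr0 mul0r normr_le0 => /eqP.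
by rewrite -[LHS]opprK e t0 oppr0.
Qed.

Lemma square_fst : times T (square T) fst. Proof. by move=> i []. Qed.
Lemma square_snd : times T (square T) snd. Proof. by move=> i []. Qed.
Lemma square_steps : steps alpha (square T) (gauge2 alpha) fst snd.
Proof. by move=> i _; exact: lexx. Qed.
Lemma ordered_fst : times T (ordered2 T) fst. Proof. by move=> i /ordered2_square[]. Qed.
Lemma ordered_snd : times T (ordered2 T) snd. Proof. by move=> i /ordered2_square[]. Qed.
Lemma ordered_steps : steps alpha (ordered2 T) (gauge2 alpha) fst snd.
Proof. by move=> i _; exact: lexx. Qed.
Lemma ordered_bounded : exists M : R, forall i, ordered2 T i -> 0 <= gauge2 alpha i <= M.
Proof. exact: (gauge2_bounded alpha0 (@ordered2_square R T)). Qed.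

Lemma triple_s : times T (ordered3 T) (fun i => i.1.1).
Proof. by move=> i [a b c d]; apply/andP; split; lra. Qed.
Lemma triple_u : times T (ordered3 T) (fun i => i.1.2).
Proof. by move=> i [a b c d]; apply/andP; split; lra. Qed.
Lemma triple_t : times T (ordered3 T) (fun i => i.2).
Proof. by move=> i [a b c d]; apply/andP; split; lra. Qed.
Lemma triple_su : steps alpha (ordered3 T) (gauge3 alpha) (fun i => i.1.1) (fun i => i.1.2).
Proof.
by move=> i [a b c d]; apply: powR_le => //; rewrite !ger0_norm; lra.
Qed.
Lemma triple_ut : steps alpha (ordered3 T) (gauge3 alpha) (fun i => i.1.2) (fun i => i.2).
Proof.
by move=> i [a b c d]; apply: powR_le => //; rewrite !ger0_norm; lra.
Qed.
Lemma controlled_isO (L : normedModType R) (H : R -> L) H' I (P : I -> Prop) w a b :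
  controlled T alpha W H H' -> times T P a -> times T P b -> steps alpha P w a b ->
  isO P w 2 (fun i => H (b i) - H (a i) - H' (a i) (W (b i) - W (a i))).
Proof.
move=> [_ _ h2] ta tb sab.
apply: (isO_holder2 h2 _ ta tb sab) => t _.
by rewrite !subrr blinr0 subrr.
Qed.

Lemma second_level_isO I (P : I -> Prop) w a b :
  times T P a -> times T P b -> steps alpha P w a b ->
  isO P w 2 (fun i => WW (a i) (b i)).
Proof.
case: hW => _ h2 _ ta tb sab.
exact: (isO_holder2 h2 rough_diag ta tb sab).
Qed.

(** Limits over partitions are only available for s <= t, while controlled paths
are estimated for s and t in any order. *)
Lemma isO_square_sym n (L : normedModType R) (f : R * R -> L) :
  isO (ordered2 T) (gauge2 alpha) n f ->
  isO (ordered2 T) (gauge2 alpha) n (fun i => f (i.2, i.1)) ->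
  isO (square T) (gauge2 alpha) n f.
Proof.
move=> [C C0 hC] [D D0 hD]; exists (C + D) => [|[s t] [/andP[a b] /andP[c d]]].
  exact: addr_ge0.
have w0 : 0 <= gauge2 alpha (s, t) ^+ n by rewrite exprn_ge0// powR_ge0.
rewrite mulrDl; have [st|/ltW ts] := leP s t.
  by rewrite (le_trans (hC (s, t) _))// lerDl mulr_ge0.
have := hD (t, s) (And3 c ts b); rewrite /gauge2 /= distrC => h.
by rewrite (le_trans h)// lerDr mulr_ge0.
Qed.

Section Bilinear.
Context {L1 L2 : normedModType R} {L : normedModType R} (m : blin L1 (blin L2 L)).

Lemma holder_bilin (A : R -> L1) (B : R -> L2) :
  holder T alpha A -> holder T alpha B -> holder T alpha (fun t => m (A t) (B t)).
Proof.
move=> hA hB; apply: holderP.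
apply: (@isO_ext _ _ _ _ _ _ _ (fun i => m (A i.2 - A i.1) (B i.2) +
    m (A i.1) (B i.2 - B i.1))).
  by move=> i _; rewrite !blin_lin; lmod R.
have dA := isO_holder hA square_fst square_snd square_steps.
have dB := isO_holder hB square_fst square_snd square_steps.
have A0 := isO_bounded alpha0 (gauge2 alpha) hA square_fst.
have B0 := isO_bounded alpha0 (gauge2 alpha) hB square_snd.
have m0 := isO_cst (P := square T) (w := gauge2 alpha) m.
apply: isOD.
  exact: (isO_app (isO_app m0 dA) B0).
exact: (isO_app (isO_app m0 A0) dB).
Qed.

Definition product' (A : R -> L1) (A' : R -> blin E L1) (B : R -> L2)
    (B' : R -> blin E L2) (t : R) : blin E L :=
  bcomp (bflip m (B t)) (A' t) + bcomp (m (A t)) (B' t).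

Lemma product'E A A' B B' t p :
  product' A A' B B' t p = m (A' t p) (B t) + m (A t) (B' t p).
Proof. by rewrite /product' blinDE !bcompE bflipE. Qed.

End Bilinear.

Lemma holder_comp (L1 L2 : normedModType R) (A : R -> blin L1 L2) (B' : R -> blin E L1) :
  holder T alpha A -> holder T alpha B' -> holder T alpha (fun t => bcomp (A t) (B' t)).
Proof.
move=> hA hB; have := holder_bilin (bcompm E L1 L2) hA hB.
by rewrite (_ : (fun t => _) = (fun t => bcomp (A t) (B' t)))//; apply/funext => t; rewrite bcompmE.
Qed.

Lemma holderD (L : normedModType R) (X Y : R -> L) :
  holder T alpha X -> holder T alpha Y -> holder T alpha (fun t => X t + Y t).
Proof.
move=> hX hY; apply: holderP.
apply: (@isO_ext _ _ _ _ _ _ _ (fun i => (X i.2 - X i.1) + (Y i.2 - Y i.1))).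
  by move=> i _; lmod R.
by apply: isOD; exact: (isO_holder _ square_fst square_snd square_steps).
Qed.

Lemma holder_cst (L : normedModType R) (c : L) : holder T alpha (fun=> c).
Proof. by exists 0 => s t _ _; rewrite subrr normr0 mul0r. Qed.

Lemma holder_linear (L1 L2 : normedModType R) (f : blin L1 L2) (X : R -> L1) :
  holder T alpha X -> holder T alpha (fun t => f (X t)).
Proof.
move=> hX; apply: holderP.
apply: (@isO_ext _ _ _ _ _ _ _ (fun i => f (X i.2 - X i.1))).
  by move=> i _; rewrite !blin_lin.
apply: (isO_app (n := 0) (isO_cst _)).
exact: (isO_holder hX square_fst square_snd square_steps).
Qed.

(** Leibniz' rule: the remainder of a product is the sum of the remainders of the
factors times the other factor, plus the product of the increments. *)
Lemma controlled_product (L1 L2 L : normedModType R) (m : blin L1 (blin L2 L)) A A' B B' :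
  controlled T alpha W A A' -> controlled T alpha W B B' ->
  controlled T alpha W (fun t => m (A t) (B t)) (product' m A A' B B').
Proof.
move=> cA cB; case: (cA) => hA hA' _; case: (cB) => hB hB' _; split.
- exact: holder_bilin.
- apply: holderD; apply: holder_comp => //; last exact: holder_linear.
  exact: (holder_linear (bflip m)).
apply: holder2P.
pose RA (i : R * R) := A i.2 - A i.1 - A' i.1 (W i.2 - W i.1).
pose RB (i : R * R) := B i.2 - B i.1 - B' i.1 (W i.2 - W i.1).
apply: (@isO_ext _ _ _ _ _ _ _ (fun i => m (RA i) (B i.1) + m (A i.1) (RB i) +
    m (A i.2 - A i.1) (B i.2 - B i.1))).
  by move=> i _; rewrite product'E /RA /RB !blin_lin; lmod R.
have oA : isO (square T) (gauge2 alpha) 2 RA.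
  exact: (controlled_isO cA square_fst square_snd square_steps).
have oB : isO (square T) (gauge2 alpha) 2 RB.
  exact: (controlled_isO cB square_fst square_snd square_steps).
have dA := isO_holder hA square_fst square_snd square_steps.
have dB := isO_holder hB square_fst square_snd square_steps.
have A0 := isO_bounded alpha0 (gauge2 alpha) hA square_fst.
have B0 := isO_bounded alpha0 (gauge2 alpha) hB square_fst.
have m0 := isO_cst (P := square T) (w := gauge2 alpha) m.
apply: isOD; first apply: isOD.
- exact: (isO_app (isO_app m0 oA) B0).
- exact: (isO_app (isO_app m0 A0) oB).
- exact: (isO_app (isO_app m0 dA) dB).
Qed.

Section RoughIntegral.
Context {L1 L2 : normedModType R} {L : completeNormedModType R}.
Variables (m : blin L1 (blin L2 L)) (A : R -> L1) (A' : R -> blin E L1)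
  (B : R -> L2) (B' : R -> blin E L2).
Hypotheses (cA : controlled T alpha W A A') (cB : controlled T alpha W B B').
Local Notation J := (rough_germ WW m A A' B B').
Let Q t := bten m (A' t) (B' t).

Lemma holder_bten : holder T alpha Q.
Proof.
case: cA => _ hA' _; case: cB => _ hB' _.
have := holder_bilin (btenm m) hA' hB'.
by rewrite (_ : (fun t => _) = Q)//; apply/funext => t; rewrite btenmE.
Qed.

(** By Chen's relation the second level contributes A'_s W_su B'_s W_ut, which
matches A_su B_ut to order 3, and the change of its coefficient from [s] to [u],
of order 1, times the second level on (u, t), of order 2. *)
Lemma rough_germ_delta : isO (ordered3 T) (gauge3 alpha) 3
  (fun i => J i.1.1 i.2 - J i.1.1 i.1.2 - J i.1.2 i.2).
Proof.
case: (hW) => hWh _ chen.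
pose RA (i : R * R * R) := A i.1.2 - A i.1.1 - A' i.1.1 (W i.1.2 - W i.1.1).
pose RB (i : R * R * R) := B i.2 - B i.1.2 - B' i.1.2 (W i.2 - W i.1.2).
pose WA (i : R * R * R) := A' i.1.1 (W i.1.2 - W i.1.1).
pose w3 (i : R * R * R) := W i.2 - W i.1.2.
apply: (@isO_ext _ _ _ _ _ _ _ (fun i => - (m (RA i) (B i.2 - B i.1.2) +
    m (WA i) (RB i) + m (WA i) ((B' i.1.2 - B' i.1.1) (w3 i)) +
    (Q i.1.2 (WW i.1.2 i.2) - Q i.1.1 (WW i.1.2 i.2))))).
  move=> [[s u] t] h /=; have hs := triple_s h; have hu := triple_u h.
  have ht := triple_t h; rewrite /= in hs hu ht.
  have e : WW s t = tens (W u - W s) (W t - W u) + WW s u + WW u t.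
    by rewrite -(chen s u t hs hu ht); lmod R.
  rewrite /rough_germ /RA /RB /WA /w3 /= e -/(Q s) -/(Q u) !(@blinrD _ _ _ (Q s)).
  by rewrite [Q s (tens _ _)]btenE !blin_lin; lmod R.
have oA : isO (ordered3 T) (gauge3 alpha) 2 RA.
  exact: (controlled_isO cA triple_s triple_u triple_su).
have oB : isO (ordered3 T) (gauge3 alpha) 2 RB.
  exact: (controlled_isO cB triple_u triple_t triple_ut).
case: (cA) => hA hA' _; case: (cB) => hB hB' _.
have dB := isO_holder hB triple_u triple_t triple_ut.
have dW := isO_holder hWh triple_s triple_u triple_su.
have dW' := isO_holder hWh triple_u triple_t triple_ut.
have dB' := isO_holder hB' triple_s triple_u triple_su.
have dQ := isO_holder holder_bten triple_s triple_u triple_su.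
have A'0 := isO_bounded alpha0 (gauge3 alpha) hA' triple_s.
have oWA : isO (ordered3 T) (gauge3 alpha) 1 WA by exact: (isO_app A'0 dW).
have m0 := isO_cst (P := ordered3 T) (w := gauge3 alpha) m.
have oWW := second_level_isO triple_u triple_t triple_ut.
apply: isON; apply: isOD; first apply: isOD; first apply: isOD.
- exact: (isO_app (isO_app m0 oA) dB).
- exact: (isO_app (isO_app m0 oWA) oB).
- exact: (isO_app (isO_app m0 oWA) (isO_app dB' dW')).
- exact: (isO_app dQ oWW).
Qed.

Lemma rough_integral_cvg (s t : R) : 0 <= s -> s <= t -> t <= T -> intcvg J s t.
Proof. by have [h _ _] := germ_sewing alpha3 rough_germ_delta; exact: h. Qed.

Lemma rough_integral_add (s u t : R) : 0 <= s -> s <= u -> u <= t -> t <= T ->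
  intlim J s t = intlim J s u + intlim J u t.
Proof. by have [_ h _] := germ_sewing alpha3 rough_germ_delta; exact: h. Qed.

Lemma rough_integral_isO :
  isO (ordered2 T) (gauge2 alpha) 3 (fun i => intlim J i.1 i.2 - J i.1 i.2).
Proof. by have [_ _ h] := germ_sewing alpha3 rough_germ_delta; exact: h. Qed.

Let F t := intlim J 0 t.

Lemma rough_integral_incr (s t : R) : 0 <= s -> s <= t -> t <= T ->
  F t - F s = intlim J s t.
Proof.
by move=> s0 st tT; rewrite /F (rough_integral_add (lexx 0) s0 st tT) addrC addKr.
Qed.

Lemma rough_integral_second_order : isO (ordered2 T) (gauge2 alpha) 3
  (fun i => F i.2 - F i.1 - J i.1 i.2).
Proof.
apply: (isO_ext _ rough_integral_isO) => i [s0 st tT].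
by rewrite rough_integral_incr.
Qed.

(** To order 2 the increment of the integral is A_s B_st, hence A_s B'_s W_st. *)
Lemma rough_integral_controlled :
  controlled T alpha W F (fun t => bcomp (m (A t)) (B' t)).
Proof.
set F' := (fun t => _); case: (hW) => hWh _ _.
case: (cA) => hA hA' _; case: (cB) => hB hB' _.
have hF' : holder T alpha F'.
  by apply: holder_comp => //; exact: holder_linear.
have dW := isO_holder hWh ordered_fst ordered_snd ordered_steps.
have oB := controlled_isO cB ordered_fst ordered_snd ordered_steps.
have A0 := isO_bounded alpha0 (gauge2 alpha) hA ordered_fst.
have m0 := isO_cst (P := ordered2 T) (w := gauge2 alpha) m.
have oWW := second_level_isO ordered_fst ordered_snd ordered_steps.
have Q0 := isO_bounded alpha0 (gauge2 alpha) holder_bten ordered_fst.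
have F'0 := isO_bounded alpha0 (gauge2 alpha) hF' ordered_fst.
have oR : isO (ordered2 T) (gauge2 alpha) 2
    (fun i => F i.2 - F i.1 - F' i.1 (W i.2 - W i.1)).
  apply: (@isO_ext _ _ _ _ _ _ _ (fun i => (F i.2 - F i.1 - J i.1 i.2) +
     m (A i.1) (B i.2 - B i.1 - B' i.1 (W i.2 - W i.1)) + Q i.1 (WW i.1 i.2))).
    move=> i _; rewrite /F' bcompE /rough_germ -/(Q i.1) !blin_lin; lmod R.
  apply: isOD; first apply: isOD.
  - exact: (isO_le ordered_bounded _ rough_integral_second_order).
  - exact: (isO_app (isO_app m0 A0) oB).
  - exact: (isO_app Q0 oWW).
have oF : isO (ordered2 T) (gauge2 alpha) 1 (fun i => F i.2 - F i.1).
  apply: (@isO_ext _ _ _ _ _ _ _ (fun i => (F i.2 - F i.1 - F' i.1 (W i.2 - W i.1)) +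
    F' i.1 (W i.2 - W i.1))); first by move=> i _; rewrite subrK.
  apply: isOD; first exact: (isO_le ordered_bounded _ oR).
  exact: (isO_app F'0 dW).
split.
- apply: holderP; apply: isO_square_sym => //.
  by apply: (isO_ext _ (isON oF)) => i _ /=; rewrite opprB.
- exact: hF'.
apply: holder2P; apply: isO_square_sym => //.
apply: (@isO_ext _ _ _ _ _ _ _ (fun i => - (F i.2 - F i.1 - F' i.1 (W i.2 - W i.1)) +
    (F' i.2 (W i.2 - W i.1) - F' i.1 (W i.2 - W i.1)))).
  by move=> i _ /=; rewrite !blin_lin; lmod R.
apply: isOD; first exact: isON.
exact: (isO_app (isO_holder hF' ordered_fst ordered_snd ordered_steps) dW).
Qed.

(** Subtracting a constant [c] from the integrand subtracts a telescoping sum from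
the sums. The compensators are such integrals with [c] the value at [s], and this
keeps the estimates on them uniform in [s]. *)
Lemma rough_integral_shift c (s t : R) : 0 <= s -> s <= t -> t <= T ->
  psum (rough_germ WW m (fun r => A r - c) A' B B') s pi @[pi --> partitions s t] -->
  intlim J s t - m c (B t - B s).
Proof.
move=> s0 st tT; have PF := partitions_filter st.
have h : psum J s pi - m c (B t - B s) @[pi --> partitions s t] -->
    intlim J s t - m c (B t - B s).
  by apply: cvgB; [exact: rough_integral_cvg|exact: cvg_cst].
apply: (cvg_trans _ h); apply: near_eq_cvg; exists 1 => // pi hpi _.
by rewrite (psum_rough_germ_shift _ _ _ _ _ _ _ hpi).
Qed.

Lemma rough_integral_incr_isO : isO (ordered2 T) (gauge2 alpha) 3
  (fun i => intlim J i.1 i.2 - m (A i.1) (B i.2 - B i.1) -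
    bten m (A' i.1) (B' i.1) (WW i.1 i.2)).
Proof.
apply: (isO_ext _ rough_integral_isO) => i _; rewrite /rough_germ; lmod R.
Qed.

End RoughIntegral.

End RoughIntegration.
Arguments rough_integral_cvg {R T alpha E W WW} alpha3 hW {L1 L2 L} m {A A' B B'}
  cA cB {s t} s0 st tT : rename.
Arguments rough_integral_shift {R T alpha E W WW} alpha3 hW {L1 L2 L} m {A A' B B'}
  cA cB c {s t} s0 st tT : rename.

(** * Evaluation along a controlled path *)

Section Flip.
Context {R : realType} {A B G : normedModType R}.

Lemma bflip_norm (m : blin A (blin B G)) : `|bflip m| <= `|m|.
Proof.
apply: blin_norm_le => // b; apply: blin_norm_le => [|a]; first exact: mulr_ge0.
rewrite bflipE (le_trans (ler_blin _ _))// mulrAC ler_wpM2r// ler_blin//.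
Qed.

Lemma bflipB (m n : blin A (blin B G)) : bflip (m - n) = bflip m - bflip n.
Proof. by apply: blin_ext => b; apply: blin_ext => a; rewrite !(bflipE, blinE). Qed.

End Flip.

Section Jets.
Context {R : realType} {T alpha : R} {E : normedModType R} {V L : normedModType R}.
Context {W : R -> E} {WW : R -> R -> ptensor E E}.
Hypotheses (alpha3 : 3^-1 < alpha).
Let alpha0 := alpha_gt0 alpha3.

(** [ev] and [dev] behave like the evaluation of a function at a point and of its
derivative, uniformly on balls. The proof of the formula keeps the evaluation maps abstract
and relies on bounds of this kind only. *)
Definition jet (ev : V -> blin E L) (dev : V -> blin E (blin V L)) : Prop :=
  forall M : R, exists2 C : R, 0 <= C & forall x y, `|x| <= M -> `|y| <= M ->
    [/\ `|ev y - ev x| <= C * `|y - x|, `|dev y - dev x| <= C * `|y - x| &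
      `|ev y - ev x - bflip (dev x) (y - x)| <= C * `|y - x| ^+ 2].

Lemma holder_ball (X : R -> V) : holder T alpha X ->
  exists M : R, forall t, 0 <= t <= T -> `|X t| <= M.
Proof.
move=> hX; have := @isO_bounded _ T _ alpha0 R (fun t => 0 <= t <= T) (fun=> 0) _ X id hX.
by move=> /(_ (fun _ h => h))[C _ hC]; exists C => t /hC; rewrite mulr1.
Qed.

Variables (ev : V -> blin E L) (dev : V -> blin E (blin V L)).
Hypothesis jetP : jet ev dev.
Variables (Y : R -> V) (Y' : R -> blin E V).
Hypothesis cY : controlled T alpha W Y Y'.

Lemma holder_jet : holder T alpha (ev \o Y) /\ holder T alpha (dev \o Y).
Proof.
case: cY => hY _ _; have [M hM] := holder_ball hY; have [C C0 hC] := jetP M.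
have [D hD] := hY.
split; exists (C * D) => s t hs ht; have [l1 l2 _] := hC _ _ (hM s hs) (hM t ht).
  by rewrite (le_trans l1)// -mulrA ler_wpM2l// hD.
by rewrite (le_trans l2)// -mulrA ler_wpM2l// hD.
Qed.

Lemma jet_second_order : isO (square T) (gauge2 alpha) 2
  (fun i => ev (Y i.2) - ev (Y i.1) - bflip (dev (Y i.1)) (Y i.2 - Y i.1)).
Proof.
case: cY => hY _ _; have [M hM] := holder_ball hY; have [C C0 hC] := jetP M.
have [D D0 hD] := isO_holder hY (@square_fst R T) (@square_snd R T) (@square_steps R T alpha).
exists (C * D ^+ 2) => [|i ti]; first by rewrite mulr_ge0// exprn_ge0.
have [hs ht] := ti; have [_ _ l3] := hC _ _ (hM _ hs) (hM _ ht).
rewrite (le_trans l3)// -mulrA ler_wpM2l// -exprMn; apply: lerXn2r; rewrite ?nnegrE//.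
  by rewrite mulr_ge0// powR_ge0.
exact: hD.
Qed.

Definition jet' t : blin E (blin E L) := bcomp (bflip (dev (Y t))) (Y' t).

Lemma jet'E t p q : jet' t p q = dev (Y t) q (Y' t p).
Proof. by rewrite /jet' bcompE bflipE. Qed.

(** Chain rule: ev(Y_t) - ev(Y_s) is the derivative at Y_s applied to Y_st up to
|Y_st|^2, and Y_st is Y'_s W_st up to order 2. *)
Lemma controlled_jet : controlled T alpha W (fun t => ev (Y t)) jet'.
Proof.
have [h1 h2] := holder_jet; case: (cY) => hY hY' _.
have hf : holder T alpha (fun t => bflip (dev (Y t))).
  have [C hC] := h2; exists C => s t hs ht; rewrite -bflipB.
  by rewrite (le_trans (bflip_norm _))//; exact: hC.
split => //; first exact: holder_comp.
apply: holder2P.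
apply: (@isO_ext _ _ _ _ _ _ _ (fun i =>
  (ev (Y i.2) - ev (Y i.1) - bflip (dev (Y i.1)) (Y i.2 - Y i.1)) +
  bflip (dev (Y i.1)) (Y i.2 - Y i.1 - Y' i.1 (W i.2 - W i.1)))).
  by move=> i _; rewrite /jet' bcompE !(blinrD, blinrN); lmod R.
apply: isOD; first exact: jet_second_order.
apply: (isO_app (n := 0)).
  exact: (isO_bounded alpha0 _ hf (@square_fst R T)).
exact: (controlled_isO cY (@square_fst R T) (@square_snd R T) (@square_steps R T alpha)).
Qed.

End Jets.

Section WeightedJets.
Context {R : realType} {V : normedModType R} {beta : 'I_4 -> R}.
Hypothesis beta_ge0 : forall k, 0 <= beta k.
Local Notation E := (wCn V V beta).

Definition eval0 (y : V) : blin E V := blin_of (fun p : E => p y).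
Definition eval1 (y : V) : blin E (blin V V) := blin_of (fun p : E => frechet p y).
Definition eval2 (y : V) : blin E (blin V (blin V V)) :=
  blin_of (fun p : E => frechet (frechet p) y).

Lemma eval0E y p : eval0 y p = p y.
Proof. by rewrite /eval0 blin_ofE//; exact: (bounded_linear_Dn y (leq0n 3)). Qed.

Lemma eval1E y p : eval1 y p = frechet p y.
Proof. by rewrite /eval1 blin_ofE//; exact: (bounded_linear_Dn y (isT : (1 <= 3)%N)). Qed.

Lemma eval2E y p : eval2 y p = frechet (frechet p) y.
Proof. by rewrite /eval2 blin_ofE//; exact: (bounded_linear_Dn y (isT : (2 <= 3)%N)). Qed.

(** A common bound on the ball of radius [M] for the weights of all the
derivatives. *)
Definition ball_cst (M : R) : R := \sum_(k < 4) (1 + `|M|) `^ beta k.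

Lemma ball_cst_ge0 M : 0 <= ball_cst M.
Proof. by apply: sumr_ge0 => k _; exact: powR_ge0. Qed.

Lemma Dn_ball (M : R) k (p : E) x : (k < 4)%N -> `|x| <= M -> `|Dn k p x| <= ball_cst M * `|p|.
Proof.
move=> k4 xM; rewrite (le_trans (wCn_Dn_le p (Ordinal k4) x))// mulrC ler_wpM2r//.
rewrite /ball_cst (bigD1 (Ordinal k4))//= -[leLHS]addr0; apply: lerD; last first.
  by apply: sumr_ge0 => j _; exact: powR_ge0.
apply: ge0_ler_powR; rewrite ?nnegrE ?addr_ge0//.
by rewrite lerD2l (le_trans xM)// ler_norm.
Qed.

Lemma segment_ball (M r : R) (x y : V) : `|x| <= M -> `|y| <= M -> 0 <= r <= 1 ->
  `|x + r *: (y - x)| <= M.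
Proof.
move=> xM yM /andP[r0 r1].
have -> : x + r *: (y - x) = (1 - r) *: x + r *: y by lmod R.
have r1' : 0 <= 1 - r by rewrite subr_ge0.
rewrite (le_trans (ler_normD _ _))// !normrZ !ger0_norm//.
have := lerD (ler_wpM2l r1' xM) (ler_wpM2l r0 yM); lra.
Qed.

Section Estimates.
Context (M : R) (x y : V).
Hypotheses (xM : `|x| <= M) (yM : `|y| <= M).
Let C := ball_cst M.

Let diffDn (p : E) k z : (k < 3)%N -> differentiable (Dn k p) z.
Proof. by move=> k3; have [h _] := wCn_Cn p; exact: h. Qed.

Let yE : y = x + (y - x). Proof. by rewrite addrC subrK. Qed.

Lemma Dn_lipschitz (p : E) k : (k < 3)%N ->
  `|Dn k p y - Dn k p x| <= C * `|p| * `|y - x|.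
Proof.
move=> k3; rewrite [in leLHS]yE; apply: segment_lipschitz => [z|r r01].
  exact: diffDn.
by apply: (@Dn_ball M k.+1 p) => //; exact: segment_ball.
Qed.

Lemma Dn_taylor1 (p : E) k : (k < 2)%N ->
  `|Dn k p y - Dn k p x - Dn k.+1 p x (y - x)| <= C * `|p| * `|y - x| ^+ 2.
Proof.
move=> k3; rewrite [in X in `|X - _ - _| <= _]yE; apply: segment_taylor1 => [z|z|r r01].
- exact/diffDn/(ltn_trans k3).
- exact: (@diffDn p k.+1).
by apply: (@Dn_ball M k.+2 p) => //; exact: segment_ball.
Qed.

Lemma taylor2 (p : E) : `|p y - p x - frechet p x (y - x) -
  2^-1 *: frechet (frechet p) x (y - x) (y - x)| <= C * `|p| * `|y - x| ^+ 3.
Proof.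
rewrite [in X in `|X - _ - _ - _| <= _]yE; apply: segment_taylor2 => [z|z|z|r r01].
- exact: (@diffDn p 0).
- exact: (@diffDn p 1).
- exact: (@diffDn p 2).
by apply: (@Dn_ball M 3 p) => //; exact: segment_ball.
Qed.

End Estimates.

Lemma jet_Dn k (ev : V -> blin E (mlin V V k)) (dev : V -> blin E (blin V (mlin V V k))) :
  (k < 2)%N -> (forall y p, ev y p = Dn k p y) -> (forall y p, dev y p = Dn k.+1 p y) ->
  jet ev dev.
Proof.
move=> k2 evE devE M; have C0 := ball_cst_ge0 M; exists (ball_cst M) => // x y xM yM; split.
- apply: blin_norm_le => [|p]; first exact: mulr_ge0.
  rewrite blinDE blinNE (evE x) (evE y) mulrAC.
  exact: (Dn_lipschitz xM yM p (ltn_trans k2 _)).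
- apply: blin_norm_le => [|p]; first exact: mulr_ge0.
  rewrite blinDE blinNE (devE x) (devE y) mulrAC.
  exact: (@Dn_lipschitz M x y xM yM p k.+1 k2).
apply: blin_norm_le => [|p]; first by rewrite mulr_ge0 ?exprn_ge0.
rewrite blinDE blinNE blinDE blinNE bflipE (evE x) (evE y) (devE x) mulrAC.
exact: (Dn_taylor1 xM yM p k2).
Qed.

Lemma jet_eval0 : jet eval0 eval1.
Proof. exact: (@jet_Dn 0 eval0 eval1 isT eval0E eval1E). Qed.

Lemma jet_eval1 : jet eval1 eval2.
Proof. exact: (@jet_Dn 1 eval1 eval2 isT eval1E eval2E). Qed.

End WeightedJets.

Section OrderedTriples.
Context {R : realType} {T alpha : R} {L : normedModType R}.

Lemma isO_ut n (f : R * R -> L) : 3^-1 < alpha ->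
  isO (ordered2 T) (gauge2 alpha) n f ->
  isO (ordered3 T) (gauge3 alpha) n (fun i => f (i.1.2, i.2)).
Proof.
move=> alpha3 [C C0 hC]; exists C => // i oi; have [a b c d] := oi.
have := hC (i.1.2, i.2) (And3 (le_trans a b) c d) => /le_trans; apply.
rewrite ler_wpM2l// lerXn2r ?nnegrE ?powR_ge0//; exact: (triple_ut alpha3 oi).
Qed.

End OrderedTriples.

(** * The germs of the formula as rough germs *)

Section RoughGerms.
Context {R : realType} {E : normedModType R} (WW : R -> R -> ptensor E E).

Lemma rint_germE (K1 : normedModType R) (K2 : completeNormedModType R)
    (A : R -> blin K1 K2) A' (B : R -> K1) B' :
  rint_germ WW A A' B B' = rough_germ WW (idL (blin K1 K2)) A A' B B'.
Proof.
apply/funext => s; apply/funext => t; rewrite /rint_germ /rough_germ idLE.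
congr (_ + Defs.lift _ _); apply/funext => p; apply/funext => q.
by rewrite idLE.
Qed.

Lemma rtens_germE (K1 : normedModType R) (B : R -> K1) B' :
  rtens_germ WW B B' = rough_germ WW (tensm K1 K1) B B' B B'.
Proof.
apply/funext => s; apply/funext => t; rewrite /rtens_germ /rough_germ tensmE.
congr (_ + Defs.lift _ _); apply/funext => p; apply/funext => q.
by rewrite tensmE.
Qed.

Lemma rintd_germE (K1 : normedModType R) (K2 : completeNormedModType R)
    (A : R -> blin K1 K2) A' (B : R -> K1) B' :
  rintd_germ WW A A' B B' = rough_germ WW (bflip (idL (blin K1 K2))) B B' A A'.
Proof.
apply/funext => s; apply/funext => t; rewrite /rintd_germ /rough_germ bflipE idLE.
congr (_ + _); rewrite -bcompE; congr (blin_fun _ _).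
apply: lift_unique => p q; rewrite bcompE btenE bflipE idLE.
rewrite /pswap lift_tens; last exact/bounded_bilinear_flip/bounded_bilinear_tens.
have -> : (fun p q => A' s p (B' s q)) = (fun p q => idL (blin K1 K2) (A' s p) (B' s q)).
  by apply/funext => a; apply/funext => b; rewrite idLE.
by rewrite -/(bten (idL (blin K1 K2)) (A' s) (B' s)) btenE idLE.
Qed.

End RoughGerms.

(** * The formula for abstract evaluation maps *)

Section DefectAlgebra.
Context {R : realType} {E : normedModType R} {V K : completeNormedModType R}.

(** The expansion of the formula at the left endpoint, as pure algebra: the lower
case letters stand for the values of the paths at [s] and [t], and the q's for the
operators applied to the second level. The first hypothesis identifies the second
order Taylor term with the one from <Y>, the second is the cancellation of the
second level terms. *)
Lemma defect_algebra (z : blin V K) (d : blin (ptensor V V) K) (a0s a0t : blin E V)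
    (a1 : blin E (blin V V)) (a2 : blin V (blin V V)) (ws wt : E) (g : V) (x : blin V V)
    (y : V) (yy : ptensor V V) (xy yx : V) (qyy : ptensor V V) (qxy qyx qg0 : V)
    (qf qg qh : K) :
  d (tens y y) = z (a2 y y) ->
  qf = qg + qh + z qg0 - d qyy - z qxy - z qyx ->
  (z (a0t wt - a0s ws) + qf) - (z g + qg) - (z (a1 ws y) + qh) -
    2^-1 *: (d yy + z (xy + yx)) =
  z (a0t ws - a0s ws - a1 ws y - 2^-1 *: a2 y y) +
  z (a0t (wt - ws) - a0s (wt - ws) - bflip a1 y (wt - ws)) -
  z (g - (a0s (wt - ws) + qg0)) -
  2^-1 *: d (yy - tens y y + 2 *: qyy) -
  2^-1 *: z ((xy - x y + 2 *: qxy) + (yx - x y + 2 *: qyx)) -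
  z (x y - a1 (wt - ws) y).
Proof.
by move=> dyy ->; rewrite !blin_lin dyy !bflipE; lmod R.
Qed.

End DefectAlgebra.

Section ItoCore.
Context {R : realType} {T alpha : R} {E : normedModType R} {V K : completeNormedModType R}.
Context {W : R -> E} {WW : R -> R -> ptensor E E}.
Hypotheses (alpha3 : 3^-1 < alpha) (hW : rough_path T alpha W WW).
Let alpha0 := alpha_gt0 alpha3.

Variables (ev0 : V -> blin E V) (ev1 : V -> blin E (blin V V))
  (ev2 : V -> blin E (blin V (blin V V))).
Hypotheses (jet0 : jet ev0 ev1) (jet1 : jet ev1 ev2).
Hypothesis taylor : forall M : R, exists2 C : R, 0 <= C &
  forall x y p, `|x| <= M -> `|y| <= M ->
  `|ev0 y p - ev0 x p - ev1 x p (y - x) - 2^-1 *: ev2 x p (y - x) (y - x)| <=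
    C * `|p| * `|y - x| ^+ 3.

Variables (Y : R -> V) (Y' : R -> blin E V).
Hypothesis hY : controlled T alpha W Y Y'.
Variables (Z : R -> blin V K) (Z' : R -> blin E (blin V K)).
Hypothesis hZ : controlled T alpha W Z Z'.

(** The driver is controlled by itself, with the identity as derivative. *)
Let IW : R -> blin E E := fun=> idL E.

Lemma controlled_driver : controlled T alpha W W IW.
Proof.
case: (hW) => hWh _ _; split=> //; first exact: holder_cst.
by exists 0 => s t _ _ _; rewrite idLE subrr normr0 mul0r.
Qed.

(** [A0] and [A1] are the evaluation of functions and of their derivatives at Y_t,
and [U] is DW(t, Y_t). *)
Let A0 t := ev0 (Y t).
Let A1 t := ev1 (Y t).
Let A0' := jet' ev1 Y Y'.
Let A1' := jet' ev2 Y Y'.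
Let F t := A0 t (W t).
Let F' := product' (idL (blin E V)) A0 A0' W IW.
Let U t := A1 t (W t).
Let U' := product' (idL (blin E (blin V V))) A1 A1' W IW.
Let H t := bcomp (Z t) (U t).
Let H' := product' (bcompm V V K) Z Z' U U'.
Let Ggerm := rough_germ WW (idL (blin E V)) A0 A0' W IW.
Let Xgerm := rough_germ WW (idL (blin E (blin V V))) A1 A1' W IW.
Let G t := intlim Ggerm 0 t.
Let X t := intlim Xgerm 0 t.

Let cA0 : controlled T alpha W A0 A0'. Proof. exact: controlled_jet. Qed.
Let cA1 : controlled T alpha W A1 A1'. Proof. exact: controlled_jet. Qed.
Let cW := controlled_driver.

Lemma controlled_F : controlled T alpha W F F'.
Proof.
have := controlled_product alpha3 (idL (blin E V)) cA0 cW.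
rewrite (_ : (fun t => _) = F)//.
by apply/funext => t; rewrite idLE.
Qed.

Lemma controlled_U : controlled T alpha W U U'.
Proof.
have := controlled_product alpha3 (idL (blin E (blin V V))) cA1 cW.
rewrite (_ : (fun t => _) = U)//.
by apply/funext => t; rewrite idLE.
Qed.

Lemma controlled_H : controlled T alpha W H H'.
Proof.
have := controlled_product alpha3 (bcompm V V K) hZ controlled_U.
rewrite (_ : (fun t => _) = H)//.
by apply/funext => t; rewrite bcompmE.
Qed.

(** The derivative of int A dW is A itself. *)
Lemma controlled_G : controlled T alpha W G A0.
Proof.
have := rough_integral_controlled alpha3 hW (idL (blin E V)) cA0 cW.
rewrite (_ : (fun t => bcomp _ _) = A0)//.
by apply/funext => t; apply: blin_ext => p; rewrite bcompE !idLE.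
Qed.

Lemma controlled_X : controlled T alpha W X A1.
Proof.
have := rough_integral_controlled alpha3 hW (idL (blin E (blin V V))) cA1 cW.
rewrite (_ : (fun t => bcomp _ _) = A1)//.
by apply/funext => t; apply: blin_ext => p; rewrite bcompE !idLE.
Qed.

Let JF := rough_germ WW (idL (blin V K)) Z Z' F F'.
Let JG := rough_germ WW (idL (blin V K)) Z Z' G A0.
Let JH := rough_germ WW (idL (blin V K)) H H' Y Y'.
Let JYY := rough_germ WW (tensm V V) Y Y' Y Y'.
Let JXY := rough_germ WW (idL (blin V V)) X A1 Y Y'.
Let JYX := rough_germ WW (bflip (idL (blin V V))) Y Y' X A1.

Let YY s t : ptensor V V := tens (Y t - Y s) (Y t - Y s) -
  2 *: intlim (rough_germ WW (tensm V V) (fun r => Y r - Y s) Y' Y Y') s t.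
Let XY s t : V := (X t - X s) (Y t - Y s) -
  2 *: intlim (rough_germ WW (idL (blin V V)) (fun r => X r - X s) A1 Y Y') s t.
Let YX s t : V := (X t - X s) (Y t - Y s) -
  2 *: intlim (rough_germ WW (bflip (idL (blin V V))) (fun r => Y r - Y s) Y' X A1) s t.

Lemma compensators_cvg (s t : R) : 0 <= s -> s <= t -> t <= T ->
  [/\ intcvg (rough_germ WW (tensm V V) (fun r => Y r - Y s) Y' Y Y') s t,
   intcvg (rough_germ WW (idL (blin V V)) (fun r => X r - X s) A1 Y Y') s t &
   intcvg (rough_germ WW (bflip (idL (blin V V))) (fun r => Y r - Y s) Y' X A1) s t].
Proof.
move=> s0 st tT; have PF := partitions_filter st; split.
- exact: (cvgP _ (rough_integral_shift alpha3 hW (tensm V V) hY hY (Y s) s0 st tT)).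
- exact: (cvgP _ (rough_integral_shift alpha3 hW (idL _) controlled_X hY (X s) s0 st tT)).
- exact: (cvgP _ (rough_integral_shift alpha3 hW (bflip (idL _)) hY controlled_X (Y s) s0 st tT)).
Qed.

Lemma YY_E (s t : R) : 0 <= s -> s <= t -> t <= T ->
  YY s t = tens (Y t - Y s) (Y t - Y s) -
    2 *: (intlim JYY s t - tens (Y s) (Y t - Y s)).
Proof.
move=> s0 st tT; have PF := partitions_filter st.
rewrite /YY; congr (_ - 2 *: _); rewrite -tensmE; apply: cvg_lim => //.
exact: (rough_integral_shift alpha3 hW (tensm V V) hY hY).
Qed.

Lemma XY_E (s t : R) : 0 <= s -> s <= t -> t <= T ->
  XY s t = (X t - X s) (Y t - Y s) - 2 *: (intlim JXY s t - X s (Y t - Y s)).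
Proof.
move=> s0 st tT; have PF := partitions_filter st.
have -> : X s (Y t - Y s) = idL (blin V V) (X s) (Y t - Y s) by rewrite idLE.
rewrite /XY; congr (_ - 2 *: _); apply: cvg_lim => //.
exact: (rough_integral_shift alpha3 hW (idL _) controlled_X hY).
Qed.

Lemma YX_E (s t : R) : 0 <= s -> s <= t -> t <= T ->
  YX s t = (X t - X s) (Y t - Y s) - 2 *: (intlim JYX s t - (X t - X s) (Y s)).
Proof.
move=> s0 st tT; have PF := partitions_filter st.
have -> : (X t - X s) (Y s) = bflip (idL (blin V V)) (Y s) (X t - X s).
  by rewrite bflipE idLE.
rewrite /YX; congr (_ - 2 *: _); apply: cvg_lim => //.
exact: (rough_integral_shift alpha3 hW _ hY controlled_X).
Qed.

Let XYX s t : V := XY s t + YX s t.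

(** Integration by parts: the sum of the two compensators is twice the difference
between the increment of X Y and int X dY + int dX (Y), all of which are
additive. *)
Lemma XYX_add (s u t : R) : 0 <= s -> s <= u -> u <= t -> t <= T ->
  XYX s t = XYX s u + XYX u t.
Proof.
move=> s0 su ut tT; have uT := le_trans ut tT; have u0 := le_trans s0 su.
have st := le_trans su ut.
have a1 := rough_integral_add alpha3 hW (idL (blin V V)) controlled_X hY s0 su ut tT.
have a2 := rough_integral_add alpha3 hW (bflip (idL (blin V V))) hY controlled_X s0 su ut tT.
rewrite /XYX !XY_E// !YX_E// /JXY /JYX a1 a2.
rewrite !blin_lin.
lmod R.
Qed.

Let P2 := ordered2 T.
Let w2 := gauge2 alpha.

(** The integral in a compensator has an integrand that vanishes at [s], so only
the second level term of its germ is left. *)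
Lemma YY_rem : isO P2 w2 3 (fun i => YY i.1 i.2 - tens (Y i.2 - Y i.1) (Y i.2 - Y i.1) +
  2 *: bten (tensm V V) (Y' i.1) (Y' i.1) (WW i.1 i.2)).
Proof.
have h := isOZ (- 2) (rough_integral_incr_isO alpha3 hW (tensm V V) hY hY).
apply: (isO_ext _ h) => i [s0 st tT]; rewrite YY_E// tensmE -/JYY; lmod R.
Qed.

Lemma XY_rem : isO P2 w2 3 (fun i => XY i.1 i.2 - (X i.2 - X i.1) (Y i.2 - Y i.1) +
  2 *: bten (idL (blin V V)) (A1 i.1) (Y' i.1) (WW i.1 i.2)).
Proof.
have h := isOZ (- 2) (rough_integral_incr_isO alpha3 hW (idL (blin V V)) controlled_X hY).
apply: (isO_ext _ h) => i [s0 st tT]; rewrite XY_E// idLE -/JXY; lmod R.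
Qed.

Lemma YX_rem : isO P2 w2 3 (fun i => YX i.1 i.2 - (X i.2 - X i.1) (Y i.2 - Y i.1) +
  2 *: bten (bflip (idL (blin V V))) (Y' i.1) (A1 i.1) (WW i.1 i.2)).
Proof.
have h := isOZ (- 2) (rough_integral_incr_isO alpha3 hW (bflip (idL (blin V V))) hY controlled_X).
apply: (isO_ext _ h) => i [s0 st tT]; rewrite YX_E// bflipE idLE -/JYX; lmod R.
Qed.

Lemma taylor_along_path : isO P2 w2 3 (fun i => A0 i.2 (W i.1) - A0 i.1 (W i.1) -
  A1 i.1 (W i.1) (Y i.2 - Y i.1) -
  2^-1 *: ev2 (Y i.1) (W i.1) (Y i.2 - Y i.1) (Y i.2 - Y i.1)).
Proof.
case: (hY) => hYh _ _; case: (hW) => hWh _ _.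
have [M hM] := holder_ball alpha3 hYh; have [C C0 hC] := taylor M.
have [N hN] := holder_ball alpha3 hWh.
have [D D0 hD] := isO_holder hYh (@ordered_fst R T) (@ordered_snd R T) (@ordered_steps R T alpha).
exists (C * `|N| * D ^+ 3) => [|i oi]; first by rewrite !mulr_ge0// exprn_ge0.
have hs := ordered_fst oi; have ht := ordered_snd oi.
rewrite (le_trans (hC _ _ _ (hM _ hs) (hM _ ht)))// -[leRHS]mulrA -exprMn.
apply: ler_pM; rewrite ?mulr_ge0 ?exprn_ge0//.
  by rewrite ler_wpM2l// (le_trans (hN _ hs))// ler_norm.
apply: lerXn2r; rewrite ?nnegrE//; last by have := hD _ oi; rewrite expr1.
by rewrite mulr_ge0// powR_ge0.
Qed.

Let D2 t : blin (ptensor V V) K := Defs.lift (fun u v => Z t (ev2 (Y t) (W t) u v)).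

Lemma D2_tens t u v : D2 t (tens u v) = Z t (ev2 (Y t) (W t) u v).
Proof.
apply: lift_tens; apply: bounded_bilinear_post; first exact: blin_bl.
exact: bounded_bilinear_blin.
Qed.

Lemma D2_bounded : isO P2 w2 0 (fun i => D2 i.1).
Proof.
case: (hZ) => hZh _ _; case: (hW) => hWh _ _.
have [_ h2] := holder_jet alpha3 jet1 hY.
have Z0 := isO_bounded alpha0 w2 hZh (@ordered_fst R T).
have W0 := isO_bounded alpha0 w2 hWh (@ordered_fst R T).
have e0 := isO_bounded alpha0 w2 h2 (@ordered_fst R T).
apply: (isO_mul_le (n := 0) (k := 0) _ Z0 (isO_app e0 W0)) => i _ /=.
apply: blin_tens_norm_le => [|u v]; first exact: mulr_ge0.
rewrite D2_tens (le_trans (ler_blin _ _))// -mulrA ler_wpM2l//.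
rewrite (le_trans (ler_blin _ _))// mulrA ler_wpM2r//; exact: ler_blin.
Qed.

(** On a tensor p (x) q the left side is Z'p (q(Y) + DW (Y'q)). The terms
Z (Dp (Y'q)), Z (D^2 W (Y'p) (Y'q)) and Z (Dq (Y'p)), which come from int H dY and
from G, are removed by the compensators. *)
Lemma second_level_cancel s :
  bten (idL (blin V K)) (Z' s) (F' s) =
  bten (idL (blin V K)) (Z' s) (A0 s) + bten (idL (blin V K)) (H' s) (Y' s) +
  bcomp (Z s) (bten (idL (blin E V)) (A0' s) (IW s)) -
  bcomp (D2 s) (bten (tensm V V) (Y' s) (Y' s)) -
  bcomp (Z s) (bten (idL (blin V V)) (A1 s) (Y' s)) -
  bcomp (Z s) (bten (bflip (idL (blin V V))) (Y' s) (A1 s)).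
Proof.
apply: lift_unique => p q; rewrite 5!blinDE 3!blinNE 4!bcompE 7!btenE.
rewrite bflipE tensmE D2_tens !idLE.
rewrite /F' /H' /U' !product'E !idLE !bcompmE blinDE 2!bcompE.
rewrite !jet'E /U.
have -> (f g : blin V V) x : Z s ((f + g) x) = Z s (f x) + Z s (g x).
  by rewrite -blinrD.
rewrite blinrD; lmod R.
Qed.

Let JD2 := young_germ D2 YY.
Let JX := young_germ Z XYX.

(** In each summand of the expansion a factor of order 3 appears: the Taylor
remainder at a fixed time, the Taylor remainder of order 2 times W_st, the
remainders of G and of the compensators, and the remainder of X times Y_st. *)
Lemma defect_isO : isO P2 w2 3 (fun i => JF i.1 i.2 - JG i.1 i.2 - JH i.1 i.2 -
  2^-1 *: (JD2 i.1 i.2 + JX i.1 i.2)).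
Proof.
case: (hZ) => hZh _ _; case: (hW) => hWh _ _; case: (hY) => hYh _ _.
have Z0 := isO_bounded alpha0 w2 hZh (@ordered_fst R T).
have dW := isO_holder hWh (@ordered_fst R T) (@ordered_snd R T) (@ordered_steps R T alpha).
have dY := isO_holder hYh (@ordered_fst R T) (@ordered_snd R T) (@ordered_steps R T alpha).
have oT := isO_ordered2 (jet_second_order alpha3 jet0 hY).
have oG := rough_integral_second_order alpha3 hW (idL (blin E V)) cA0 cW.
have oX := controlled_isO controlled_X (@ordered_fst R T) (@ordered_snd R T) (@ordered_steps R T alpha).
apply: (@isO_ext _ _ _ _ _ _ _ (fun i =>
  Z i.1 (A0 i.2 (W i.1) - A0 i.1 (W i.1) - A1 i.1 (W i.1) (Y i.2 - Y i.1) -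
    2^-1 *: ev2 (Y i.1) (W i.1) (Y i.2 - Y i.1) (Y i.2 - Y i.1)) +
  Z i.1 (A0 i.2 (W i.2 - W i.1) - A0 i.1 (W i.2 - W i.1) -
    bflip (A1 i.1) (Y i.2 - Y i.1) (W i.2 - W i.1)) -
  Z i.1 (G i.2 - G i.1 - Ggerm i.1 i.2) -
  2^-1 *: D2 i.1 (YY i.1 i.2 - tens (Y i.2 - Y i.1) (Y i.2 - Y i.1) +
    2 *: bten (tensm V V) (Y' i.1) (Y' i.1) (WW i.1 i.2)) -
  2^-1 *: Z i.1 ((XY i.1 i.2 - (X i.2 - X i.1) (Y i.2 - Y i.1) +
    2 *: bten (idL (blin V V)) (A1 i.1) (Y' i.1) (WW i.1 i.2)) +
   (YX i.1 i.2 - (X i.2 - X i.1) (Y i.2 - Y i.1) +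
    2 *: bten (bflip (idL (blin V V))) (Y' i.1) (A1 i.1) (WW i.1 i.2))) -
  Z i.1 ((X i.2 - X i.1) (Y i.2 - Y i.1) -
    A1 i.1 (W i.2 - W i.1) (Y i.2 - Y i.1)))).
  move=> [s t] _; rewrite /JF /JG /JH /Ggerm /rough_germ /JD2 /JX /young_germ !idLE.
  rewrite /H bcompE; apply: defect_algebra; first exact: D2_tens.
  by rewrite second_level_cancel -!bcompE.
apply: isOB; first apply: isOB; first apply: isOB; first apply: isOB; first apply: isOD.
- exact: (isO_app Z0 taylor_along_path).
- exact: (isO_app Z0 (isO_app oT dW)).
- exact: (isO_app Z0 oG).
- exact: (isOZ _ (isO_app D2_bounded YY_rem)).
- exact: (isOZ _ (isO_app Z0 (isOD XY_rem YX_rem))).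
- exact: (isO_app Z0 (isO_app oX dY)).
Qed.

Let dY2 : isO P2 w2 2 (fun i => tens (Y i.2 - Y i.1) (Y i.2 - Y i.1)).
Proof.
case: hY => hYh _ _.
have dY := isO_holder hYh (@ordered_fst R T) (@ordered_snd R T) (@ordered_steps R T alpha).
exact: (isO_tens dY dY).
Qed.

Let dXY2 : isO P2 w2 2 (fun i => (X i.2 - X i.1) (Y i.2 - Y i.1)).
Proof.
case: hY => hYh _ _; case: controlled_X => hXh _ _.
have dY := isO_holder hYh (@ordered_fst R T) (@ordered_snd R T) (@ordered_steps R T alpha).
have dX := isO_holder hXh (@ordered_fst R T) (@ordered_snd R T) (@ordered_steps R T alpha).
exact: (isO_app dX dY).
Qed.

Let remainder_isO (L : completeNormedModType R) (Q q : R * R -> L) (S : R -> blin (ptensor E E) L) :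
  holder T alpha S ->
  isO P2 w2 3 (fun i => Q i - q i + 2 *: S i.1 (WW i.1 i.2)) ->
  isO P2 w2 2 q -> isO P2 w2 2 Q.
Proof.
move=> hS h3 h2; have h := isO_le (ordered_bounded alpha3) (isT : (2 <= 3)%N) h3.
have S0 := isO_bounded alpha0 w2 hS (@ordered_fst R T).
have oWW := second_level_isO hW (@ordered_fst R T) (@ordered_snd R T) (@ordered_steps R T alpha).
have := isOB (isOD h h2) (isOZ 2 (isO_app S0 oWW)).
by apply: isO_ext => i _; lmod R.
Qed.

Lemma YY_isO : isO P2 w2 2 (fun i => YY i.1 i.2).
Proof.
exact: (remainder_isO (holder_bten alpha3 (tensm V V) hY hY) YY_rem dY2).
Qed.

Lemma XY_isO : isO P2 w2 2 (fun i => XY i.1 i.2).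
Proof.
exact: (remainder_isO (holder_bten alpha3 (idL (blin V V)) controlled_X hY) XY_rem dXY2).
Qed.

Lemma YX_isO : isO P2 w2 2 (fun i => YX i.1 i.2).
Proof.
exact: (remainder_isO (holder_bten alpha3 (bflip (idL (blin V V))) hY controlled_X) YX_rem dXY2).
Qed.

(** For an additive Q the defect of the Young germ Z_s Q_st is - Z_su Q_ut, here of
order 1 + 2. *)
Lemma young_XYX_cvg s t : 0 <= s -> s <= t -> t <= T -> intcvg JX s t.
Proof.
have dJ : isO (ordered3 T) (gauge3 alpha) 3
    (fun i => JX i.1.1 i.2 - JX i.1.1 i.1.2 - JX i.1.2 i.2).
  case: hZ => hZh _ _.
  have dZ := isO_holder hZh (@triple_s R T) (@triple_u R T) (@triple_su R T _ alpha3).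
  have oX := isO_ut alpha3 (isOD XY_isO YX_isO).
  apply: (@isO_ext _ _ _ _ _ _ _ (fun i =>
    - (Z i.1.2 (XYX i.1.2 i.2) - Z i.1.1 (XYX i.1.2 i.2)))).
    move=> [[u v] x] [/= u0 uv vx xT].
    by rewrite /JX /young_germ (XYX_add u0 uv vx xT) blinrD; lmod R.
  exact: (isON (isO_app dZ oX)).
by have [h _ _] := germ_sewing alpha3 dJ; exact: h.
Qed.

(** The sums for <Y> are, up to sums that tend to 0, a linear combination of sums
that converge; this gives both their convergence and the formula. *)
Theorem ito_formula (s t : R) : 0 <= s -> s <= t -> t <= T ->
  [/\ intcvg JF s t, intcvg JG s t & intcvg JH s t] /\
  intcvg JD2 s t /\ intcvg JX s t /\
  intlim JF s t = intlim JG s t + intlim JH s t +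
    2^-1 *: (intlim JD2 s t + intlim JX s t) /\
  (intcvg (young_germ Z XY) s t \/ intcvg (young_germ Z YX) s t ->
    [/\ intcvg (young_germ Z XY) s t, intcvg (young_germ Z YX) s t &
      intlim JF s t = intlim JG s t + intlim JH s t +
        2^-1 *: (intlim JD2 s t + intlim (young_germ Z XY) s t +
                 intlim (young_germ Z YX) s t)]).
Proof.
move=> s0 st tT; have PF := partitions_filter st.
have cF : intcvg JF s t by exact: (rough_integral_cvg alpha3 hW _ hZ controlled_F).
have cG : intcvg JG s t by exact: (rough_integral_cvg alpha3 hW _ hZ controlled_G).
have cH : intcvg JH s t by exact: (rough_integral_cvg alpha3 hW _ controlled_H hY).
have cX := young_XYX_cvg s0 st tT.
have c0 := @isO_negligible _ T alpha _
  (fun u v => JF u v - JG u v - JH u v - 2^-1 *: (JD2 u v + JX u v)) s t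
  alpha3 defect_isO s0 st tT.
pose l := 2 *: (intlim JF s t - intlim JG s t - intlim JH s t - 0) - intlim JX s t.
have cD : psum JD2 s pi @[pi --> partitions s t] --> l.
  have -> : (fun pi => psum JD2 s pi) = (fun pi =>
      2 *: (psum JF s pi - psum JG s pi - psum JH s pi -
        psum (fun u v => JF u v - JG u v - JH u v - 2^-1 *: (JD2 u v + JX u v)) s pi) -
      psum JX s pi).
    by apply/funext => pi; rewrite !psumB psumZ psumD; lmod R.
  apply: cvgB => //; apply: cvgZl_tmp; apply: cvgB => //.
  by apply: cvgB => //; apply: cvgB.
have eD : intlim JD2 s t = l by exact: cvg_lim cD.
have ito : intlim JF s t = intlim JG s t + intlim JH s t +
    2^-1 *: (intlim JD2 s t + intlim JX s t) by rewrite eD /l; lmod R.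
split; first by split; [exact: cF|exact: cG|exact: cH].
split; first exact: cvgP cD.
split; first exact: cX.
split; first exact: ito.
move=> h.
have eJX pi : psum JX s pi = psum (young_germ Z XY) s pi + psum (young_germ Z YX) s pi.
  by rewrite -psumD; apply: eq_psum => u v; rewrite /JX /young_germ blinrD.
have cXY : intcvg (young_germ Z XY) s t.
  case: h => h; first exact: h.
  have e : psum (young_germ Z XY) s = psum JX s \- psum (young_germ Z YX) s.
    by apply/funext => pi; rewrite /= eJX addrK.
  rewrite /intcvg e; exact: (cvgP _ (cvgB cX h)).
have cYX : intcvg (young_germ Z YX) s t.
  have e : psum (young_germ Z YX) s = psum JX s \- psum (young_germ Z XY) s.
    by apply/funext => pi; rewrite /= eJX addrC addKr.
  rewrite /intcvg e; exact: (cvgP _ (cvgB cX cXY)).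
split; [exact: cXY|exact: cYX|].
rewrite ito; congr (_ + 2^-1 *: _); rewrite -addrA; congr (_ + _).
apply: cvg_lim => //.
have -> : psum JX s = psum (young_germ Z XY) s \+ psum (young_germ Z YX) s.
  by apply/funext => pi; exact: eJX.
exact: (cvgD cXY cYX).
Qed.

End ItoCore.

(** * The formula for weighted spaces of functions *)

Section Compensators.
Context {R : realType} {E : normedModType R} {V : completeNormedModType R}.
Variables (WW : R -> R -> ptensor E E) (X : R -> blin V V) (X' : R -> blin E (blin V V))
  (Y : R -> V) (Y' : R -> blin E V).

(** Subtracting a constant from Y does not change its increments. *)
Lemma rtens_germ_incr c :
  rtens_germ WW (fun r => Y r - c) Y' =
  rough_germ WW (tensm V V) (fun r => Y r - c) Y' Y Y'.
Proof.
rewrite rtens_germE; apply/funext => u; apply/funext => v; rewrite /rough_germ.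
by congr (tensm V V _ _ + _); lmod R.
Qed.

Lemma bracketE : bracket WW Y Y' = (fun s t => tens (Y t - Y s) (Y t - Y s) -
  2 *: intlim (rough_germ WW (tensm V V) (fun r => Y r - Y s) Y' Y Y') s t).
Proof.
apply/funext => s; apply/funext => t; congr (_ - 2 *: intlim _ s t).
exact: rtens_germ_incr.
Qed.

Lemma bracketXYE : bracketXY WW X X' Y Y' = (fun s t => (X t - X s) (Y t - Y s) -
  2 *: intlim (rough_germ WW (idL (blin V V)) (fun r => X r - X s) X' Y Y') s t).
Proof.
apply/funext => s; apply/funext => t; congr (_ - 2 *: intlim _ s t).
exact: rint_germE.
Qed.

Lemma bracketYXE : bracketYX WW X X' Y Y' = (fun s t => (X t - X s) (Y t - Y s) -
  2 *: intlim (rough_germ WW (bflip (idL (blin V V))) (fun r => Y r - Y s) Y' X X') s t).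
Proof.
apply/funext => s; apply/funext => t; congr (_ - 2 *: intlim _ s t).
exact: rintd_germE.
Qed.

End Compensators.

Section Identification.
Context {R : realType} {V K : completeNormedModType R} {beta : 'I_4 -> R}.
Local Notation E := (wCn V V beta).
Variables (W : R -> E) (WW : R -> R -> ptensor E E) (Y : R -> V) (Y' : R -> blin E V)
  (Z : R -> blin V K) (Z' : R -> blin E (blin V K)).
Local Notation A0 := (fun t => @eval0 R V beta (Y t)).
Local Notation A1 := (fun t => @eval1 R V beta (Y t)).
Local Notation IW := (fun=> idL E).

Lemma ItoF_E : ItoF W Y = (fun t => eval0 (Y t) (W t)).
Proof. by apply/funext => t; rewrite eval0E. Qed.

Lemma ItoF'_E : ItoF' W Y Y' = product' (idL (blin E V)) A0 (jet' eval1 Y Y') W IW.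
Proof.
apply/funext => t; apply: blin_ext => p.
by rewrite (ItoF'E W Y Y' t p) product'E !idLE jet'E eval0E eval1E addrC.
Qed.

Lemma ItoG_germE : ItoG_germ W WW Y Y' =
  rough_germ WW (idL (blin E V)) A0 (jet' eval1 Y Y') W IW.
Proof.
apply/funext => s; apply/funext => t; rewrite /ItoG_germ /rough_germ idLE eval0E.
congr (_ + Defs.lift _ _); apply/funext => p; apply/funext => q.
by rewrite !idLE jet'E eval1E.
Qed.

Lemma ItoG_E : ItoG W WW Y Y' =
  (fun t => intlim (rough_germ WW (idL (blin E V)) A0 (jet' eval1 Y Y') W IW) 0 t).
Proof. by apply/funext => t; rewrite /ItoG ItoG_germE. Qed.

Lemma ItoX_germE : ItoX_germ W WW Y Y' =
  rough_germ WW (idL (blin E (blin V V))) A1 (jet' eval2 Y Y') W IW.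
Proof.
apply/funext => s; apply/funext => t; rewrite /ItoX_germ /rough_germ idLE eval1E.
congr (_ + Defs.lift _ _); apply/funext => p; apply/funext => q.
by rewrite !idLE jet'E eval2E.
Qed.

Lemma ItoX_E : ItoX W WW Y Y' =
  (fun t => intlim (rough_germ WW (idL (blin E (blin V V))) A1 (jet' eval2 Y Y') W IW) 0 t).
Proof. by apply/funext => t; rewrite /ItoX ItoX_germE. Qed.

Lemma ItoH_E : ItoH W Y Z = (fun t => bcomp (Z t) (eval1 (Y t) (W t))).
Proof. by apply/funext => t; rewrite eval1E. Qed.

Lemma ItoH'_E : ItoH' W Y Y' Z Z' = product' (bcompm V V K) Z Z'
  (fun t => eval1 (Y t) (W t))
  (product' (idL (blin E (blin V V))) A1 (jet' eval2 Y Y') W IW).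
Proof.
apply/funext => t; apply: blin_ext => p; apply: blin_ext => v.
rewrite (ItoH'E W Y Y' Z Z' t p v) !product'E !idLE !bcompmE blinDE 2!bcompE !jet'E.
have -> (f g : blin V V) x : Z t ((f + g) x) = Z t (f x) + Z t (g x) by rewrite -blinrD.
by rewrite (eval1E (Y t) (W t)) (eval1E (Y t) p) eval2E -addrA [X in _ + X]addrC.
Qed.

Lemma ItoD2_E : ItoD2 W Y Z =
  (fun t => Defs.lift (fun u v => Z t (eval2 (Y t) (W t) u v))).
Proof. by apply/funext => t; rewrite eval2E. Qed.

End Identification.

Section TaylorEvaluation.
Context {R : realType} {V : normedModType R} {beta : 'I_4 -> R}.
Hypothesis beta_ge0 : forall k, 0 <= beta k.

Lemma taylor_eval (M : R) : exists2 C : R, 0 <= C &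
  forall x y (p : wCn V V beta), `|x| <= M -> `|y| <= M ->
  `|eval0 y p - eval0 x p - eval1 x p (y - x) - 2^-1 *: eval2 x p (y - x) (y - x)| <=
    C * `|p| * `|y - x| ^+ 3.
Proof.
exists (@ball_cst R beta M) => [|x y p xM yM]; first exact: ball_cst_ge0.
rewrite (eval0E x p) (eval0E y p) (eval1E x p) (eval2E x p).
exact: taylor2.
Qed.

End TaylorEvaluation.

Theorem theorem5p11 (R : realType) (V K : completeNormedModType R)
  (sepV : separable V) (sepK : separable K)
  (T alpha : R) (T_gt0 : 0 < T)
  (alpha_gt : 3^-1 < alpha) (alpha_le : alpha <= 2^-1)
  (beta : 'I_4 -> R) (beta_ge0 : forall k, 0 <= beta k)
  (W : R -> wCn V V beta)
  (WW : R -> R -> ptensor (wCn V V beta) (wCn V V beta))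
  (hW : rough_path T alpha W WW)
  (Y : R -> V) (Y' : R -> blin (wCn V V beta) V)
  (hY : controlled T alpha W Y Y')
  (Z : R -> blin V K) (Z' : R -> blin (wCn V V beta) (blin V K))
  (hZ : controlled T alpha W Z Z') :
  let F := ItoF W Y in let F' := ItoF' W Y Y' in
  let G := ItoG W WW Y Y' in let G' := ItoG' beta Y in
  let H := ItoH W Y Z in let H' := ItoH' W Y Y' Z Z' in
  let X := ItoX W WW Y Y' in let X' := ItoX' beta Y in
  let YY := bracket WW Y Y' in
  let XY := bracketXY WW X X' Y Y' in
  let YX := bracketYX WW X X' Y Y' in
  let XYX := fun s t => XY s t + YX s t in
  let D2 := ItoD2 W Y Z in
  let ZdF := rint_germ WW Z Z' F F' in
  let ZdG := rint_germ WW Z Z' G G' in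
  let HdY := rint_germ WW H H' Y Y' in
  (* G, X and the compensators are well defined *)
  (forall t, 0 <= t <= T ->
    intcvg (ItoG_germ W WW Y Y') 0 t /\ intcvg (ItoX_germ W WW Y Y') 0 t) /\
  (forall s t, 0 <= s -> s <= t -> t <= T ->
    [/\ intcvg (rtens_germ WW (fun r => Y r - Y s) Y') s t,
        intcvg (rint_germ WW (fun r => X r - X s) X' Y Y') s t &
        intcvg (rintd_germ WW X X' (fun r => Y r - Y s) Y') s t]) /\
  (* the rough integrals are integrals of controlled paths *)
  [/\ controlled T alpha W F F', controlled T alpha W G G',
      controlled T alpha W H H' & controlled T alpha W X X'] /\
  (* the compensators are 2 alpha-Hoelder *)
  [/\ holder2_le T alpha YY, holder2_le T alpha XY & holder2_le T alpha YX] /\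
  (forall s t, 0 <= s -> s <= t -> t <= T ->
    [/\ intcvg ZdF s t, intcvg ZdG s t & intcvg HdY s t] /\
    intcvg (young_germ D2 YY) s t /\ intcvg (young_germ Z XYX) s t /\
    (* the Ito formula, the last two Young integrals being taken jointly *)
    intlim ZdF s t = intlim ZdG s t + intlim HdY s t +
      2^-1 *: (intlim (young_germ D2 YY) s t + intlim (young_germ Z XYX) s t) /\
    (* the Ito formula with separate Young integrals, when they exist *)
    (intcvg (young_germ Z XY) s t \/ intcvg (young_germ Z YX) s t ->
      [/\ intcvg (young_germ Z XY) s t, intcvg (young_germ Z YX) s t &
        intlim ZdF s t = intlim ZdG s t + intlim HdY s t +
          2^-1 *: (intlim (young_germ D2 YY) s t +
                   intlim (young_germ Z XY) s t +
                   intlim (young_germ Z YX) s t)])).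
Proof.
have jet0 := @jet_eval0 R V beta beta_ge0; have jet1 := @jet_eval1 R V beta beta_ge0.
have ty := @taylor_eval R V beta beta_ge0.
cbv zeta.
have eG' : ItoG' beta Y = (fun t => eval0 (Y t)) by [].
have eX' : ItoX' beta Y = (fun t => eval1 (Y t)) by [].
rewrite ItoF_E ItoF'_E ItoG_E ItoG_germE ItoX_E ItoX_germE ItoH_E ItoH'_E ItoD2_E eG' eX'.
rewrite bracketE bracketXYE bracketYXE.
rewrite (rint_germE WW Z Z' (fun t => eval0 (Y t) (W t))).
rewrite (rint_germE WW Z Z' _ (fun t => eval0 (Y t))).
rewrite (rint_germE WW _ _ Y Y').
have cX := controlled_X alpha_gt hW jet1 hY.
split.
  move=> t /andP[t0 tT]; split.
    exact: (rough_integral_cvg alpha_gt hW _ (controlled_jet alpha_gt jet0 hY) (controlled_driver hW)).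
  exact: (rough_integral_cvg alpha_gt hW _ (controlled_jet alpha_gt jet1 hY) (controlled_driver hW)).
split.
  move=> s t s0 st tT; rewrite rtens_germ_incr rint_germE rintd_germE.
  exact: (compensators_cvg alpha_gt hW jet1 hY s0 st tT).
split.
  split; last exact: cX.
  - exact: (controlled_F alpha_gt hW jet0 hY).
  - exact: (controlled_G alpha_gt hW jet0 hY).
  - exact: (controlled_H alpha_gt hW jet1 hY hZ).
split.
  split.
  - exact: (holder2_leP (YY_isO alpha_gt hW hY)).
  - exact: (holder2_leP (XY_isO alpha_gt hW jet1 hY)).
  - exact: (holder2_leP (YX_isO alpha_gt hW jet1 hY)).
exact: (ito_formula alpha_gt hW jet0 jet1 ty hY hZ).
Qed.
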